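(* Let $(X,\mathsf d)$ be a complete separable metric space and let $\mathfrak m_n,\mathfrak m\in\mathscr M^+_{loc}(X)$ with $\mathfrak m_n$ weakly convergent to $\mathfrak m$. Let $\boldsymbol b_n\in\mathrm{Der}^2_{loc}(X,\mathsf d,\mathfrak m_n)\cap\mathrm{Div}^1_{loc}(X,\mathsf d,\mathfrak m_n)$ satisfy, for some $\bar x\in X$ and all $R>0$, $$\sup_n\int_{B_R(\bar x)}|\boldsymbol b_n|^2\,d\mathfrak m_n<\infty,\qquad \sup_n\int_{B_R(\bar x)}\Theta(|\mathrm{div}\,\boldsymbol b_n|)\,d\mathfrak m_n<\infty$$ for some function $\Theta=\Theta_R:[0,\infty)\to[0,\infty]$ with more than linear growth at infinity (i.e. $\Theta(z)/z\to\infty$ as $z\to\infty$). Then there exist a subsequence $\boldsymbol b_{n(k)}$ and $\boldsymbol b\in\mathrm{Der}^2_{loc}(X,\mathsf d,\mathfrak m)\cap\mathrm{Div}^1_{loc}(X,\mathsf d,\mathfrak m)$ such that $\boldsymbol b_{n(k)}$ weakly converge to $\boldsymbol b$ in duality with $\mathscr A_{bs}$, i.e. $$\lim_{k\to\infty}\int_X\boldsymbol b_{n(k)}(f)\,v\,d\mathfrak m_{n(k)}=\int_X\boldsymbol b(f)\,v\,d\mathfrak m\qquad\forall f\in\mathscr A_{bs},\ v\in C_b(X).$$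
   Context: $\mathscr M^+_{loc}(X)$: nonnegative Borel measures finite on bounded sets. $C_b(X)$, $\mathrm{Lip}_b(X)$: bounded continuous, bounded Lipschitz functions; $C_{bs}(X)$, $\mathrm{Lip}_{bs}(X)$: bounded continuous, Lipschitz functions with bounded support. $\mathfrak m_n$ weakly converge to $\mathfrak m$ if $\int v\,d\mathfrak m_n\to\int v\,d\mathfrak m$ for all $v\in C_{bs}(X)$. $L^0(X,\mathfrak m)$: real $\mathfrak m$-measurable functions; $L^p_{loc}$: $p$-integrability on bounded subsets. Algebras: fix a countable dense set $D\subset X$. $\mathscr A\subset\mathrm{Lip}_b(X)$ is the smallest set containing all $\min\{\mathsf d(\cdot,x),k\}$, $k\in\mathbb Q\cap[0,\infty)$, $x\in D$, which is a vector space over $\mathbb Q$ stable under products and lattice operations; $\mathscr A_{bs}$ is the subalgebra of functions with bounded support. Minimal relaxed slope (w.r.t. a measure $\mathfrak m$): $\mathrm{Lip}_af(x)=\lim_{r\to0^+}\mathrm{Lip}(f|_{B_r(x)})$; $\mathsf{Ch}(f)=\inf\{\liminf_n\frac12\int\mathrm{Lip}_a^2(f_n)\,d\mathfrak m:\ f_n\in\mathrm{Lip}_b(X)\cap L^2(X,\mathfrak m),\ f_n\to f\text{ in }L^2\}$; $H^{1,2}(X,\mathsf d,\mathfrak m)=\{f\in L^2:\mathsf{Ch}(f)<\infty\}$; for $f\in H^{1,2}$, $|\mathrm Df|$ is the element of smallest $L^2$ norm among functions in $L^2$ that are $\ge$ some weak $L^2$ limit of $\mathrm{Lip}_a(f_n)$,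 $f_n\in\mathrm{Lip}_b\cap L^2$, $f_n\to f$ in $L^2$. For $f\in\mathrm{Lip}_b(X)$, $|\mathrm Df|$ is defined by locality: it equals $|\mathrm Df_R|$ $\mathfrak m$-a.e. on $B_R(\bar x)$ for any $f_R\in\mathrm{Lip}_{bs}(X)$ with $f_R=f$ on $B_R(\bar x)$. Derivations: a derivation on $(X,\mathsf d,\mathfrak m)$ is a linear map $\boldsymbol b:\mathrm{Lip}_b(X)\to L^0(X,\mathfrak m)$ such that, for some $h\in L^0(X,\mathfrak m)$, $|\boldsymbol b(f)|\le h|\mathrm Df|$ $\mathfrak m$-a.e. for all $f\in\mathrm{Lip}_b(X)$; the $\mathfrak m$-a.e. smallest such $h$ is denoted $|\boldsymbol b|$. $\mathrm{Der}^p_{loc}(X,\mathsf d,\mathfrak m)$: derivations with $|\boldsymbol b|\in L^p_{loc}(X,\mathfrak m)$. $\boldsymbol b\in\mathrm{Der}^1_{loc}$ has divergence in $L^1_{loc}$ if there is $g=:\mathrm{div}\,\boldsymbol b\in L^1_{loc}(X,\mathfrak m)$ (necessarily unique) with $-\int_X\boldsymbol b(f)\,d\mathfrak m=\int_Xfg\,d\mathfrak m$ for all $f\in\mathrm{Lip}_{bs}(X)$. $\mathrm{Div}^1_{loc}(X,\mathsf d,\mathfrak m)$ is the set of $\boldsymbol b\in\mathrm{Der}^1_{loc}$ with $\mathrm{div}\,\boldsymbol b\in L^1_{loc}$. All of this is applied with $\mathfrak m_n$ in place of $\mathfrak m$ for $\boldsymbol b_n$. *)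

(* Defs.v *)
From HB Require Import structures.
From mathcomp Require Import all_boot all_order all_algebra.
From mathcomp Require Import all_classical all_reals all_analysis.

Set Implicit Arguments.
Unset Strict Implicit.
Unset Printing Implicit Defensive.

Import Order.TTheory GRing.Theory Num.Theory.
Import numFieldNormedType.Exports.

Local Open Scope classical_set_scope.
Local Open Scope ring_scope.

(* MathComp-Analysis has complete pseudometric spaces and metric spaces, but not
   their join.  Completeness there includes the choice of a point. *)
#[short(type="completeMetricType")]
HB.structure Definition CompleteMetric (R : numDomainType) :=
  {T of Metric R T & Complete T}.

(* X with its Borel sigma-algebra; convertible to X as a type. *)
Notation borel X := (g_sigma_algebraType (@open X)).

Section function_classes.
Context {R : realType} {X : completeMetricType R}.
Implicit Types (B D : set X) (f v : X -> R).

Definition metric_bounded B := exists x r, B `<=` ball x r.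

Definition bounded_support f := metric_bounded [set x | f x != 0].

Definition Lip f := exists L : R, forall x y, `|f x - f y| <= L * mdist x y.

Definition Lip_b f := Lip f /\ bounded_fun f.

Definition Lip_bs f := Lip_b f /\ bounded_support f.

Definition C_b v := continuous v /\ bounded_fun v.

Definition C_bs v := C_b v /\ bounded_support v.

Definition rat_lattice_algebra (M : set (X -> R)) :=
  [/\ M (cst 0),
      forall f g, M f -> M g -> M (fun x => f x + g x),
      forall (q : rat) f, M f -> M (fun x => ratr q * f x),
      forall f g, M f -> M g -> M (fun x => f x * g x) &
      forall f g, M f -> M g ->
        M (fun x => Num.max (f x) (g x)) /\ M (fun x => Num.min (f x) (g x))].

Definition truncated_dists D : set (X -> R) :=
  [set f | exists x (k : rat),
    [/\ D x, 0 <= k & f = fun y => Num.min (mdist y x) (ratr k)]].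

Definition algA D : set (X -> R) :=
  smallest rat_lattice_algebra (truncated_dists D).

Definition algA_bs D : set (X -> R) := algA D `&` bounded_support.

(* Diagonal pairs contribute 0 / 0 = 0, so the supremum is over a nonempty set
   when B is nonempty; it is bounded above when f is Lipschitz on B. *)
Definition lip_const f B : R :=
  sup [set `|f p.1 - f p.2| / mdist p.1 p.2 | p in B `*` B].

Definition lip_a f : X -> R :=
  fun x => lim (lip_const f (ball x r) @[r --> 0^'+]).

End function_classes.

Section measure_notions.
Context {R : realType} {X : completeMetricType R}.
Variable m : {measure set (borel X) -> \bar R}.
Implicit Types (f g h w : X -> R) (b : (X -> R) -> X -> R).

Definition finite_on_bounded :=
  forall B : set (borel X), measurable B -> metric_bounded B -> (m B < +oo)%E.

(* Elements of L^0 are handled through Borel representatives. *)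
Definition L0 f := measurable_fun setT (f : borel X -> R).

Definition Lp_loc (p : R) f := L0 f /\
  forall B : set (borel X), measurable B -> metric_bounded B ->
    m.-integrable B (fun x => (`|f x| `^ p)%:E).

Definition L2 f := (f : borel X -> R) \in Lfun m 2%:E.

Definition L2_cvg (f_ : nat -> X -> R) f :=
  'N[m]_2%:E[(fun x => (f_ n x - f x)%:E)]%E @[n --> \oo] --> 0%E.

Definition L2_weak_cvg (f_ : nat -> X -> R) f :=
  forall g, L2 g ->
    (\int[m]_x (f_ n x * g x)) @[n --> \oo] --> \int[m]_x (f x * g x).

Definition Lip_approx (f_ : nat -> X -> R) f :=
  (forall n, Lip_b (f_ n) /\ L2 (f_ n)) /\ L2_cvg f_ f.

Definition Ch f : \bar R :=
  ereal_inf [set limn_einf (fun n =>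
      2^-1%:E * \int[m]_x (lip_a (f_ n) x ^+ 2)%:E)%E
    | f_ in [set f_ | Lip_approx f_ f]].

Definition H12 f := L2 f /\ (Ch f < +oo)%E.

Definition relaxed_slope f g := L2 g /\
  exists (f_ : nat -> X -> R) w,
    [/\ Lip_approx f_ f,
        forall n, L2 (lip_a (f_ n)),
        L2 w,
        L2_weak_cvg (fun n => lip_a (f_ n)) w &
        \forall x \ae m, w x <= g x].

Definition is_min_relaxed_slope f g :=
  [/\ H12 f, relaxed_slope f g &
      forall h, relaxed_slope f h ->
        ('N[m]_2%:E[EFin \o g] <= 'N[m]_2%:E[EFin \o h])%E].

(* |Df| for f in H^{1,2} *)
Definition min_relaxed_slope f : X -> R :=
  xget (cst 0) (is_min_relaxed_slope f).

Definition is_slope f g := L0 g /\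
  forall x r fr, 0 < r -> Lip_bs fr -> (forall y, ball x r y -> fr y = f y) ->
    \forall y \ae m, ball x r y -> g y = min_relaxed_slope fr y.

(* |Df| for f in Lip_b(X), by locality *)
Definition slope f : X -> R := xget (cst 0) (is_slope f).

(* The values of b outside Lip_b are irrelevant. *)
Definition Lip_b_linear b :=
  (forall f, Lip_b f -> L0 (b f)) /\
  forall (c : R) f g, Lip_b f -> Lip_b g ->
    \forall x \ae m, b (fun y => c * f y + g y) x = c * b f x + b g x.

(* h is required to be nonnegative: otherwise it would be unconstrained from
   below where all slopes vanish, and no smallest h would exist. *)
Definition der_bound b h :=
  [/\ L0 h, \forall x \ae m, 0 <= h x &
      forall f, Lip_b f -> \forall x \ae m, `|b f x| <= h x * slope f x].

Definition derivation b := Lip_b_linear b /\ exists h, der_bound b h.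

Definition is_der_norm b h := der_bound b h /\
  forall h', der_bound b h' -> \forall x \ae m, h x <= h' x.

(* |b| *)
Definition der_norm b : X -> R := xget (cst 0) (is_der_norm b).

Definition Der_loc (p : R) b :=
  derivation b /\ exists h, is_der_norm b h /\ Lp_loc p h.

Definition is_divergence b g := Lp_loc 1 g /\
  forall f, Lip_bs f -> - (\int[m]_x b f x) = \int[m]_x (f x * g x).

Definition divergence b : X -> R := xget (cst 0) (is_divergence b).

Definition Div1_loc b := Der_loc 1 b /\ exists g, is_divergence b g.

End measure_notions.

Definition weak_measure_cvg {R : realType} {X : completeMetricType R}
    (m_ : nat -> {measure set (borel X) -> \bar R})
    (m : {measure set (borel X) -> \bar R}) :=
  forall v : X -> R, C_bs v ->
    (\int[m_ n]_x v x) @[n --> \oo] --> \int[m]_x v x.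

(* Main.v *)
(* Testing a derivation b with divergence against f in Lip_b and v in Lip_bs
   gives, by the Leibniz rule, int b(f) v = - int b(v) f - int (div b) f v.
   Hence weak convergence of b_n(f) for f in a countable family of Lipschitz
   functions with bounded support (finite maxima of tents, which approximate
   nonnegative lower semicontinuous functions from below) together with weak
   convergence of div b_n implies weak convergence of b_n(f) for every f in
   Lip_b.  Along a diagonal subsequence the pairings of |b_n|, b_n(f) and
   the truncated div b_n with tents converge; L^2 bounds turn the limits into
   densities (Riesz), and the superlinear bound makes the truncation error of the
   divergences uniformly small.
   The limit b satisfies |b(f)| <= h Lip_a f, where h is the weak limit of
   |b_n|: localize |b_n(f)| <= |b_n| Lip_a f to small balls.  Applying the
   integration by parts for b along Lipschitz functions realizing the minimal
   relaxed slope in L^2 improves this to |b(f)| <= h |Df|. *)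

Require Import Defs.
From mathcomp Require Import all_boot all_order all_algebra.
From mathcomp Require Import all_classical all_reals all_analysis.
From mathcomp Require Import measurable_realfun ring lra.
Set Implicit Arguments.
Unset Strict Implicit.
Unset Printing Implicit Defensive.
Import Order.TTheory GRing.Theory Num.Theory.
Import numFieldNormedType.Exports.
Local Open Scope classical_set_scope.
Local Open Scope ring_scope.

(** * Integrals and square-integrable functions *)

(** The space need not be locally compact and the measures vary, so compactness has to come from few
    test functions. Tents suffice because of a square: for [v] in [C_bs] and a maximum [t] of tents
    below it, [(v - t) ^ 2] is again in [C_bs]; hence the L^2 distance of [v] and [t] under [m_n]
    converges to the one under [m], where dominated convergence makes it small. Integration by parts
    turns an arbitrary Lipschitz [f] into a test factor, so uncountably many [f] are settled by
    countably many sequences. A minimal relaxed slope depends on its measure, and the slopes of [f]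
    under [m_n] have no evident relation to the one under [m]. The bounds are therefore weakened
    before the limit to [lip_a f], which is the same for all measures and upper semicontinuous, and
    sharpened again afterwards. Sharpening uses strong L^2 convergence of slopes of approximations;
    it is obtained by minimizing norms over convex sets of majorants of [lip_a v], with [v] close to
    [f]. Locality of the slope comes from the competitors [phi * v + (1 - phi) * u]. *)

Section integrals.
Context d (T : measurableType d) (R : realType) (mu : {measure set T -> \bar R}).
Implicit Types f g h : T -> R.

Definition intg f := mu.-integrable setT (EFin \o f).
Local Notation I f := (\int[mu]_x f x).

Lemma ae_mp (P S : T -> Prop) : (\forall x \ae mu, P x) ->
  (forall x, P x -> S x) -> \forall x \ae mu, S x.
Proof. by move=> p ps; apply: filterS p => x; exact: ps. Qed.

Lemma ae_mp2 (P Q S : T -> Prop) : (\forall x \ae mu, P x) ->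
  (\forall x \ae mu, Q x) -> (forall x, P x -> Q x -> S x) -> \forall x \ae mu, S x.
Proof. by move=> p q pqs; apply: filterS (filterI p q) => x [/pqs]; exact. Qed.

Lemma ae_mp3 (P Q S U : T -> Prop) : (\forall x \ae mu, P x) ->
  (\forall x \ae mu, Q x) -> (\forall x \ae mu, S x) ->
  (forall x, P x -> Q x -> S x -> U x) -> \forall x \ae mu, U x.
Proof.
by move=> p q s pqsu; apply: filterS (filterI p (filterI q s)) => x [? [? ?]]; exact: pqsu.
Qed.

Lemma aeT (P : T -> Prop) : (forall x, P x) -> \forall x \ae mu, P x.
Proof. exact: aeW. Qed.

Lemma intgP f : intg f <->
  measurable_fun setT f /\ (\int[mu]_x (`|f x|)%:E < +oo)%E.
Proof.
by split=> [/integrableP[/measurable_EFinP]|[mf ?]]; [|apply/integrableP];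
  split=> //; exact/measurable_EFinP.
Qed.

Lemma intg_meas f : intg f -> measurable_fun setT f.
Proof. by move=> /intgP[]. Qed.

Lemma intg_le_ae f g : measurable_fun setT f ->
  (\forall x \ae mu, `|f x| <= g x) -> intg g -> intg f.
Proof.
move=> mf fg /intgP[mg ig]; apply/intgP; split=> //; apply: le_lt_trans ig.
apply: ae_ge0_le_integral => //.
- by apply/measurable_EFinP; exact: measurableT_comp.
- by apply/measurable_EFinP; exact: measurableT_comp.
- by apply: filterS fg => x fgx _; rewrite lee_fin (le_trans fgx)// ler_norm.
Qed.

Lemma intg_le f g : measurable_fun setT f ->
  (forall x, `|f x| <= g x) -> intg g -> intg f.
Proof. by move=> mf fg; apply: intg_le_ae => //; exact: aeW. Qed.

Lemma intg0 : intg (fun=> 0).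
Proof. exact: (integrable0 mu). Qed.

Lemma intgD f g : intg f -> intg g -> intg (fun x => f x + g x).
Proof. by move=> fi gi; exact: (integrableD measurableT fi gi). Qed.

Lemma intgB f g : intg f -> intg g -> intg (fun x => f x - g x).
Proof. by move=> fi gi; exact: (integrableB measurableT fi gi). Qed.

Lemma intgZ c f : intg f -> intg (fun x => c * f x).
Proof. by move=> fi; exact: (integrableZl measurableT c fi). Qed.

Lemma intgN f : intg f -> intg (fun x => - f x).
Proof. by move=> fi; exact: (@integrableN _ _ _ mu _ (EFin \o f) fi). Qed.

Lemma intg_norm f : intg f -> intg (fun x => `|f x|).
Proof. by move=> fi; exact: (integrable_norm fi). Qed.

Lemma intg_lty f : measurable_fun setT f -> (forall x, 0 <= f x) ->
  (\int[mu]_x (f x)%:E < +oo)%E -> intg f.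
Proof.
move=> mf f0 fi; apply/intgP; split => //.
by under eq_integral do rewrite ger0_norm//.
Qed.

Lemma intg_fin f : intg f -> (\int[mu]_x (f x)%:E)%E = (I f)%:E.
Proof. by move=> fi; rewrite /Rintegral fineK//; exact: integrable_fin_num. Qed.

Lemma ItgD f g : intg f -> intg g -> I (fun x => f x + g x) = I f + I g.
Proof. exact: RintegralD. Qed.

Lemma ItgB f g : intg f -> intg g -> I (fun x => f x - g x) = I f - I g.
Proof. exact: RintegralB. Qed.

Lemma ItgZ c f : intg f -> I (fun x => c * f x) = c * I f.
Proof. by move=> fi; rewrite RintegralZl. Qed.

Lemma ItgN f : intg f -> I (fun x => - f x) = - I f.
Proof.
move=> fi; under eq_Rintegral do rewrite -mulN1r.
by rewrite ItgZ// mulN1r.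
Qed.

Lemma Itg0 : I (fun=> 0) = 0.
Proof. by rewrite /Rintegral integral0. Qed.

Lemma eq_Rint_ae f g : measurable_fun setT f -> measurable_fun setT g ->
  (\forall x \ae mu, f x = g x) -> I f = I g.
Proof.
move=> mf mg fg; congr fine; apply: ae_eq_integral => //.
- exact/measurable_EFinP.
- exact/measurable_EFinP.
- by apply: filterS fg => x -> _.
Qed.

Lemma le_Rint_ae f g : intg f -> intg g -> (\forall x \ae mu, f x <= g x) ->
  I f <= I g.
Proof.
move=> fi gi fg; rewrite -subr_ge0 -ItgB//.
rewrite (@eq_Rint_ae _ (fun x => `|g x - f x|)).
- exact: Rintegral_ge0.
- by apply: intg_meas; exact: intgB.
- by apply: intg_meas; apply: intg_norm; exact: intgB.
- by apply: filterS fg => x fgx; rewrite ger0_norm// subr_ge0.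
Qed.

Lemma le_Rint f g : intg f -> intg g -> (forall x, f x <= g x) -> I f <= I g.
Proof. by move=> fi gi fg; apply: le_Rint_ae => //; exact: aeW. Qed.

Lemma le_norm_Rint f : intg f -> `|I f| <= I (fun x => `|f x|).
Proof. exact: le_normr_Rintegral. Qed.

Lemma Rint_eq0_ae f : intg f -> (\forall x \ae mu, 0 <= f x) -> I f <= 0 ->
  \forall x \ae mu, f x = 0.
Proof.
move=> fi f0 If; have mf := intg_meas fi.
have E : I f = I (fun x => `|f x|).
  apply: eq_Rint_ae => //; first exact: measurableT_comp.
  by apply: filterS f0 => x fx; rewrite ger0_norm.
have /(ae_eq_integral_abs mu measurableT): measurable_fun setT (EFin \o f).
  exact/measurable_EFinP.
move=> /iffLR H; have : ae_eq mu setT (EFin \o f) (cst 0%E).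
  apply: H; transitivity (\int[mu]_x (`|f x|)%:E)%E; first by [].
  rewrite intg_fin; last exact: intg_norm.
  congr EFin; apply/eqP; rewrite eq_le -{1}E If/=.
  exact: Rintegral_ge0.
by apply: filterS => x /(_ Logic.I) /= [].
Qed.

Lemma Rint_dominated (f_ : nat -> T -> R) f g :
  (forall n, measurable_fun setT (f_ n)) -> measurable_fun setT f ->
  (\forall x \ae mu, f_ n x @[n --> \oo] --> f x) -> intg g ->
  (\forall x \ae mu, forall n, `|f_ n x| <= g x) ->
  I (f_ n) @[n --> \oo] --> I f.
Proof.
move=> mf_ mf f_f ig f_g.
have := @dominated_convergence _ _ _ mu setT measurableT
  (fun n => EFin \o f_ n) (EFin \o f) (EFin \o g).
case.
- by move=> n; exact/measurable_EFinP.
- exact/measurable_EFinP.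
- by apply: filterS f_f => x f_fx _; apply/cvg_EFin; [exact: nearW|].
- exact: ig.
- by apply: filterS f_g => x f_gx n _; rewrite lee_fin.
move=> fi _; have f_i n : intg (f_ n).
  by apply: intg_le_ae ig => //; apply: filterS f_g => x.
move=> H; rewrite intg_fin// in H.
apply: (cvg_trans _ (fine_cvg H)); apply: near_eq_cvg; near=> n => /=.
by rewrite /Rintegral.
Unshelve. all: by end_near. Qed.

(** Fatou's lemma, the almost everywhere limit being identified with the lower limit. In the
    completeness arguments it yields both the integrability of a limit and the bound on its distance
    to the sequence. *)
Lemma Rint_fatou (f_ : nat -> T -> R) f C :
  (forall n, intg (f_ n)) -> (forall n x, 0 <= f_ n x) ->
  (\forall n \near \oo, I (f_ n) <= C) ->
  measurable_fun setT f -> (\forall x \ae mu, f_ n x @[n --> \oo] --> f x) ->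
  (forall x, 0 <= f x) ->
  intg f /\ I f <= C.
Proof.
move=> f_i f_0 f_C mf f_f f0.
have mf_ n : measurable_fun setT (EFin \o f_ n).
  by apply/measurable_EFinP; exact: intg_meas.
have key : (\int[mu]_x (f x)%:E <= C%:E)%E.
  have mli : measurable_fun setT (fun x => limn_einf (fun n => (f_ n x)%:E)).
    rewrite (_ : (fun x => _) =
        (fun x => - limn_esup (fun n => - (f_ n x)%:E))%E); last first.
      apply/funext => x; rewrite -limn_einfN; congr limn_einf.
      by apply/funext => n /=; rewrite opprK.
    apply: measurableT_comp => //; apply: measurable_fun_limn_esup => n.
    by apply: measurableT_comp => //; exact: mf_.
  have : (\int[mu]_x limn_einf (fun n => (f_ n x)%:E) <= C%:E)%E.
    apply: le_trans (fatou mu measurableT mf_ _) _.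
      by move=> n x _; rewrite lee_fin.
    apply: (@le_trans _ _ (limn_einf (fun=> C%:E))); last first.
      by rewrite (cvg_limn_einf_sup (cvg_cst _)).
    rewrite !limn_einf_lim; apply: lee_lim.
    - exact: is_cvg_einfs.
    - exact: is_cvg_einfs.
    case: f_C => N _ f_C; near=> n.
    apply: (@le_trans _ _ (\int[mu]_x (f_ n x)%:E)%E).
      by apply: ereal_inf_lbound; exists n => //=; exact: leqnn.
    rewrite intg_fin//; apply: (@le_trans _ _ C%:E).
      by rewrite lee_fin; apply: f_C => /=; near: n; exact: nbhs_infty_ge.
    by apply: le_ereal_inf_tmp => _ [m _ <-]//.
  apply: le_trans; apply: ae_ge0_le_integral => //.
  - by move=> x _; rewrite lee_fin.
  - exact/measurable_EFinP.
  - move=> x _; rewrite limn_einf_lim; apply: lime_ge; first exact: is_cvg_einfs.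
    by apply: nearW => n; apply: le_ereal_inf_tmp => _ [m _ <-]; rewrite lee_fin.
  - apply: filterS f_f => x f_fx _.
    rewrite (@cvg_limn_einf_sup _ _ (f x)%:E)//.
    by apply/cvg_EFin => //; exact: nearW.
have fi : intg f by apply: intg_lty => //; exact: le_lt_trans key (ltry _).
by split=> //; rewrite -lee_fin -intg_fin.
Unshelve. all: by end_near. Qed.

End integrals.

Lemma ler_sqr_norm (R : realDomainType) (x y : R) :
  `|x| <= `|y| -> x ^+ 2 <= y ^+ 2.
Proof.
by move=> xy; rewrite -(real_normK (num_real x)) -(real_normK (num_real y)) lerXn2r// nnegrE.
Qed.

(** The restriction [e <= 1] lets a caller absorb [e * e] into [e], or use [e] as a convexity
    parameter. *)
Lemma le_eps_mul (R : realFieldType) (a b K : R) : (forall e, 0 < e -> e <= 1 -> a <= b + e * K) -> a <= b.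
Proof.
move=> H; apply/ler_addgt0Pr => e e0.
pose t := Num.min 1 (e / (`|K| + 1)).
have K1 : 0 < `|K| + 1 by rewrite ltr_wpDl.
have t0 : 0 < t by rewrite lt_min ltr01/= divr_gt0.
have t1 : t <= 1 by rewrite ge_min lexx.
apply: (le_trans (H t t0 t1)); rewrite lerD2l.
apply: (@le_trans _ _ (e / (`|K| + 1) * (`|K| + 1))).
  apply: (@le_trans _ _ (t * (`|K| + 1))).
    by rewrite ler_wpM2l ?(ltW t0)// (le_trans (ler_norm K))// lerDl.
  by rewrite ler_wpM2r ?(ltW K1)// ge_min lexx orbT.
by rewrite divfK// gt_eqF.
Qed.

(** * Inner product, norm and completeness of L^2 *)

Section L2.
Context d (T : measurableType d) (R : realType) (mu : {measure set T -> \bar R}).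
Implicit Types (f g h v : T -> R) (u : nat -> T -> R).
Local Notation intg := (@intg d T R mu).
Local Notation I f := (\int[mu]_x f x).

Definition sqi f := measurable_fun setT f /\ intg (fun x => f x ^+ 2).

Definition ip f g := I (fun x => f x * g x).

Definition nrm f := Num.sqrt (ip f f).

Lemma sqi_meas f : sqi f -> measurable_fun setT f. Proof. by case. Qed.

Lemma sqi_le_ae f g : measurable_fun setT f ->
  (\forall x \ae mu, `|f x| <= `|g x|) -> sqi g -> sqi f.
Proof.
move=> mf fg [mg gi]; split=> //; apply: intg_le_ae gi.
  exact: measurable_funX.
by apply: filterS fg => x fgx; rewrite ger0_norm ?sqr_ge0// ler_sqr_norm.
Qed.

Lemma sqi_le f g : measurable_fun setT f ->
  (forall x, `|f x| <= `|g x|) -> sqi g -> sqi f.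
Proof. by move=> mf fg; apply: sqi_le_ae => //; exact: aeW. Qed.

Lemma sqi_mul f g : sqi f -> sqi g -> intg (fun x => f x * g x).
Proof.
move=> [mf fi] [mg gi]; apply: intg_le (intgD fi gi).
  exact: measurable_funM.
by move=> x; rewrite ler_norml; apply/andP; split; nra.
Qed.

Lemma sqiZ c f : sqi f -> sqi (fun x => c * f x).
Proof.
move=> [mf fi]; split; first exact: measurable_funM.
under eq_fun do rewrite exprMn.
exact: intgZ.
Qed.

Lemma sqiD f g : sqi f -> sqi g -> sqi (fun x => f x + g x).
Proof.
move=> sf sg; split; first by apply: measurable_funD; apply: sqi_meas.
under eq_fun do rewrite sqrrD -mulr_natl.
apply: intgD (sg.2); apply: intgD (sf.2) _; apply: intgZ.
exact: sqi_mul.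
Qed.

Lemma sqiN f : sqi f -> sqi (fun x => - f x).
Proof. by move=> /(sqiZ (-1)); under eq_fun do rewrite mulN1r. Qed.

Lemma sqiB f g : sqi f -> sqi g -> sqi (fun x => f x - g x).
Proof. by move=> sf sg; apply: sqiD => //; exact: sqiN. Qed.

Lemma sqi_norm f : sqi f -> sqi (fun x => `|f x|).
Proof.
move=> sf; apply: sqi_le (sf); first by apply: measurableT_comp => //; case: sf.
by move=> x; rewrite normr_id.
Qed.

Lemma sqi0 : sqi (fun=> 0).
Proof. by split=> //; under eq_fun do rewrite expr0n/=; exact: intg0. Qed.

Lemma ipC f g : ip f g = ip g f.
Proof. by apply: eq_Rintegral => x _; rewrite mulrC. Qed.

Lemma ipDl f g h : sqi f -> sqi g -> sqi h ->
  ip (fun x => f x + g x) h = ip f h + ip g h.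
Proof.
move=> sf sg sh; rewrite /ip; under eq_Rintegral do rewrite mulrDl.
by rewrite ItgD//; exact: sqi_mul.
Qed.

Lemma ipZl c f h : sqi f -> sqi h -> ip (fun x => c * f x) h = c * ip f h.
Proof.
move=> sf sh; rewrite /ip; under eq_Rintegral do rewrite -mulrA.
by rewrite (@ItgZ _ _ _ _ _ (fun x => f x * h x))//; exact: sqi_mul.
Qed.

Lemma ipBl f g h : sqi f -> sqi g -> sqi h ->
  ip (fun x => f x - g x) h = ip f h - ip g h.
Proof.
move=> sf sg sh; rewrite /ip; under eq_Rintegral do rewrite mulrBl.
by rewrite ItgB//; exact: sqi_mul.
Qed.

Lemma ipDr f g h : sqi f -> sqi g -> sqi h ->
  ip h (fun x => f x + g x) = ip h f + ip h g.
Proof. by move=> sf sg sh; rewrite ipC ipDl// !(ipC h). Qed.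

Lemma ipZr c f h : sqi f -> sqi h -> ip h (fun x => c * f x) = c * ip h f.
Proof. by move=> sf sh; rewrite ipC ipZl// (ipC h). Qed.

Lemma ipE f : ip f f = I (fun x => f x ^+ 2).
Proof. by apply: eq_Rintegral => x _; rewrite expr2. Qed.

Lemma ip_ge0 f : 0 <= ip f f.
Proof. by rewrite ipE; apply: Rintegral_ge0 => x _; exact: sqr_ge0. Qed.

Lemma nrm_ge0 f : 0 <= nrm f. Proof. exact: sqrtr_ge0. Qed.

Lemma sqr_nrm f : nrm f ^+ 2 = ip f f. Proof. exact: sqr_sqrtr (ip_ge0 f). Qed.

Lemma ip_lin f g s t : sqi f -> sqi g ->
  ip (fun x => s * f x + t * g x) (fun x => s * f x + t * g x) =
  s ^+ 2 * ip f f + 2 * s * t * ip f g + t ^+ 2 * ip g g.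
Proof.
move=> sf sg; have [sf' sg'] := (sqiZ s sf, sqiZ t sg).
rewrite ipDl//; last exact: sqiD.
rewrite !ipDr// !ipZl// !ipZr// (ipC g f); ring.
Qed.

Lemma ipBB f g : sqi f -> sqi g ->
  ip (fun x => f x - g x) (fun x => f x - g x) = ip f f - 2 * ip f g + ip g g.
Proof.
move=> sf sg; have := ip_lin 1 (-1) sf sg.
under [in ip _ _]eq_fun do rewrite mul1r mulN1r.
by move=> ->; ring.
Qed.

Lemma cauchy_schwarz f g : sqi f -> sqi g -> `|ip f g| <= nrm f * nrm g.
Proof.
move=> sf sg; rewrite -(ler_pXn2r (ltn0Sn 1))// ?nnegrE ?mulr_ge0 ?nrm_ge0//.
rewrite exprMn !sqr_nrm (real_normK (num_real _)).
have H s t : 0 <= s ^+ 2 * ip f f + 2 * s * t * ip f g + t ^+ 2 * ip g g.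
  by rewrite -ip_lin//; exact: ip_ge0.
have := ip_ge0 g; rewrite le_eqVlt => /predU1P[g0|g0].
  have [->|b0] := eqVneq (ip f g) 0; first by rewrite expr0n/= mulr_ge0 ?ip_ge0.
  (* With [ip g g = 0] the form is affine in [t], and this [t] gives it the value -1. *)
  have := H 1 (- (ip f f + 1) / (2 * ip f g)); rewrite -g0 mulr0 addr0.
  rewrite (_ : _ + _ = - 1); last by field.
  by rewrite oppr_ge0 ler10.
have := H (ip g g) (- ip f g).
rewrite (_ : _ + _ = ip g g * (ip f f * ip g g - ip f g ^+ 2)); last by ring.
by rewrite pmulr_rge0// subr_ge0.
Qed.

Lemma nrmD f g : sqi f -> sqi g -> nrm (fun x => f x + g x) <= nrm f + nrm g.
Proof.
move=> sf sg; rewrite -(ler_pXn2r (ltn0Sn 1))// ?nnegrE ?addr_ge0 ?nrm_ge0//.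
rewrite sqr_nrm sqrrD !sqr_nrm ipDl ?ipDr//; last exact: sqiD.
have := le_trans (ler_norm _) (cauchy_schwarz sf sg).
by rewrite (ipC g f); lra.
Qed.

Lemma nrmBC f g : nrm (fun x => f x - g x) = nrm (fun x => g x - f x).
Proof.
congr Num.sqrt; apply: eq_Rintegral => x _; ring.
Qed.

Lemma nrmZ c f : sqi f -> nrm (fun x => c * f x) = `|c| * nrm f.
Proof.
move=> sf; rewrite /nrm ipZl//; last exact: sqiZ.
by rewrite ipZr// mulrA -expr2 sqrtrM ?sqr_ge0// sqrtr_sqr.
Qed.

Lemma nrm_triangle f g h : sqi f -> sqi g -> sqi h ->
  nrm (fun x => f x - h x) <= nrm (fun x => f x - g x) + nrm (fun x => g x - h x).
Proof.
move=> sf sg sh; apply: le_trans (nrmD (sqiB sf sg) (sqiB sg sh)).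
by rewrite le_eqVlt; apply/orP; left; apply/eqP; congr nrm; apply/funext => x; ring.
Qed.

Lemma le_nrm f g : sqi f -> sqi g -> (\forall x \ae mu, `|f x| <= `|g x|) ->
  nrm f <= nrm g.
Proof.
move=> sf sg fg; rewrite ler_wsqrtr// !ipE; apply: le_Rint_ae.
- exact: sf.2.
- exact: sg.2.
by apply: filterS fg => x; exact: ler_sqr_norm.
Qed.

Lemma nrm_eq0_ae f : sqi f -> nrm f = 0 -> \forall x \ae mu, f x = 0.
Proof.
move=> sf /eqP; rewrite sqrtr_eq0 ipE => f0.
have := Rint_eq0_ae (proj2 sf) (aeW _ (fun x => sqr_ge0 (f x))) f0.
by apply: filterS => x /eqP; rewrite sqrf_eq0 => /eqP.
Qed.

Definition L2lim u v := nrm (fun x => u n x - v x) @[n --> \oo] --> 0.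

Lemma L2limP u v : L2lim u v <-> forall e, 0 < e ->
  exists n0, forall n, (n0 <= n)%N -> nrm (fun x => u n x - v x) <= e.
Proof.
split=> [/cvgrPdist_le H e e0|H].
  have [n0 _ Hn] := H e e0; exists n0 => n n0n.
  by have := Hn n n0n; rewrite sub0r normrN ger0_norm// nrm_ge0.
apply/cvgrPdist_le => e e0; have [n0 Hn] := H e e0.
by exists n0 => // n /= n0n; rewrite sub0r normrN ger0_norm ?nrm_ge0// Hn.
Qed.

Lemma ip_cvgl u v h : (forall n, sqi (u n)) -> sqi v -> sqi h -> L2lim u v ->
  ip (u n) h @[n --> \oo] --> ip v h.
Proof.
move=> su sv sh uv; apply/cvgrPdist_le => e e0.
have [n0 Hn] := (L2limP _ _).1 uv (e / (nrm h + 1)) (divr_gt0 e0 (ltr_wpDl (nrm_ge0 h) ltr01)).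
exists n0 => // n /= n0n; rewrite distrC -ipBl//.
have sB := sqiB (su n) sv.
apply: (le_trans (cauchy_schwarz sB sh)).
apply: (@le_trans _ _ (e / (nrm h + 1) * (nrm h + 1))).
  by rewrite ler_pM ?nrm_ge0 ?Hn// lerDl.
by rewrite divfK// gt_eqF// ltr_wpDl ?nrm_ge0.
Qed.

Lemma nrm_cvg u v : (forall n, sqi (u n)) -> sqi v -> L2lim u v ->
  nrm (u n) @[n --> \oo] --> nrm v.
Proof.
move=> su sv uv; apply/cvgrPdist_le => e e0.
have [n0 Hn] := (L2limP _ _).1 uv e e0.
exists n0 => // n /= n0n; apply: le_trans (Hn n n0n).
have h1 := nrmD (sqiB (su n) sv) sv; have h2 := nrmD (sqiB sv (su n)) (su n).
move: h1 h2; under eq_fun do rewrite subrK.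
under [in X in _ -> nrm X <= _ -> _]eq_fun do rewrite subrK.
by rewrite (nrmBC v) ler_norml => ? ?; apply/andP; split; lra.
Qed.

Lemma ip_cvg2 u v : (forall n, sqi (u n)) -> sqi v -> L2lim u v ->
  ip (u n) (u n) @[n --> \oo] --> ip v v.
Proof.
move=> su sv uv; rewrite -sqr_nrm; under eq_fun do rewrite -sqr_nrm expr2.
by rewrite expr2; apply: cvgM; exact: nrm_cvg.
Qed.

Lemma exp_half_gt0 (n : nat) : 0 < (2^-1 : R) ^+ n.
Proof. by rewrite exprn_gt0// invr_gt0. Qed.

Lemma exp_half_le (i j : nat) : (i <= j)%N -> (2^-1 : R) ^+ j <= 2^-1 ^+ i.
Proof. by move=> ij; rewrite ler_wiXn2l// invf_le1// ler1n. Qed.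

Lemma exp_half_small (e : R) : 0 < e -> exists j, 2^-1 ^+ j <= e.
Proof.
move=> e0; have /cvgrPdist_le/(_ e e0) : (GRing.exp (2^-1 : R)) @ \oo --> 0.
  by apply: cvg_expr; rewrite ger0_norm ?invr_ge0// invf_lt1// ltr1n.
case=> n0 _ /(_ n0 (leqnn _)); rewrite sub0r normrN ger0_norm; first by exists n0.
by rewrite exprn_ge0.
Qed.

Lemma sum_half (n : nat) : \sum_(0 <= i < n) (2^-1 : R) ^+ i <= 2.
Proof.
suff -> : \sum_(0 <= i < n) (2^-1 : R) ^+ i = 2 - 2 * 2^-1 ^+ n.
  by rewrite lerBlDr lerDl mulr_ge0// exprn_ge0.
elim: n => [|n IHn]; first by rewrite big_geq// expr0 mulr1 subrr.
by rewrite big_nat_recr//= IHn exprS; lra.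
Qed.

(** The sum of the series has integral at most 2, hence is finite almost everywhere. *)
Lemma ae_sum_bounded (D : nat -> T -> R) : (forall j, measurable_fun setT (D j)) ->
  (forall j x, 0 <= D j x) -> (forall j, (\int[mu]_x (D j x)%:E <= (2^-1 ^+ j)%:E)%E) ->
  \forall x \ae mu, exists C, forall n, \sum_(0 <= j < n) D j x <= C.
Proof.
move=> mD' D0' iD; pose E j x := (D j x)%:E.
have D0 j x : (0 <= E j x)%E by rewrite lee_fin.
have mD j : measurable_fun setT (E j) by exact/measurable_EFinP.
pose S x := (\sum_(0 <= j <oo) E j x)%E.
have iS : (\int[mu]_x S x <= 2%:E)%E.
  rewrite /S integral_nneseries//.
  apply: lime_le; first by apply: is_cvg_nneseries => j _ _; exact: integral_ge0.
  apply: nearW => n; apply: (@le_trans _ _ (\sum_(0 <= j < n) (2^-1 ^+ j)%:E)%E).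
    by apply: lee_sum => j _; exact: iD.
  by rewrite sumEFin lee_fin sum_half.
have mS : measurable_fun setT S by exact: ge0_emeasurable_sum.
have S0 x : (0 <= S x)%E by exact: nneseries_ge0.
have : mu.-integrable setT S.
  apply/integrableP; split=> //.
  under eq_integral do rewrite gee0_abs//.
  exact: le_lt_trans iS (ltry _).
move=> /(integrable_ae measurableT); apply: filterS => x /(_ Logic.I) Sx.
exists (fine (S x)) => n; rewrite -lee_fin fineK// -sumEFin.
by apply: (@nneseries_lim_ge R (E^~ x) xpredT 0%N n) => j _ _; exact: D0.
Qed.

Lemma cvgn_of_abs_sum_bounded (a : nat -> R) C :
  (forall n, \sum_(0 <= j < n) `|a j.+1 - a j| <= C) -> cvgn a.
Proof.
move=> aC; have cv : cvgn (series (fun j => a j.+1 - a j)).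
  apply: normed_cvg; apply: nondecreasing_is_cvgn.
    by apply: nondecreasing_series => j _ _; exact: normr_ge0.
  by exists C => _ [n _ <-]; exact: aC.
rewrite (_ : a = cst (a 0) + series (fun j => a j.+1 - a j)).
  by apply: is_cvgD => //; exact: is_cvg_cst.
apply/funext => n; rewrite /= /series/= fctE/= telescope_sumr//.
by rewrite addrCA subrr addr0.
Qed.

Lemma ae_cvg_limit u : (forall n, measurable_fun setT (u n)) ->
  (\forall x \ae mu, cvgn (fun n => u n x)) ->
  exists2 v : T -> R, measurable_fun setT v &
    \forall x \ae mu, u n x @[n --> \oo] --> v x.
Proof.
move=> mu_ [N [mN N0 Nc]].
(* Cutting off the measurable null set [N] makes the sequence converge everywhere, so the limit is
   measurable although the measure need not be complete. *)
pose w n x := u n x * \1_(~` N) x.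
have mw n : measurable_fun setT (w n).
  by apply: measurable_funM => //; exact/measurable_indicP/measurableC.
have cw x : cvgn (fun n => w n x).
  have [xN|xN] := pselect (N x).
    rewrite (_ : (fun n => _) = fun=> 0); first exact: is_cvg_cst.
    by apply/funext => n; rewrite /w indicE memNset ?mulr0//=; exact.
  rewrite (_ : (fun n => _) = fun n => u n x).
    by apply: contrapT => H; apply: xN; exact: Nc.
  by apply/funext => n; rewrite /w indicE mem_set ?mulr1.
exists (fun x => limn (fun n => w n x)).
  by apply: (measurable_fun_cvg mw) => x _; exact: cw.
exists N; split=> // x /= H; apply: contrapT => xN; apply: H.
rewrite (_ : (fun n => w n x) = fun n => u n x).
  by apply: contrapT => H; apply: xN; exact: Nc.
by apply/funext => n; rewrite /w indicE mem_set ?mulr1.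
Qed.

(* AM-GM: [|D_j| <= 2^-j + 2^j D_j ^ 2], so the increments of a fast Cauchy
   sequence are absolutely summable wherever [\sum_j 2^j D_j ^ 2] is finite. *)
Lemma fast_cauchy_ae_cvg u : (forall n, sqi (u n)) ->
  (forall j, nrm (fun x => u j.+1 x - u j x) <= 2^-1 ^+ j) ->
  \forall x \ae mu, cvgn (fun n => u n x).
Proof.
move=> su hu.
have sD j : sqi (fun x => u j.+1 x - u j x) by exact: sqiB.
have := @ae_sum_bounded (fun j x => 2 ^+ j * (u j.+1 x - u j x) ^+ 2).
move=> /(_ _ _ _)/ae_mp; apply.
- move=> j; apply: measurable_funM => //.
  by apply: measurable_funX; exact: (sqi_meas (sD j)).
- by move=> j x; rewrite mulr_ge0 ?sqr_ge0// exprn_ge0.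
- move=> j; rewrite intg_fin; last by apply: intgZ; case: (sD j).
  rewrite ItgZ; last by case: (sD j).
  rewrite -ipE -sqr_nrm lee_fin.
  rewrite [leRHS](_ : _ = 2 ^+ j * (2^-1 ^+ j) ^+ 2); last first.
    by rewrite expr2 mulrA -exprMn divff// expr1n mul1r.
  by rewrite ler_wpM2l ?exprn_ge0// lerXn2r// nnegrE ?nrm_ge0// exprn_ge0.
move=> x [C HC]; apply: (@cvgn_of_abs_sum_bounded _ (2 + C)) => n.
apply: le_trans (lerD (sum_half n) (HC n)).
rewrite -big_split/=; apply: ler_sum => j _.
set a := u j.+1 x - u j x.
have p0 : 0 < (2 : R) ^+ j by rewrite exprn_gt0.
rewrite exprVn -[a ^+ 2](real_normK (num_real a)).
have b0 := normr_ge0 a; set b := `|a| in b0 *; set p := 2 ^+ j in p0 *.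
rewrite -subr_ge0 (_ : _ - b = p^-1 * ((1 - p * b) ^+ 2 + p * b)); last first.
  by field; rewrite gt_eqF.
by rewrite mulr_ge0 ?invr_ge0 ?(ltW p0)// addr_ge0 ?sqr_ge0// mulr_ge0// ltW.
Qed.

Definition L2cauchy u := forall e, 0 < e ->
  exists n0, forall m n, (n0 <= m)%N -> (n0 <= n)%N ->
    nrm (fun x => u m x - u n x) <= e.

Lemma L2_complete u : (forall n, sqi (u n)) -> L2cauchy u ->
  exists2 v, sqi v & L2lim u v.
Proof.
move=> su cu.
have /choice[k0 hk0] (j : nat) : exists k, forall m n, (k <= m)%N -> (k <= n)%N ->
    nrm (fun x => u m x - u n x) <= 2^-1 ^+ j.
  by apply: cu; exact: exp_half_gt0.
(* The indices increase strictly and dominate [k0], which gives a subsequence with increments at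
   most [2^-j]. *)
pose k := fix k j := if j is i.+1 then maxn (k i).+1 (k0 j) else k0 0.
have kk0 j : (k0 j <= k j)%N by case: j => //= j; rewrite leq_maxr.
have kS j : (k j < k j.+1)%N by rewrite /= leq_maxl.
have ki j : (j <= k j)%N by elim: j => // j IH; exact: leq_ltn_trans IH (kS j).
have hk j m n : (k j <= m)%N -> (k j <= n)%N ->
    nrm (fun x => u m x - u n x) <= 2^-1 ^+ j.
  by move=> km kn; apply: hk0; exact: leq_trans (kk0 _) _.
have aec := @fast_cauchy_ae_cvg (u \o k) (fun n => su (k n))
  (fun j => hk j _ _ (ltnW (kS j)) (leqnn _)).
have [v mv wv] := ae_cvg_limit (fun n => sqi_meas (su (k n))) aec.
(* Fatou along the subsequence with [n] fixed turns the Cauchy bound into a bound on the distance to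
   [v]. *)
have fat j n : (k j <= n)%N -> intg (fun x => (v x - u n x) ^+ 2) /\
    I (fun x => (v x - u n x) ^+ 2) <= (2^-1 ^+ j) ^+ 2.
  move=> jn; apply: (@Rint_fatou _ _ _ mu (fun i x => (u (k i) x - u n x) ^+ 2)).
  - by move=> i; have [] := sqiB (su (k i)) (su n).
  - by move=> i x; exact: sqr_ge0.
  - exists j => // i /= ji; rewrite -ipE -sqr_nrm lerXn2r ?nnegrE ?nrm_ge0 ?exprn_ge0//.
    apply: hk => //; move: ji; rewrite leq_eqVlt => /predU1P[->//|ji].
    by apply/ltnW; apply: (homo_ltn ltn_trans kS).
  - by apply: measurable_funX; apply: measurable_funB => //; exact: (sqi_meas (su _)).
  - apply: filterS wv => x ux; rewrite expr2; under eq_fun do rewrite expr2.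
    by apply: cvgM; apply: cvgB => //; exact: cvg_cst.
  - by move=> x; exact: sqr_ge0.
have sv : sqi v.
  have sB : sqi (fun x => v x - u (k 0) x).
    by split; [apply: measurable_funB => //; exact: (sqi_meas (su _))|case: (fat 0%N _ (leqnn _))].
  by have := sqiD sB (su (k 0%N)); under eq_fun do rewrite subrK.
exists v => //; apply/L2limP => e e0; have [j je] := exp_half_small e0.
exists (k j) => n jn; apply: le_trans je; rewrite nrmBC.
rewrite -(ler_pXn2r (ltn0Sn 1)) ?nnegrE ?nrm_ge0 ?exprn_ge0//.
by rewrite sqr_nrm ipE; case: (fat j n jn).
Qed.

End L2.

(** * Least-norm elements of convex sets and Riesz representation *)

Section hilbert.
Context d (T : measurableType d) (R : realType) (mu : {measure set T -> \bar R}).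
Implicit Types (f g h v p H : T -> R) (u : nat -> T -> R).
Local Notation sqi := (@sqi d T R mu).
Local Notation ip := (@ip d T R mu).
Local Notation nrm := (@nrm d T R mu).

(** [K] is not assumed closed, so the minimizer lies only in its closure, as the second clause says.
    The third clause is the first-order condition along the segments from [p] to the points of
    [K]. *)
Lemma min_norm_element (K : set (T -> R)) :
  (forall H, K H -> sqi H) -> K !=set0 ->
  (forall s H1 H2, 0 <= s -> s <= 1 -> K H1 -> K H2 ->
     K (fun x => (1 - s) * H1 x + s * H2 x)) ->
  exists p, [/\ sqi p,
    forall e, 0 < e -> exists2 H, K H & nrm (fun x => H x - p x) <= e &
    forall H, K H -> ip p p <= ip p H].
Proof.
move=> sK [H0 KH0] cK.
pose A := [set ip H H | H in K]; pose c := inf A.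
have A0 : has_inf A.
  by split; [exists (ip H0 H0), H0|exists 0 => _ [H _ <-]; exact: ip_ge0].
have cH H : K H -> c <= ip H H.
  by move=> KH; apply: ge_inf; [case: A0|exists H].
have c0 : 0 <= c by apply: lb_le_inf => [|_ [H _ <-]]; [case: A0|exact: ip_ge0].
have /choice[h hh] (n : nat) : exists H, K H /\ ip H H < c + 2^-1 ^+ n.
  have [_ [H KH <-] Hlt] := inf_adherent (exp_half_gt0 R n) A0.
  by exists H.
have Kh n : K (h n) by case: (hh n).
have sh n : sqi (h n) by exact: sK.
(* Parallelogram law: the midpoint lies in [K], so its squared norm is at least [c]. *)
have par m n : ip (fun x => h m x - h n x) (fun x => h m x - h n x) <=
    2 * (2^-1 ^+ m + 2^-1 ^+ n).
  have half0 : 0 <= (2^-1 : R) by rewrite invr_ge0.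
  have half1 : (2^-1 : R) <= 1 by rewrite invf_le1// ler1n.
  have := cH _ (cK _ _ _ half0 half1 (Kh m) (Kh n)).
  rewrite ip_lin// ipBB//.
  have [_ h1] := hh m; have [_ h2] := hh n.
  by lra.
have cauchy : L2cauchy mu h.
  move=> e e0; have e20 : 0 < e ^+ 2 / 4 by rewrite divr_gt0// exprn_gt0.
  have [j hj] := exp_half_small e20.
  have small n : (j <= n)%N -> (2^-1 : R) ^+ n <= e ^+ 2 / 4.
    by move=> jn; apply: le_trans hj; exact: exp_half_le.
  exists j => m n jm jn; rewrite -(ler_pXn2r (ltn0Sn 1)) ?nnegrE ?nrm_ge0 ?(ltW e0)//.
  rewrite sqr_nrm; apply: (le_trans (par m n)).
  by have := small _ jm; have := small _ jn; lra.
have [p sp hp] := L2_complete sh cauchy.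
have pc : ip p p = c.
  have cv := ip_cvg2 sh sp hp.
  apply/eqP; rewrite eq_le; apply/andP; split.
    apply/ler_addgt0Pr => e e0; have [j hj] := exp_half_small e0.
    apply: (cvgr_to_le cv); exists j => // n /= jn.
    have [_ /ltW hn] := hh n; apply: (le_trans hn); rewrite lerD2l.
    by apply: le_trans hj; exact: exp_half_le.
  by apply: (cvgr_to_ge cv); apply: nearW => n; exact: cH.
exists p; split => //.
- move=> e e0; have [n0 hn] := (L2limP _ _ _).1 hp e e0.
  by exists (h n0) => //; apply: hn.
move=> H KH; rewrite pc.
have key s : 0 <= s -> s <= 1 ->
    c <= (1 - s) ^+ 2 * c + 2 * (1 - s) * s * ip p H + s ^+ 2 * ip H H.
  move=> s0 s1.
  have : (1 - s) ^+ 2 * ip (h n) (h n) + 2 * (1 - s) * s * ip (h n) H +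
      s ^+ 2 * ip H H @[n --> \oo] -->
      (1 - s) ^+ 2 * c + 2 * (1 - s) * s * ip p H + s ^+ 2 * ip H H.
    apply: cvgD; [apply: cvgD|exact: cvg_cst].
      by rewrite -pc; apply: cvgMr; exact: ip_cvg2.
    by apply: cvgMr; apply: ip_cvgl => //; exact: sK.
  move=> cv; apply: (cvgr_to_ge cv); apply: nearW => n.
  by rewrite -ip_lin//; [exact/cH/cK|exact: sK].
set b := ip p H in key *; set k := ip H H in key.
(* Dividing [key] by [2 * s] leaves [s] times half the coefficient of [s ^ 2], which is this
   constant. *)
apply: (@le_eps_mul _ _ _ ((k - c) / 2 - (b - c))) => s s0 s1.
rewrite -subr_ge0 -(pmulr_rge0 _ (mulr_gt0 (ltr0Sn R 1) s0)).
by have := key s (ltW s0) s1; lra.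
Qed.

(** The least-norm element [p] of the closure of the affine hyperplane [l = 1] is orthogonal to the
    kernel of [l], and a multiple of it represents [l]. The subspace [V] need not be closed, so [p]
    may lie outside it. *)
Lemma riesz (V : set (T -> R)) (l : (T -> R) -> R) (C : R) :
  (forall v, V v -> sqi v) -> V (fun=> 0) ->
  (forall s t v w, V v -> V w -> V (fun x => s * v x + t * w x)) ->
  (forall s t v w, V v -> V w ->
     l (fun x => s * v x + t * w x) = s * l v + t * l w) ->
  (forall v, V v -> `|l v| <= C * nrm v) ->
  exists2 g, sqi g & forall v, V v -> l v = ip g v.
Proof.
move=> sV V0 Vlin llin lC.
have [l0|] := pselect (forall v, V v -> l v = 0).
  exists (fun=> 0); first exact: sqi0.
  move=> v Vv; rewrite l0// /ip; under eq_Rintegral do rewrite mul0r.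
  by rewrite Itg0.
move=> /existsNP[v0 /not_implyP[Vv0 /eqP lv0]].
pose K := [set v | V v /\ l v = 1].
have VZ s v : V v -> V (fun x => s * v x).
  by move=> Vv; have := Vlin s 0 _ _ Vv Vv; under eq_fun do rewrite mul0r addr0.
have lZ s v : V v -> l (fun x => s * v x) = s * l v.
  move=> Vv; have := llin s 0 _ _ Vv Vv.
  by under [X in l X]eq_fun do rewrite mul0r addr0; rewrite mul0r addr0.
have [e0 Ke0] : K !=set0.
  exists (fun x => (l v0)^-1 * v0 x).
  by split; [exact: VZ|rewrite lZ// mulVf].
have [p [sp clp mp]] : exists p, [/\ sqi p,
    forall e, 0 < e -> exists2 H, K H & nrm (fun x => H x - p x) <= e &
    forall H, K H -> ip p p <= ip p H].
  apply: min_norm_element.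
  - by move=> v [/sV].
  - by exists e0.
  - move=> s H1 H2 _ _ [V1 l1] [V2 l2]; split; first exact: Vlin.
    by rewrite llin// l1 l2; ring.
have ker z : V z -> l z = 0 -> ip p z = 0.
  move=> Vz lz; apply/eqP; apply: contraT => pz.
  have KH s : K (fun x => 1 * e0 x + s * z x).
    by split; [exact: Vlin Ke0.1 Vz|rewrite llin ?lz ?Ke0.2; [ring|exact: Ke0.1|]].
  (* With this multiple of [z] the inner product with [p] becomes [ip p p - 1], below the
     minimum. *)
  have /mp := KH ((ip p p - ip p e0 - 1) / ip p z).
  have [se0 sz] := (sV _ Ke0.1, sV _ Vz).
  rewrite ipDr ?ipZr//; try exact: sqiZ.
  by rewrite divfK// => ?; lra.
have C0 : 0 < C.
  have := lC _ Ke0.1; rewrite Ke0.2 normr1 => h1.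
  rewrite ltNge; apply/negP => C0; have := mulr_le0_ge0 C0 (nrm_ge0 mu e0).
  by move=> /(le_trans h1); rewrite leNgt ltr01.
(* If [p] had norm 0, [K] would contain elements of norm at most [C^-1 / 2], where [l] is at most
   1/2 instead of 1. *)
have p0 : 0 < ip p p.
  rewrite lt_neqAle ip_ge0 andbT eq_sym; apply/eqP => pp0.
  have C20 : 0 < C^-1 / 2 by rewrite divr_gt0// invr_gt0.
  have [H [VH lH] nH] := clp _ C20.
  have := lC _ VH; rewrite lH normr1.
  have nH' : nrm H <= C^-1 / 2.
    have := nrmD (sqiB (sV _ VH) sp) sp; under eq_fun do rewrite subrK.
    move=> /le_trans; apply.
    by rewrite [X in _ + X](_ : _ = 0) ?addr0// /nrm pp0 sqrtr0.
  move=> /le_trans/(_ (ler_wpM2l (ltW C0) nH')).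
  by rewrite mulrA divff ?gt_eqF// mul1r; lra.
have pe0 : 0 < ip p e0 by apply: lt_le_trans p0 _; exact: mp.
exists (fun x => (ip p e0)^-1 * p x); first exact: sqiZ.
move=> v Vv; rewrite ipZl//; last exact: sV.
have : ip p (fun x => 1 * v x + (- l v) * e0 x) = 0.
  apply: ker; first exact: Vlin Vv Ke0.1.
  by rewrite llin ?Ke0.2//; [ring|exact: Ke0.1].
have [se0 sv] := (sV _ Ke0.1, sV _ Vv).
rewrite ipDr ?ipZr//; try exact: sqiZ.
move=> h; have -> : ip p v = l v * ip p e0 by lra.
by field; rewrite gt_eqF.
Qed.
End hilbert.

(** * Lipschitz functions and tents *)

Section lipschitz.
Context {R : realType} {X : completeMetricType R}.
Implicit Types (f g h u v : X -> R) (x y z : X) (A B : set X) (c r : R).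

Lemma metric_tri y x z : mdist x z <= mdist x y + mdist y z.
Proof. exact: metric_triangle. Qed.

Definition lip_on c f A := forall y z, A y -> A z -> `|f y - f z| <= c * mdist y z.

Lemma ballP x r y : ball x r y <-> mdist x y < r.
Proof. by rewrite ballEmdist. Qed.

Lemma LipP f : Lip f <-> exists2 L, 0 <= L & lip_on L f setT.
Proof.
split=> [[L HL]|[L _ HL]]; last by exists L => x y; exact: HL.
exists `|L| => // x y _ _; apply: (le_trans (HL x y)).
by rewrite ler_wpM2r ?mdist_ge0// ler_norm.
Qed.

Lemma bounded_real_funP f : bounded_fun f <-> exists2 M, 0 <= M & forall x, `|f x| <= M.
Proof.
split=> [[M [Mr HM]]|[M _ HM]].
  exists (`|M| + 1) => [|x]; first by rewrite addr_ge0.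
  by apply: HM => //; rewrite (le_lt_trans (ler_norm _))// ltrDl.
exists M; split; first exact: num_real.
by move=> y My x _; apply: le_trans (HM x) (ltW My).
Qed.

Lemma Lip_bP f : Lip_b f <-> exists L M, [/\ 0 <= L, 0 <= M, lip_on L f setT &
  forall x, `|f x| <= M].
Proof.
split=> [[/LipP[L L0 HL] /bounded_real_funP[M M0 HM]]|[L [M [L0 M0 HL HM]]]].
  by exists L, M.
by split; [apply/LipP; exists L|apply/bounded_real_funP; exists M].
Qed.

Lemma Lip_bL f : Lip_b f -> Lip f. Proof. by case. Qed.

Lemma Lip_comb2 f g h K M : (forall y z, `|h y - h z| <= K * (`|f y - f z| + `|g y - g z|)) ->
  (forall x, `|h x| <= M) -> 0 <= K -> Lip f -> Lip g -> Lip_b h.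
Proof.
move=> hfg hM K0 /LipP[Lf Lf0 HLf] /LipP[Lg Lg0 HLg]; split.
  exists (K * (Lf + Lg)) => x y; apply: (le_trans (hfg x y)).
  by rewrite -mulrA ler_wpM2l// mulrDl lerD// ?HLf ?HLg.
by exists M; split; [exact: num_real|move=> N MN x _; exact: le_trans (hM x) (ltW MN)].
Qed.

Lemma Lip_b_cst c : Lip_b (fun _ : X => c).
Proof.
apply/Lip_bP; exists 0, `|c|; split=> // x y _ _.
by rewrite subrr normr0 mul0r.
Qed.

Lemma Lip_bD f g : Lip_b f -> Lip_b g -> Lip_b (fun x => f x + g x).
Proof.
move=> /[dup] /Lip_bP[_ [M [_ _ _ HM]]] [Lf _] /[dup] /Lip_bP[_ [N [_ _ _ HN]]] [Lg _].
apply: (@Lip_comb2 f g _ 1 (M + N)) => //.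
  move=> y z; rewrite mul1r opprD addrACA.
  exact: ler_normD.
by move=> x; rewrite (le_trans (ler_normD _ _))// lerD.
Qed.

Lemma Lip_bM f g : Lip_b f -> Lip_b g -> Lip_b (fun x => f x * g x).
Proof.
move=> /[dup] /Lip_bP[_ [M [_ M0 _ HM]]] [Lf _] /[dup] /Lip_bP[_ [N [_ N0 _ HN]]] [Lg _].
apply: (@Lip_comb2 f g _ (M + N) (M * N)) => //; last by rewrite addr_ge0.
  move=> y z.
  rewrite (_ : _ - _ = (f y - f z) * g y + f z * (g y - g z)); last by ring.
  rewrite (le_trans (ler_normD _ _))// !normrM mulrDl [leRHS]addrC.
  apply: lerD.
    by rewrite mulrC ler_pM// ?HN// lerDl.
  by rewrite ler_pM// ?HM// lerDr.
by move=> x; rewrite normrM ler_pM.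
Qed.

Lemma Lip_bZ c f : Lip_b f -> Lip_b (fun x => c * f x).
Proof. by move=> Lf; apply: Lip_bM => //; exact: Lip_b_cst. Qed.

Lemma Lip_bN f : Lip_b f -> Lip_b (fun x => - f x).
Proof. by move=> /(Lip_bZ (-1)); under eq_fun do rewrite mulN1r. Qed.

Lemma Lip_bB f g : Lip_b f -> Lip_b g -> Lip_b (fun x => f x - g x).
Proof. by move=> Lf Lg; apply: Lip_bD => //; exact: Lip_bN. Qed.

Lemma Lip_b_norm f : Lip_b f -> Lip_b (fun x => `|f x|).
Proof.
move=> /[dup] /Lip_bP[_ [M [_ M0 _ HM]]] [Lf _].
apply: (@Lip_comb2 f f _ 1 M) => // [y z|x]; last by rewrite normr_id.
by rewrite mul1r (le_trans (ler_dist_dist _ _))// lerDl.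
Qed.

Lemma max_normE (a b : R) : Num.max a b = 2^-1 * (a + b + `|a - b|).
Proof.
by case: leP => ab; [rewrite ler0_norm ?subr_le0//|rewrite gtr0_norm ?subr_gt0//]; lra.
Qed.

Lemma min_normE (a b : R) : Num.min a b = 2^-1 * (a + b - `|a - b|).
Proof.
by case: leP => ab; [rewrite ler0_norm ?subr_le0//|rewrite gtr0_norm ?subr_gt0//]; lra.
Qed.

Lemma Lip_b_max f g : Lip_b f -> Lip_b g -> Lip_b (fun x => Num.max (f x) (g x)).
Proof.
move=> Lf Lg; under eq_fun do rewrite max_normE.
by apply/Lip_bZ/Lip_bD; [exact: Lip_bD|exact/Lip_b_norm/Lip_bB].
Qed.

Lemma Lip_b_min f g : Lip_b f -> Lip_b g -> Lip_b (fun x => Num.min (f x) (g x)).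
Proof.
move=> Lf Lg; under eq_fun do rewrite min_normE.
by apply/Lip_bZ/Lip_bB; [exact: Lip_bD|exact/Lip_b_norm/Lip_bB].
Qed.

Lemma Lip_continuous f : Lip f -> continuous f.
Proof.
move=> /LipP[L L0 HL] x; apply/cvgrPdist_le => e e0.
have d0 : 0 < e / (L + 1) by rewrite divr_gt0// ltr_wpDl.
apply: (@filterS _ _ _ (ball x (e / (L + 1)))); last exact: nbhsx_ballx.
move=> y /ballP xy; apply: (le_trans (HL _ _ I I)).
apply: (@le_trans _ _ ((L + 1) * (e / (L + 1)))).
  by rewrite ler_pM ?mdist_ge0 ?(ltW xy)// lerDl.
by rewrite mulrC divfK// gt_eqF// ltr_wpDl.
Qed.

Lemma Lip_b_C_b f : Lip_b f -> C_b f.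
Proof. by move=> [Lf bf]; split=> //; exact: Lip_continuous. Qed.

Lemma open_L0 f : (forall a : R, open [set x | a < f x]) -> L0 f.
Proof.
move=> of_; apply: (measurability _ (RGenOInfty.measurableE R)) => _ [_ [a ->] <-].
rewrite setTI; apply: sub_sigma_algebra.
rewrite (_ : _ @^-1` _ = [set x | a < f x]); first exact: of_.
by apply/seteqP; split => x /=; rewrite in_itv/= andbT.
Qed.

Lemma open_lt_L0 f : (forall a : R, open [set x | f x < a]) -> L0 f.
Proof.
move=> of_; have : L0 (fun x => - f x).
  by apply: open_L0 => a; under eq_set do rewrite ltrNr; exact: of_.
move=> /(@measurable_funN _ (borel X) _ _ _); apply: eq_measurable_fun => x _.
exact: opprK.
Qed.

Lemma open_superlevel f c : continuous f -> open [set x | c < f x].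
Proof.
move=> cf; rewrite (_ : [set x | _] = f @^-1` [set t | c < t])//.
by apply: open_comp => [x _|]; [exact: cf|exact: open_gt].
Qed.

Lemma continuous_L0 f : continuous f -> L0 f.
Proof. by move=> cf; apply: open_L0 => a; exact: open_superlevel. Qed.

Lemma Lip_b_L0 f : Lip_b f -> L0 f.
Proof. by move=> [/Lip_continuous/continuous_L0]. Qed.

Lemma open_metric_ball x r : open (ball x r).
Proof.
rewrite openE => y /= /ballP xy; rewrite /interior.
have d0 : 0 < r - mdist x y by rewrite subr_gt0.
apply: (@filterS _ _ _ (ball y (r - mdist x y))); last exact: nbhsx_ballx.
move=> z /ballP yz; apply/ballP; apply: (le_lt_trans (metric_tri y x z)).
by move: yz; lra.
Qed.

Lemma open_meas (U : set X) : open U -> measurable (U : set (borel X)).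
Proof. by move=> oU; exact: sub_sigma_algebra. Qed.

Lemma ball_meas x r : measurable (ball x r : set (borel X)).
Proof. by apply: open_meas; exact: open_metric_ball. Qed.

Lemma lip_const_le c f B : 0 <= c -> lip_on c f B -> lip_const f B <= c.
Proof.
move=> c0 fB; rewrite /lip_const; set S := (X in sup X).
have [->|S0] := eqVneq S set0; first by rewrite sup0.
apply: ge_sup; first exact/set0P.
move=> _ [[y z] /= [By Bz] <-].
have [->|] := eqVneq y z; first by rewrite mdistxx invr0 mulr0.
rewrite -mdist_gt0 => yz.
by rewrite ler_pdivrMr//; exact: fB.
Qed.

Lemma lip_constP f B : Lip f -> lip_on (lip_const f B) f B.
Proof.
move=> /LipP[L L0 HL] y z By Bz.
have [->|] := eqVneq y z; first by rewrite mdistxx mulr0 subrr normr0.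
rewrite -mdist_gt0 => yz.
rewrite -ler_pdivrMr//; apply: ub_le_sup; last by exists (y, z).
exists L => _ [[a b] _ <-] /=.
have [->|] := eqVneq a b; first by rewrite mdistxx invr0 mulr0.
rewrite -mdist_gt0 => ab.
by rewrite ler_pdivrMr//; exact: HL.
Qed.

Lemma lip_const_ge0 f B : 0 <= lip_const f B.
Proof.
rewrite /lip_const; set S := (X in sup X).
have [[Sn0 Sub]|nS] := pselect (has_sup S); last by rewrite sup_out.
case: Sn0 => s Ss; have s0 : 0 <= s.
  by case: Ss => -[a b] _ <- /=; rewrite divr_ge0// mdist_ge0.
by apply: (le_trans s0); exact: ub_le_sup.
Qed.

Lemma lip_onS c f A B : A `<=` B -> lip_on c f B -> lip_on c f A.
Proof. by move=> AB fB y z /AB By /AB Bz; exact: fB. Qed.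

Lemma lip_on_le c c' f A : c <= c' -> lip_on c f A -> lip_on c' f A.
Proof.
move=> cc fA y z Ay Az; apply: (le_trans (fA _ _ Ay Az)).
by rewrite ler_wpM2r// mdist_ge0.
Qed.

Lemma lip_const_balls_has_inf f x :
  has_inf [set lip_const f (ball x r) | r in [set r | 0 < r]].
Proof.
split; first by exists (lip_const f (ball x 1)), 1 => /=.
by exists 0 => _ [r _ <-]; exact: lip_const_ge0.
Qed.

(** The Lipschitz constant on a ball is monotone in the radius, so its right limit at 0 is an
    infimum. *)
Lemma lip_a_cvg f x : Lip f ->
  lip_const f (ball x r) @[r --> 0^'+] -->
  inf [set lip_const f (ball x r) | r in [set r | 0 < r]].
Proof.
move=> Lf; set S := (X in inf X).
have S0 : has_inf S := lip_const_balls_has_inf f x.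
apply/cvgrPdist_le => e e0; have [_ [r /= r0 <-] Hr] := inf_adherent e0 S0.
near=> s; have s0 : 0 < s by near: s; exact: nbhs_right_gt.
have sr : s <= r by near: s; apply: nbhs_right_le.
have h1 : inf S <= lip_const f (ball x s).
  by apply: ge_inf; [case: S0|exists s].
have h2 : lip_const f (ball x s) <= lip_const f (ball x r).
  apply: lip_const_le; first exact: lip_const_ge0.
  by apply: lip_onS (lip_constP Lf); exact: le_ball.
by rewrite ler0_norm; lra.
Unshelve. all: by end_near. Qed.

Lemma lip_aE f x : Lip f ->
  lip_a f x = inf [set lip_const f (ball x r) | r in [set r | 0 < r]].
Proof. by move=> Lf; apply: cvg_lim => //; exact: lip_a_cvg. Qed.

Lemma lip_a_le f x c r : Lip f -> 0 < r -> 0 <= c -> lip_on c f (ball x r) ->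
  lip_a f x <= c.
Proof.
move=> Lf r0 c0 fc; rewrite lip_aE//; apply: le_trans (lip_const_le c0 fc).
by apply: ge_inf; [exists 0 => _ [s _ <-]; exact: lip_const_ge0|exists r].
Qed.

Lemma lip_a_le_Lip f x c : 0 <= c -> lip_on c f setT -> lip_a f x <= c.
Proof.
move=> c0 fc; apply: (lip_a_le _ ltr01 c0 (lip_onS (@subsetT _ _) fc)).
by apply/LipP; exists c.
Qed.

Lemma lip_aP f x e : Lip f -> 0 < e ->
  exists2 r, 0 < r & lip_on (lip_a f x + e) f (ball x r).
Proof.
move=> Lf e0; rewrite lip_aE//; set S := (X in inf X).
have S0 : has_inf S := lip_const_balls_has_inf f x.
have [_ [r /= r0 <-] Hr] := inf_adherent e0 S0.
by exists r => //; apply: lip_on_le (ltW Hr) _; exact: lip_constP.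
Qed.

Lemma lip_a_ge0 f x : Lip f -> 0 <= lip_a f x.
Proof.
move=> Lf; rewrite lip_aE//; apply: lb_le_inf.
  by exists (lip_const f (ball x 1)), 1 => /=.
by move=> _ [r _ <-]; exact: lip_const_ge0.
Qed.

(** Upper semicontinuity: a Lipschitz constant valid on [ball x r] is valid on [ball y (r / 2)] for
    every [y] within [r / 2] of [x]. Borel measurability of [lip_a f] follows. *)
Lemma lip_a_open f a : Lip f -> open [set x | lip_a f x < a].
Proof.
move=> Lf; rewrite openE => x /= xa; rewrite /interior.
have e0 : 0 < (a - lip_a f x) / 2 by rewrite divr_gt0// subr_gt0.
have [r r0 fr] := lip_aP x Lf e0.
apply: (@filterS _ _ _ (ball x (r / 2))); last first.
  by apply: nbhsx_ballx; rewrite divr_gt0.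
move=> y /= xy; have : lip_a f y <= lip_a f x + (a - lip_a f x) / 2.
  apply: (@lip_a_le _ _ _ (r / 2)) => //; first by rewrite divr_gt0.
    by rewrite addr_ge0 ?lip_a_ge0// ltW.
  by apply: lip_onS fr => z yz; rewrite (splitr r); exact: ball_triangle xy yz.
by move=> /le_lt_trans; apply; lra.
Qed.

Lemma lip_a_L0 f : Lip f -> L0 (lip_a f).
Proof. by move=> Lf; apply: open_lt_L0 => a; exact: lip_a_open. Qed.

Lemma lip_a_le_local f g x : Lip f -> Lip g ->
  (exists2 r, 0 < r & forall y z, ball x r y -> ball x r z -> `|f y - f z| <= `|g y - g z|) ->
  lip_a f x <= lip_a g x.
Proof.
move=> Lf Lg [r r0 fg]; apply/ler_addgt0Pr => e e0; have [s s0 gs] := lip_aP x Lg e0.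
have sr0 : 0 < Num.min s r by rewrite lt_min s0.
apply: (lip_a_le Lf sr0).
  by rewrite addr_ge0 ?lip_a_ge0// ltW.
move=> y z /ballP + /ballP; rewrite !lt_min => /andP[ys yr] /andP[zs zr].
by apply: (le_trans (fg y z _ _)); [exact/ballP|exact/ballP|apply: gs; exact/ballP].
Qed.

Lemma lip_a_eq_local f g x r : Lip f -> Lip g -> 0 < r ->
  (forall y, ball x r y -> f y = g y) -> lip_a f x = lip_a g x.
Proof.
move=> Lf Lg r0 fg; apply/eqP; rewrite eq_le; apply/andP; split.
  by apply: lip_a_le_local => //; exists r => // y z /fg -> /fg ->.
by apply: lip_a_le_local => //; exists r => // y z /fg -> /fg ->.
Qed.

Lemma lip_a_comp f g x : Lip f -> Lip g ->
  (forall y z, `|f y - f z| <= `|g y - g z|) -> lip_a f x <= lip_a g x.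
Proof.
by move=> Lf Lg fg; apply: lip_a_le_local => //; exists 1 => // y z _ _.
Qed.

Lemma lip_a_cst (c : R) x : lip_a (fun _ : X => c) x = 0.
Proof.
have Lc : Lip (fun _ : X => c) by exact: (Lip_bL (Lip_b_cst c)).
apply/eqP; rewrite eq_le lip_a_ge0// andbT.
by apply: (lip_a_le Lc (@ltr01 R)) => // y z _ _; rewrite subrr normr0 mul0r.
Qed.

(** The increment splits as [w y * (u y - u z) + (1 - w y) * (v y - v z) + (w y - w z) * (u z - v
    z)]. The constant weight gives convexity of [lip_a]; the variable weight is what yields locality
    of relaxed slopes. *)
Lemma lip_a_interp (w u v : X -> R) x : Lip_b w -> Lip_b u -> Lip_b v ->
  (forall y, 0 <= w y <= 1) ->
  lip_a (fun y => w y * u y + (1 - w y) * v y) x <=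
  w x * lip_a u x + (1 - w x) * lip_a v x + lip_a w x * `|u x - v x|.
Proof.
move=> Lw Lu Lv w01.
have L1w : Lip_b (fun y => 1 - w y) by apply: Lip_bB => //; exact: Lip_b_cst.
have Lh : Lip (fun y => w y * u y + (1 - w y) * v y).
  by apply: Lip_bL; apply: Lip_bD; exact: Lip_bM.
have [[lu lv] lw] := (lip_a_ge0 x (Lip_bL Lu), lip_a_ge0 x (Lip_bL Lv), lip_a_ge0 x (Lip_bL Lw)).
set a := lip_a u x in lu *; set b := lip_a v x in lv *; set c := lip_a w x in lw *.
set k := `|u x - v x|; have k0 : 0 <= k by exact: normr_ge0.
(* The factor collects the coefficients of [e] in the estimate below, once [e * e] is bounded by
   [e]. *)
apply: (@le_eps_mul _ _ _ (a + b + c + k + 2)) => e e0 e1.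
have [r1 r10 Hu] := lip_aP x (Lip_bL Lu) e0.
have [r2 r20 Hv] := lip_aP x (Lip_bL Lv) e0.
have [r3 r30 Hw] := lip_aP x (Lip_bL Lw) e0.
have /cvgrPdist_le/(_ e e0)/nbhs_ballP[r4 /= r40 H4] : w y @[y --> x] --> w x.
  exact: (Lip_continuous (Lip_bL Lw)).
have /cvgrPdist_le/(_ e e0)/nbhs_ballP[r5 /= r50 H5] : u y - v y @[y --> x] --> u x - v x.
  exact: (Lip_continuous (Lip_bL (Lip_bB Lu Lv))).
pose r := Num.min r1 (Num.min r2 (Num.min r3 (Num.min r4 r5))).
have r0 : 0 < r by rewrite !lt_min r10 r20 r30 r40 r50.
have wx := w01 x.
apply: (lip_a_le Lh r0).
  by case/andP: wx => ? ?; rewrite !addr_ge0// ?mulr_ge0 ?subr_ge0 ?(ltW e0)// !addr_ge0.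
move=> y z /ballP + /ballP.
rewrite !lt_min => /and5P[y1 y2 y3 y4 y5] /and5P[z1 z2 z3 z4 z5].
have hu := Hu y z ((ballP _ _ _).2 y1) ((ballP _ _ _).2 z1).
have hv := Hv y z ((ballP _ _ _).2 y2) ((ballP _ _ _).2 z2).
have hw := Hw y z ((ballP _ _ _).2 y3) ((ballP _ _ _).2 z3).
have h4 : w y <= w x + e /\ 1 - w y <= 1 - w x + e.
  by have := H4 y ((ballP _ _ _).2 y4); rewrite ler_norml => /andP[? ?]; split; lra.
have h5 : `|u z - v z| <= k + e.
  have := H5 z ((ballP _ _ _).2 z5); rewrite /= distrC => h5.
  rewrite -[u z - v z](subrK (u x - v x)) addrC (le_trans (ler_normD _ _))//.
  by rewrite lerD2l.
rewrite (_ : _ - _ = w y * (u y - u z) + (1 - w y) * (v y - v z) + (w y - w z) * (u z - v z)); last by ring.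
case/andP: (w01 y) => wy0 wy1; case: h4 => h41 h42; case/andP: wx => wx0 wx1.
have D0 := mdist_ge0 y z; set D := mdist y z in hu hv hw D0 *.
apply: (@le_trans _ _ (w y * ((a + e) * D) + (1 - w y) * ((b + e) * D) + (c + e) * D * (k + e))).
  rewrite (le_trans (ler_normD _ _))// lerD//.
    rewrite (le_trans (ler_normD _ _))//.
    by apply: lerD; rewrite normrM ger0_norm ?subr_ge0// ler_wpM2l ?subr_ge0.
  by rewrite normrM ler_pM.
rewrite (_ : _ + _ = (w y * (a + e) + (1 - w y) * (b + e) + (c + e) * (k + e)) * D); last by ring.
rewrite ler_wpM2r//.
have q1 : w y * a <= (w x + e) * a by rewrite ler_wpM2r.
have q2 : (1 - w y) * b <= (1 - w x + e) * b by rewrite ler_wpM2r.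
have q3 : e * e <= e by rewrite ler_piMl// ltW.
lra.
Qed.

Lemma lip_a_convex (s : R) (u v : X -> R) x : 0 <= s -> s <= 1 -> Lip_b u -> Lip_b v ->
  lip_a (fun y => (1 - s) * u y + s * v y) x <= (1 - s) * lip_a u x + s * lip_a v x.
Proof.
move=> s0 s1 Lu Lv.
have := @lip_a_interp (fun _ : X => s) v u x (Lip_b_cst s) Lv Lu.
rewrite lip_a_cst mul0r addr0 => H.
under [X in lip_a X]eq_fun do rewrite addrC.
by rewrite [leRHS]addrC; apply: H => y; rewrite s0.
Qed.

End lipschitz.

(** * Tents, cutoffs and a countable class of test functions *)

Section tents.
Context {R : realType} {X : completeMetricType R}.
Implicit Types (f g h u v : X -> R) (x y z : X) (A B : set X) (c r q : R).

(** The slope is [k.+1], so that it never vanishes and the tent is positive only within distance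
    [q / k.+1] of [x]. *)
Definition tent x q (k : nat) y : R := Num.max 0 (q - k.+1%:R * mdist x y).

Lemma tent_ge0 x q k y : 0 <= tent x q k y.
Proof. by rewrite /tent le_max lexx. Qed.

Lemma tent_Lip_b x q k : Lip_b (tent x q k).
Proof.
apply/Lip_bP; exists k.+1%:R, `|q|; split=> // [y z _ _|y]; last first.
  rewrite ger0_norm ?tent_ge0// /tent ge_max normr_ge0/= (le_trans _ (ler_norm q))//.
  by rewrite lerBlDr lerDl mulr_ge0// mdist_ge0.
have := ler_wpM2l (ler0n R k.+1) (metric_tri z x y).
have := ler_wpM2l (ler0n R k.+1) (metric_tri y x z).
rewrite (metric_sym z y) !mulrDr ler_norml /tent; set a := _ * mdist x y; set b := _ * mdist x z.
have := mulr_ge0 (ler0n R k.+1) (mdist_ge0 y z); set c := _ * mdist y z.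
by move=> ? ? ?; apply/andP; rewrite /Num.max; do ![case: ifPn]; rewrite -?leNgt => *; split; lra.
Qed.

Lemma tent_supp x q k y : 0 < tent x q k y -> mdist x y < q / k.+1%:R.
Proof. by rewrite /tent lt_max ltxx/= subr_gt0 ltr_pdivlMr// mulrC. Qed.

Lemma metric_boundedP x B : metric_bounded B <->
  exists k : nat, forall y, B y -> mdist x y < k%:R.
Proof.
split=> [[z [r H]]|[k H]]; last by exists x, k%:R => y /H ?; exact/ballP.
exists (Num.truncn (mdist x z + r)).+1 => y /H /ballP zy.
apply: le_lt_trans (truncnS_gt _); apply: (le_trans (metric_tri z x y)).
by rewrite lerD2l ltW.
Qed.

Lemma bounded_supportP x f : bounded_support f <->
  exists k : nat, forall y, f y != 0 -> mdist x y < k%:R.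
Proof. exact: metric_boundedP. Qed.

Definition cutoff x (k : nat) y : R := Num.min 1 (tent x k.+1%:R 0 y).

Lemma cutoff_Lip_b x k : Lip_b (cutoff x k).
Proof. by apply: Lip_b_min; [exact: Lip_b_cst|exact: tent_Lip_b]. Qed.

Lemma cutoff_ge0 x k y : 0 <= cutoff x k y.
Proof. by rewrite /cutoff le_min ler01 tent_ge0. Qed.

Lemma cutoff_le1 x k y : cutoff x k y <= 1.
Proof. by rewrite /cutoff ge_min lexx. Qed.

Lemma cutoff_eq1 x k y : mdist x y <= k%:R -> cutoff x k y = 1.
Proof.
move=> xy; rewrite /cutoff; apply/min_idPl; rewrite /tent le_max; apply/orP; right.
by rewrite mul1r -natr1; lra.
Qed.

Lemma cutoff_supp x k y : cutoff x k y != 0 -> mdist x y < k.+1%:R.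
Proof.
move=> c0; have : 0 < cutoff x k y by rewrite lt_neqAle eq_sym c0 cutoff_ge0.
by rewrite /cutoff lt_min => /andP[_ /tent_supp]; rewrite divr1.
Qed.

Lemma cutoff_eq0 x k y : k.+1%:R <= mdist x y -> cutoff x k y = 0.
Proof.
move=> xy; apply/eqP; apply: contraTT xy => /cutoff_supp; by rewrite -ltNge.
Qed.

Lemma cutoff_Lip_bs x k : Lip_bs (cutoff x k).
Proof.
split; first exact: cutoff_Lip_b.
by apply/(bounded_supportP x); exists k.+1 => y; exact: cutoff_supp.
Qed.

Lemma Lip_bs_mulr f g : Lip_b f -> Lip_bs g -> Lip_bs (fun x => f x * g x).
Proof.
move=> Lf [Lg [x [r H]]]; split; first exact: Lip_bM.
by exists x, r => y /=; rewrite mulf_eq0 negb_or => /andP[_ /H].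
Qed.

Lemma dense_sequence (D : set X) x0 : countable D -> dense D ->
  exists d : nat -> X, forall x e, 0 < e -> exists i, mdist (d i) x < e.
Proof.
move=> /countable_injP[i ii] dD; exists (fun n => xget x0 [set x | D x /\ i x = n]).
move=> x e e0; have [y [/ballP xy Dy]] : ball x e `&` D !=set0.
  by apply: dD; [exists x; exact: ballxx|exact: open_metric_ball].
exists (i y); rewrite (_ : xget _ _ = y) 1?metric_sym//.
case: xgetP => [z -> [Dz iz]|/(_ y)]; last by case.
by apply: ii => //; rewrite inE.
Qed.

Section countable_class.
Variables (d : nat -> X).
Hypothesis d_dense : forall x e, 0 < e -> exists i, mdist (d i) x < e.

Local Notation code := (nat * rat * nat)%type.

Definition rtent (p : code) := tent (d p.1.1) (ratr p.1.2) p.2.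

Definition tentmax (s : seq code) x : R := \big[Num.max/0]_(p <- s) rtent p x.

Lemma tentmax_ge0 s x : 0 <= tentmax s x.
Proof.
rewrite /tentmax; apply: (big_ind (fun a => 0 <= a)) => // [a b a0 b0|p _].
  by rewrite le_max a0.
exact: tent_ge0.
Qed.

Lemma tentmax_Lip_b s : Lip_b (tentmax s).
Proof.
elim: s => [|p s IH].
  by rewrite (_ : tentmax _ = fun=> 0); [exact: Lip_b_cst|apply/funext => x; rewrite /tentmax big_nil].
rewrite (_ : tentmax _ = fun x => Num.max (rtent p x) (tentmax s x)); last first.
  by apply/funext => x; rewrite /tentmax big_cons.
by apply: Lip_b_max => //; exact: tent_Lip_b.
Qed.

Lemma tentmax_Lip_bs s : Lip_bs (tentmax s).
Proof.
split; first exact: tentmax_Lip_b.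
apply/(bounded_supportP (d 0)); elim: s => [|p s [k IH]].
  by exists 0%N => y; rewrite /tentmax big_nil eqxx.
pose r : R := mdist (d 0) (d p.1.1) + ratr p.1.2 / p.2.+1%:R.
exists (maxn k (Num.truncn r).+1) => y.
rewrite /tentmax big_cons -/(tentmax s y) => H.
have [by0|] := eqVneq (tentmax s y) 0; last first.
  by move=> /IH /lt_le_trans; apply; rewrite ler_nat leq_maxl.
have py : 0 < rtent p y.
  move: H; rewrite by0 lt_neqAle tent_ge0 andbT eq_sym; apply: contra => /eqP ->.
  by rewrite maxxx.
apply: (@lt_le_trans _ _ (Num.truncn r).+1%:R); last by rewrite ler_nat leq_maxr.
apply: le_lt_trans (truncnS_gt r); apply: (le_trans (metric_tri (d p.1.1) _ _)).
by rewrite lerD2l ltW// tent_supp.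
Qed.

Lemma le_tentmax s p x : p \in s -> rtent p x <= tentmax s x.
Proof.
rewrite /tentmax; elim: s => // q s IH; rewrite inE big_cons => /predU1P[->|/IH H].
  by rewrite le_max lexx.
by rewrite le_max H orbT.
Qed.

(* A nonnegative lower semicontinuous function is the supremum of the countably
   many tents lying below it. *)
Lemma lsc_tent_below v x q : (forall y, 0 <= v y) -> (forall a, 0 <= a -> open [set y | a < v y]) ->
  q < v x -> exists p, (forall y, rtent p y <= v y) /\ q <= rtent p x.
Proof.
move=> v0 ov qx.
have [q0|q0] := ltP q 0.
  exists (0%N, 0 : rat, 0%N); split=> [y|]; last by rewrite (le_trans (ltW q0))// tent_ge0.
  rewrite /rtent/= /tent raddf0 sub0r max_l// oppr_le0 mulr_ge0//.
  exact: mdist_ge0.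
have [t /[!in_itv]/= /andP[qt tv]] := rat_in_itvoo qx.
have t0 : 0 < ratr t :> R by exact: le_lt_trans qt.
have := ov _ (ltW t0); rewrite openE => /(_ x tv) /nbhs_ballP[r /= r0 Hr].
(* This slope makes the support radius smaller than [r / 2]. With its centre within [r / 2] of [x]
   the tent lives in [ball x r], where [v] exceeds its height; the second bound on the centre keeps
   the loss of height at [x] below [ratr t - q]. *)
pose k := Num.truncn (2 * ratr t / r : R).
have hk : ratr t / k.+1%:R < r / 2.
  have := truncnS_gt (2 * ratr t / r : R).
  by rewrite ltr_pdivrMr// -/k ltr_pdivrMr// => ?; lra.
have e0 : 0 < Num.min (r / 2) ((ratr t - q) / k.+1%:R).
  by rewrite lt_min !divr_gt0// subr_gt0.
have [i] := d_dense x e0; rewrite lt_min => /andP[i1 i2].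
exists (i, t, k); split=> [y|]; rewrite /rtent/=.
  have [->//|b0] := eqVneq (tent (d i) (ratr t) k y) 0.
  have bp : 0 < tent (d i) (ratr t) k y by rewrite lt_neqAle eq_sym b0 tent_ge0.
  have xy : ball x r y.
    apply/ballP; apply: (le_lt_trans (metric_tri (d i) _ _)); rewrite metric_sym.
    rewrite (splitr r); apply: ltrD => //; apply: lt_trans hk.
    exact: tent_supp.
  apply/ltW; apply: le_lt_trans (Hr _ xy); rewrite /tent ge_max (ltW t0)/=.
  by rewrite lerBlDr lerDl mulr_ge0// mdist_ge0.
rewrite /tent le_max; apply/orP; right.
by move: i2; rewrite ltr_pdivlMr// mulrC; lra.
Qed.

Lemma lsc_tentmax_approx v : (forall y, 0 <= v y) ->
  (forall a, 0 <= a -> open [set y | a < v y]) ->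
  exists s : nat -> seq code, (forall n x, tentmax (s n) x <= v x) /\
    (forall x, tentmax (s n) x @[n --> \oo] --> v x).
Proof.
move=> v0 ov; pose good p := `[< forall y, rtent p y <= v y >].
(* Those among the first [n] codes whose tent lies below [v]: every admissible code enters at some
   stage, so the maxima reach the supremum. *)
pose s n := [seq p <- pmap unpickle (iota 0 n) | good p].
have le_v n x : tentmax (s n) x <= v x.
  rewrite /tentmax /s; elim: (pmap _ _) => [|p l IH] /=; first by rewrite big_nil.
  by case: ifPn => // /asboolP gp; rewrite big_cons ge_max gp.
exists s; split=> // x; apply/cvgrPdist_le => e e0.
have vx : v x - e < v x by rewrite ltrBlDr ltrDl.
have [p [gp hp]] := lsc_tent_below v0 ov vx.
exists (pickle p).+1 => // n /= pn; rewrite ger0_norm ?subr_ge0//.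
rewrite lerBlDr addrC -lerBlDr (le_trans hp)//; apply: le_tentmax.
rewrite mem_filter; apply/andP; split; first exact/asboolP.
rewrite mem_pmap; apply/mapP; exists (pickle p); last by rewrite pickleK.
by rewrite mem_iota add0n.
Qed.

End countable_class.
End tents.

(** * Detecting signs with Lipschitz weights *)

Section density.
Context {R : realType} {X : completeMetricType R}.
Variable m : {measure set (borel X) -> \bar R}.
Variable d : nat -> X.
Hypothesis d_dense : forall x (e : R), 0 < e -> exists i, mdist (d i) x < e.
Implicit Types (F v : X -> R) (A B : set X).

Local Notation intg := (@intg _ (borel X) R m).
Let ind A x : R := \1_A x.

Lemma ind01 A x : 0 <= ind A x <= 1.
Proof. by rewrite /ind indicE; case: (x \in A); rewrite ?lexx ?ler01. Qed.

Let ind_meas A : measurable (A : set (borel X)) -> L0 (ind A).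
Proof. by move=> mA; exact/(@measurable_indicP _ (borel X)). Qed.

Lemma intgM_bounded F v c : intg F -> L0 v -> (forall x, `|v x| <= c) ->
  intg (fun x => F x * v x).
Proof.
move=> iF mv vc; apply: (@intg_le _ (borel X) R m _ (fun x => c * `|F x|)).
- by apply: measurable_funM => //; exact: (intg_meas iF).
- by move=> x; rewrite normrM mulrC ler_wpM2r.
- by apply/intgZ/intg_norm.
Qed.

(** Approximability of the indicator of [A] in L^1 of the measure with density [|F|]. For integrable
    [F] the sets with this property contain the open sets and are stable under complements and
    countable unions. *)
Definition lip_approx F A := measurable (A : set (borel X)) /\
  forall e, 0 < e -> exists v, [/\ Lip_b v, forall x, 0 <= v x <= 1 &
    \int[m]_x (`|F x| * `|ind A x - v x|) <= e].

Let dist_le1 A v x : (forall x, 0 <= v x <= 1) -> `| `|ind A x - v x| | <= 1.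
Proof.
move=> /(_ x) /andP[v0 v1]; have /andP[i0 i1] := ind01 A x.
by rewrite normr_id ler_norml; apply/andP; split; lra.
Qed.

Let dist_intg F A v : intg F -> measurable (A : set (borel X)) -> L0 v ->
  (forall x, 0 <= v x <= 1) -> intg (fun x => `|F x| * `|ind A x - v x|).
Proof.
move=> iF mA mv v01; apply: (@intgM_bounded _ _ 1).
- exact: intg_norm.
- apply: measurableT_comp => //; apply: measurable_funB => //.
  exact: ind_meas.
- by move=> x; exact: dist_le1.
Qed.

Let dist_cvg0 F A (v : nat -> X -> R) : intg F -> measurable (A : set (borel X)) ->
  (forall n, L0 (v n)) -> (forall n x, 0 <= v n x <= 1) ->
  (forall x, v n x @[n --> \oo] --> ind A x) ->
  forall e, 0 < e -> exists n, \int[m]_x (`|F x| * `|ind A x - v n x|) <= e.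
Proof.
move=> iF mA mv v01 vA e e0.
have : \int[m]_x (`|F x| * `|ind A x - v n x|) @[n --> \oo] --> 0.
  rewrite -(@Itg0 _ (borel X) R m).
  apply: (@Rint_dominated _ (borel X) R m _ _ (fun x => `|F x|)).
  - by move=> n; apply: intg_meas; exact: dist_intg.
  - exact: measurable_cst.
  - apply: aeT => x; rewrite -[X in _ --> X](mulr0 `|F x|).
    apply: cvgMr; rewrite -(normr0 R) -(subrr (ind A x)).
    by apply: cvg_norm; apply: cvgB => //; exact: cvg_cst.
  - exact: intg_norm.
  - by apply: aeT => x n; rewrite normrM normr_id ler_piMr// dist_le1.
move=> /cvgrPdist_le/(_ e e0)[n _ /(_ n (leqnn n))].
by rewrite sub0r normrN => hn; exists n; exact: le_trans (ler_norm _) hn.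
Qed.

Lemma lip_approx_limit F A (B : nat -> set X) : intg F ->
  measurable (A : set (borel X)) -> (forall n, lip_approx F (B n)) ->
  (forall x, ind (B n) x @[n --> \oo] --> ind A x) -> lip_approx F A.
Proof.
move=> iF mA aB BA; split=> // e e0; have e2 : 0 < e / 2 by rewrite divr_gt0.
have mI n : L0 (ind (B n)) by apply: ind_meas; case: (aB n).
have [n hn] := dist_cvg0 iF mA mI (fun n => ind01 (B n)) BA e2.
have [mB /(_ _ e2)[v [Lv v01 hv]]] := aB n.
exists v; split=> //.
have mv := Lip_b_L0 Lv.
have i1 := dist_intg iF mB mv v01.
have i2 := dist_intg iF mA (mI n) (ind01 (B n)).
rewrite (splitr e); apply: le_trans (lerD hn hv).
rewrite -ItgD//; apply: le_Rint.
- exact: dist_intg.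
- exact: intgD.
- by move=> x; rewrite -mulrDr ler_wpM2l// ler_distD.
Qed.

Lemma lip_approx_open F A : intg F -> open A -> lip_approx F A.
Proof.
move=> iF oA.
have iA0 x : 0 <= ind A x by case/andP: (ind01 A x).
have oi a : 0 <= a -> open [set y | a < ind A y].
  move=> a0; have [a1|a1] := ltP a 1.
    rewrite (_ : [set y | _] = A)//; apply/seteqP; split=> y /=; rewrite /ind indicE.
      by case: (boolP (y \in A)) => [/set_mem//|_]; rewrite ltNge a0.
    by move=> Ay; rewrite mem_set.
  rewrite (_ : [set y | _] = set0); first exact: open0.
  by apply/seteqP; split=> y //=; rewrite ltNge (le_trans _ a1)//; case/andP: (ind01 A y).
have [s [sA scv]] := lsc_tentmax_approx d_dense iA0 oi.
split=> [|e e0]; first exact: open_meas.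
have v01 n x : 0 <= tentmax d (s n) x <= 1.
  by rewrite tentmax_ge0 (le_trans (sA n x))//; case/andP: (ind01 A x).
have Ls n : Lip_b (tentmax d (s n)) by exact: tentmax_Lip_b.
have [n hn] := dist_cvg0 iF (open_meas oA) (fun n => Lip_b_L0 (Ls n)) v01 scv e0.
by exists (tentmax d (s n)).
Qed.

Lemma lip_approx_setC F A : lip_approx F A -> lip_approx F (~` A).
Proof.
move=> [mA aA]; split=> [|e /aA[v [Lv v01 hv]]]; first exact: measurableC.
exists (fun x => 1 - v x); split.
- by apply: Lip_bB => //; exact: Lip_b_cst.
- by move=> x; have /andP[? ?] := v01 x; apply/andP; split; lra.
- apply: le_trans hv; rewrite le_eqVlt; apply/orP; left; apply/eqP.
  apply: eq_Rintegral => x _; congr (_ * _); rewrite distrC; congr `| _ |.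
  by rewrite /ind !indicE in_setC; case: (x \in A) => /=; ring.
Qed.

Lemma lip_approx_setU F A B : intg F -> lip_approx F A -> lip_approx F B ->
  lip_approx F (A `|` B).
Proof.
move=> iF [mA aA] [mB aB]; split=> [|e e0]; first exact: measurableU.
have [v [Lv v01 hv]] := aA _ (divr_gt0 e0 (ltr0Sn R 1)).
have [w [Lw w01 hw]] := aB _ (divr_gt0 e0 (ltr0Sn R 1)).
exists (fun x => Num.max (v x) (w x)).
have mv := Lip_b_L0 Lv; have mw := Lip_b_L0 Lw.
have Lm := Lip_b_max Lv Lw.
have m01 x : 0 <= Num.max (v x) (w x) <= 1.
  by have /andP[v0 v1] := v01 x; have /andP[w0 w1] := w01 x; rewrite le_max v0 ge_max v1.
split=> //.
have i1 := dist_intg iF mA mv v01; have i2 := dist_intg iF mB mw w01.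
rewrite (splitr e); apply: le_trans (lerD hv hw).
rewrite -ItgD//; apply: le_Rint.
- by apply: dist_intg => //; [exact: measurableU|exact: Lip_b_L0].
- exact: intgD.
move=> x; rewrite -mulrDr ler_wpM2l//.
have -> : ind (A `|` B) x = Num.max (ind A x) (ind B x).
  rewrite /ind !indicE in_setU; case: (x \in A); case: (x \in B) => /=.
  - by rewrite maxxx.
  - by rewrite max_l.
  - by rewrite max_r.
  - by rewrite maxxx.
rewrite !max_normE; set a := ind A x; set b := ind B x.
rewrite (_ : _ - _ = 2^-1 * ((a - v x) + (b - w x) + (`|a - b| - `|v x - w x|))); last by ring.
rewrite normrM ger0_norm ?invr_ge0//.
have h1 := ler_normD (a - v x + (b - w x)) (`|a - b| - `|v x - w x|).
have h2 := ler_normD (a - v x) (b - w x).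
have h3 := ler_dist_dist (a - b) (v x - w x).
have h4 := ler_normB (a - v x) (b - w x).
move: h3; rewrite (_ : a - b - (v x - w x) = a - v x - (b - w x)); last by ring.
by lra.
Qed.

Lemma lip_approx_measurable F A : intg F -> measurable (A : set (borel X)) ->
  lip_approx F A.
Proof.
move=> iF; apply; split=> [|B oB]; last exact: lip_approx_open.
split=> [|B|B aB].
- by apply: lip_approx_open => //; exact: open0.
- by rewrite setTD; exact: lip_approx_setC.
pose S n := \big[setU/set0]_(i < n) B i.
apply: (@lip_approx_limit _ _ S) => //.
- by apply: bigcupT_measurable => i; case: (aB i).
- elim=> [|n IH]; rewrite /S.
    by rewrite big_ord0; apply: lip_approx_open => //; exact: open0.
  by rewrite big_ord_recr/=; exact: lip_approx_setU.
move=> x; have [[k _ Bx]|nBx] := pselect ((\bigcup_k B k) x).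
  apply/cvgrPdist_le => e e0; exists k.+1 => // n /= kn.
  rewrite /ind !indicE mem_set; last by exists k.
  rewrite mem_set ?subrr ?normr0 ?ltW// /S -bigcup_mkord.
  by exists k.
rewrite (_ : (fun n => _) = fun=> ind (\bigcup_k B k) x); first exact: cvg_cst.
apply/funext => n; rewrite /ind !indicE [in RHS]memNset// memNset// /S -bigcup_mkord.
by move=> [k _ Bx]; apply: nBx; exists k.
Qed.

(* A function with nonnegative averages against Lipschitz weights is nonnegative:
   Lipschitz weights approximate the indicator of its negativity set. *)
Lemma ae_ge0_of_weights F : intg F ->
  (forall v, Lip_b v -> (forall x, 0 <= v x <= 1) -> 0 <= \int[m]_x (F x * v x)) ->
  \forall x \ae m, 0 <= F x.
Proof.
move=> iF H; pose A : set (borel X) := [set x | F x < 0].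
have mF := intg_meas iF.
have mA : measurable A.
  rewrite (_ : A = setT `&` F @^-1` `]-oo, 0[%classic).
    by apply: mF => //; exact: measurable_itv.
  by rewrite setTI; apply/seteqP; split => x /=; rewrite in_itv.
have mi : measurable_fun setT (ind A : borel X -> R) by exact: ind_meas.
have iFA : intg (fun x => F x * ind A x).
  apply: (@intgM_bounded _ _ 1) => // x.
  by have /andP[? ?] := ind01 A x; rewrite ger0_norm.
have FA0 x : 0 <= - (F x * ind A x).
  rewrite /ind indicE; case: (boolP (x \in A)) => [/set_mem|]; rewrite ?mulr0 ?oppr0//.
  by rewrite mulr1 oppr_ge0 => /ltW.
have : \int[m]_x (- (F x * ind A x)) <= 0.
  rewrite ItgN//; apply/ler_addgt0Pr => e e0; rewrite add0r.
  have [_ /(_ e e0)[v [Lv v01 hv]]] := lip_approx_measurable iF mA.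
  have iFv : intg (fun x => F x * v x).
    apply: (@intgM_bounded _ _ 1) => //; first exact: Lip_b_L0.
    by move=> x; have /andP[? ?] := v01 x; rewrite ger0_norm.
  have mv := Lip_b_L0 Lv; have h0 := H v Lv v01.
  have iD := dist_intg iF mA mv v01.
  apply: (@le_trans _ _ (\int[m]_x (F x * v x - F x * ind A x))).
    by rewrite ItgB//; lra.
  apply: le_trans hv; apply: le_Rint => //; first exact: intgB.
  by move=> x; rewrite -mulrBr distrC -normrM ler_norm.
have aF0 : \forall x \ae m, 0 <= - (F x * ind A x) by exact: aeT.
move=> /(Rint_eq0_ae (intgN iFA) aF0); apply: filterS => x.
rewrite /ind indicE; case: (boolP (x \in A)) => [_|/negP xA _].
  by rewrite mulr1 => /eqP; rewrite oppr_eq0 => /eqP ->.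
by rewrite leNgt; apply/negP => Fx; apply: xA; exact/mem_set.
Qed.

(* [|F|] is [F] times the sign of [F], which is almost a Lipschitz weight. *)
Lemma L1_norm_le_of_weights F c : intg F ->
  (forall w, Lip_b w -> (forall x, `|w x| <= 1) -> \int[m]_x (F x * w x) <= c) ->
  \int[m]_x `|F x| <= c.
Proof.
move=> iF H; pose A : set (borel X) := [set x | 0 < F x].
have mF := intg_meas iF.
have mA : measurable A.
  rewrite (_ : A = setT `&` F @^-1` `]0, +oo[%classic).
    by apply: mF => //; exact: measurable_itv.
  by rewrite setTI; apply/seteqP; split => x /=; rewrite in_itv/= andbT.
apply/ler_addgt0Pr => e e0; have e2 : 0 < e / 2 by rewrite divr_gt0.
have [_ /(_ _ e2)[v [Lv v01 hv]]] := lip_approx_measurable iF mA.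
have Lw : Lip_b (fun x => 2 * v x - 1).
  by apply: Lip_bB; [exact: Lip_bZ|exact: Lip_b_cst].
have w1 x : `|2 * v x - 1| <= 1.
  by have /andP[? ?] := v01 x; rewrite ler_norml; apply/andP; split; lra.
have iFw : intg (fun x => F x * (2 * v x - 1)).
  by apply: (@intgM_bounded _ _ 1) => //; exact: Lip_b_L0.
have iD := dist_intg iF mA (Lip_b_L0 Lv) v01.
apply: (@le_trans _ _ (\int[m]_x (F x * (2 * v x - 1) + 2 * (`|F x| * `|ind A x - v x|)))).
  apply: le_Rint; [exact: intg_norm|by apply: intgD => //; exact: intgZ|] => x.
  have E : `|F x| = F x * (2 * ind A x - 1).
    rewrite /ind indicE; case: (boolP (x \in A)) => [/set_mem Fx|/negP nF] /=.
      by rewrite gtr0_norm// mulr1n; ring.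
    rewrite ler0_norm ?mulr0n; first by ring.
    by rewrite leNgt; apply/negP => Fx; apply: nF; exact/mem_set.
  rewrite {1}E -subr_ge0.
  rewrite (_ : _ - _ = 2 * (`|F x| * `|ind A x - v x| - F x * (ind A x - v x))).
    by rewrite mulr_ge0// subr_ge0 -normrM ler_norm.
  by ring.
rewrite ItgD//; last exact: intgZ.
by rewrite ItgZ//; have := H _ Lw w1; lra.
Qed.

End density.

(** * Minimal relaxed slopes *)

Lemma ler_sqr_nneg (R : realDomainType) (a b : R) : 0 <= a -> a <= b -> a ^+ 2 <= b ^+ 2.
Proof. by move=> a0 ab; rewrite lerXn2r// nnegrE// (le_trans a0). Qed.

Lemma ler_of_sqr (R : realDomainType) (a b : R) : 0 <= b -> a ^+ 2 <= b ^+ 2 -> a <= b.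
Proof.
move=> b0 ab; rewrite leNgt; apply/negP => ba.
by move: ab; rewrite leNgt ltrXn2r// nnegrE// ltW// (le_lt_trans b0).
Qed.

Section Lnorm2.
Context d (T : measurableType d) (R : realType) (mu : {measure set T -> \bar R}).
Implicit Types (f g h v : T -> R) (u : nat -> T -> R).
Local Notation sqi := (@sqi d T R mu).
Local Notation ip := (@ip d T R mu).
Local Notation nrm := (@nrm d T R mu).

Lemma Lnorm2E f : sqi f -> ('N[mu]_2%:E[EFin \o f])%E = (nrm f)%:E.
Proof.
move=> sf; have := @poweR_Lnorm _ T R mu (EFin \o f) 2 (lt0r_neq0 (ltr0Sn R 1)).
rewrite (_ : (\int[mu]_x _)%E = (ip f f)%:E); last first.
  rewrite ipE -intg_fin; last by case: sf.
  apply: eq_integral => x _ /=.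
  by rewrite powR_mulrn// real_normK// num_real.
have := Lnorm_ge0 mu 2%:E (EFin \o f); case: ('N[mu]_2%:E[_])%E => [r| |] //.
- rewrite lee_fin => r0; rewrite poweR_EFin powR_mulrn// => -[r2].
  by rewrite /nrm -r2 sqrtr_sqr ger0_norm.
- by rewrite poweRyr.
Qed.

Lemma L2P f : (f \in Lfun mu 2%:E) <-> sqi f.
Proof.
split=> [fL|sf].
  split; last exact: (Lfun2_integrable_sqr fL).
  by move: fL; rewrite inE => /andP[/[!inE]].
rewrite inE; apply/andP; split; first by rewrite inE/=; exact: sqi_meas sf.
by rewrite inE/= /finite_norm Lnorm2E// ltry.
Qed.

Lemma ip_def f g : ip f g = \int[mu]_x (f x * g x).
Proof. by []. Qed.

Lemma nrm_def f : nrm f = Num.sqrt (ip f f).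
Proof. by []. Qed.

Lemma nrm_self_sub f : nrm (fun x => f x - f x) = 0.
Proof.
rewrite nrm_def ip_def; under eq_Rintegral do rewrite subrr mulr0.
by rewrite Itg0 sqrtr0.
Qed.

Lemma nrm_le_of_ip f g : sqi f -> sqi g -> ip f f <= ip f g -> nrm f <= nrm g.
Proof.
move=> sf sg fg; have := le_trans fg (le_trans (ler_norm _) (cauchy_schwarz sf sg)).
rewrite -sqr_nrm expr2; have := nrm_ge0 mu f; rewrite le_eqVlt => /predU1P[<-|f0].
  by move=> _; exact: nrm_ge0.
by rewrite ler_pM2l.
Qed.

Lemma nrm_norm f : nrm (fun x => `|f x|) = nrm f.
Proof.
rewrite !nrm_def !ip_def; congr Num.sqrt; apply: eq_Rintegral => x _.
by rewrite -normrM ger0_norm// -expr2 sqr_ge0.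
Qed.

(* If [p] is the element of least norm of a convex set to which [l] belongs, and
   [l] is not much longer than [p], then [l] is close to [p]. *)
Lemma nrm_near_min l p (M t : R) : sqi l -> sqi p -> 0 <= t -> t <= 1 ->
  nrm p <= M -> nrm l <= nrm p + t -> ip p p <= ip p l ->
  nrm (fun x => l x - p x) ^+ 2 <= t * (2 * M + 1).
Proof.
move=> sl sp t0 t1; rewrite sqr_nrm ipBB// (ipC mu l p) -!sqr_nrm.
have := nrm_ge0 mu p; have := nrm_ge0 mu l.
move: (nrm p) (nrm l) (ip p l) => B A C A0 B0 BM AB BC.
have : A ^+ 2 <= (B + t) ^+ 2 by exact: ler_sqr_nneg.
have : t * B <= t * M by rewrite ler_wpM2l.
have : t * t <= t by rewrite ler_piMl.
by rewrite sqrrD -mulr_natl; lra.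
Qed.

End Lnorm2.
Opaque ip nrm.

Section slopes.
Context {R : realType} {X : completeMetricType R}.
Variable m : {measure set (borel X) -> \bar R}.
Hypothesis m_fin : finite_on_bounded m.
Implicit Types (f g h u v w F G H : X -> R) (x y : X) (c r e : R).

Local Notation intg := (@intg _ (borel X) R m).
Local Notation sqi := (@sqi _ (borel X) R m).
Local Notation ip := (@ip _ (borel X) R m).
Local Notation nrm := (@nrm _ (borel X) R m).
Local Notation L2lim := (@L2lim _ (borel X) R m).

Lemma intg_bounded_support f c x r : L0 f -> (forall y, `|f y| <= c) ->
  (forall y, f y != 0 -> mdist x y < r) -> intg f.
Proof.
move=> mf fc fr; pose B : set (borel X) := ball x r.
have mB : measurable B by exact: ball_meas.
have iB : intg (fun y => c * \1_B y).
  apply: intgZ; apply: intg_lty => [|y|]; first exact/measurable_indicP.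
    by rewrite indicE.
  by rewrite integral_indic// setIT; apply: m_fin => //; exists x, r.
apply: (@intg_le _ (borel X) R m _ _ mf _ iB) => y.
have [->|/fr/ballP By] := eqVneq (f y) 0.
  by rewrite normr0 mulr_ge0// (le_trans _ (fc y)).
by rewrite indicE mem_set// mulr1.
Qed.

Lemma sqi_bounded_support f c x r : L0 f -> (forall y, `|f y| <= c) ->
  (forall y, f y != 0 -> mdist x y < r) -> sqi f.
Proof.
move=> mf fc fr; split=> //; apply: (@intg_bounded_support _ (c ^+ 2) x r).
- exact: measurable_funX.
- by move=> y; rewrite normrX lerXn2r// nnegrE ?(le_trans _ (fc y)).
- by move=> y; rewrite sqrf_eq0; exact: fr.
Qed.

Definition adm u := [/\ Lip_b u, sqi u & sqi (lip_a u)].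

(** Beyond distance [k + 1] from [x0] the function vanishes on a whole ball of radius 1. *)
Lemma lip_a_supp f x0 k x : Lip f -> (forall y, f y != 0 -> mdist x0 y < k) ->
  lip_a f x != 0 -> mdist x0 x < k + 1.
Proof.
move=> Lf fk; apply: contraR; rewrite -leNgt => kx.
rewrite (@lip_a_eq_local _ _ f (fun=> 0) x 1) ?lip_a_cst//.
  by have [] := @Lip_b_cst R X 0.
move=> y /ballP xy; apply/eqP; apply: contraT => /fk yk.
have := metric_tri y x0 x; rewrite (metric_sym y x); lra.
Qed.

Lemma Lip_bs_adm f : Lip_bs f -> adm f.
Proof.
move=> [Lf sf]; have [x0] : exists x0 : X, True.
  by case: sf => x0 _; exists x0.
move=> _; have /(bounded_supportP x0)[k fk] := sf.
have [L [M [L0' M0 HL HM]]] := (Lip_bP f).1 Lf.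
split=> //.
  by apply: sqi_bounded_support fk; [exact: Lip_b_L0|exact: HM].
apply: (@sqi_bounded_support _ L x0 (k%:R + 1)).
- by apply: lip_a_L0; exact: Lip_bL.
- by move=> y; rewrite ger0_norm ?lip_a_ge0 ?lip_a_le_Lip//; exact: Lip_bL.
- by move=> y; apply: lip_a_supp fk; exact: Lip_bL.
Qed.

Lemma adm_convex (s : R) u v : 0 <= s -> s <= 1 -> adm u -> adm v ->
  adm (fun x => (1 - s) * u x + s * v x).
Proof.
move=> s0 s1 [Lu su su'] [Lv sv sv'].
have Lw : Lip_b (fun x => (1 - s) * u x + s * v x).
  by apply: Lip_bD; exact: Lip_bZ.
split=> //; first by apply: sqiD; exact: sqiZ.
apply: (@sqi_le _ (borel X) R m _ (fun x => (1 - s) * lip_a u x + s * lip_a v x)).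
- by apply: lip_a_L0; exact: Lip_bL.
- move=> x; rewrite ger0_norm; last by apply: lip_a_ge0; exact: Lip_bL.
  by apply: (le_trans (lip_a_convex x s0 s1 Lu Lv)); exact: ler_norm.
- by apply: sqiD; exact: sqiZ.
Qed.

(** Majorants of [lip_a v] are taken instead of [lip_a v] itself because [lip_a] is only convex in
    [v]; with majorants the set becomes convex and least-norm elements are available. *)
Definition upper_slopes f (e : R) : set (X -> R) := [set H | sqi H /\
  exists v, [/\ adm v, nrm (fun x => v x - f x) <= e & forall x, lip_a v x <= H x]].

Lemma upper_slopes_convex f e : sqi f -> 0 <= e ->
  forall s H1 H2, 0 <= s -> s <= 1 -> upper_slopes f e H1 -> upper_slopes f e H2 ->
  upper_slopes f e (fun x => (1 - s) * H1 x + s * H2 x).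
Proof.
move=> sf e0 s H1 H2 s0 s1 [sH1 [v1 [a1 n1 l1]]] [sH2 [v2 [a2 n2 l2]]].
have s10 : 0 <= 1 - s by rewrite subr_ge0.
split; first by apply: sqiD; exact: sqiZ.
exists (fun x => (1 - s) * v1 x + s * v2 x); split; first exact: adm_convex.
  have [[_ sv1 _] [_ sv2 _]] := (a1, a2).
  rewrite (_ : (fun x => _) = (fun x => (1 - s) * (v1 x - f x) + s * (v2 x - f x))); last first.
    by apply/funext => x; ring.
  have [sB1 sB2] := (sqiB sv1 sf, sqiB sv2 sf).
  apply: (le_trans (nrmD (sqiZ _ sB1) (sqiZ _ sB2))).
  rewrite !nrmZ// !ger0_norm//.
  rewrite [leRHS](_ : e = (1 - s) * e + s * e); last by ring.
  by rewrite lerD// ler_wpM2l.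
have [[L1 _ _] [L2 _ _]] := (a1, a2).
move=> x; apply: (le_trans (lip_a_convex x s0 s1 L1 L2)).
by rewrite lerD// ler_wpM2l.
Qed.

Lemma upper_slopesS f e e' : e <= e' -> upper_slopes f e `<=` upper_slopes f e'.
Proof.
by move=> ee H [sH [v [av nv lv]]]; split=> //; exists v; split=> //; exact: le_trans ee.
Qed.

(* The last clause is the variational inequality characterizing [G] as the
   element of least norm among the relaxed slopes. *)
Definition energy_slope f G := [/\ sqi G,
  exists u : nat -> X -> R, [/\ forall n, adm (u n), L2lim u f &
    L2lim (fun n => lip_a (u n)) G] &
  forall (v H : nat -> X -> R) w, (forall n, adm (v n)) -> L2lim v f ->
    (forall n, sqi (H n)) -> (forall n x, lip_a (v n) x <= H n x) -> sqi w ->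
    (forall g, sqi g -> ip (H n) g @[n --> \oo] --> ip w g) -> ip G G <= ip G w].

Lemma ip_closure (K : set (X -> R)) p q c : sqi p -> sqi q ->
  (forall H, K H -> sqi H) ->
  (forall e, 0 < e -> exists2 H, K H & nrm (fun x => H x - p x) <= e) ->
  (forall H, K H -> c <= ip q H) -> c <= ip q p.
Proof.
move=> sp sq sK cl cK.
have /choice[h hh] (n : nat) : exists H, K H /\ nrm (fun x => H x - p x) <= 2^-1 ^+ n.
  have [|H KH HH] := cl (2^-1 ^+ n); first exact: exp_half_gt0.
  by exists H.
have sh n : sqi (h n) by apply: sK; case: (hh n).
have hp : L2lim h p.
  apply/L2limP => e e0; have [j hj] := exp_half_small e0; exists j => n jn.
  by case: (hh n) => _ /le_trans; apply; apply: le_trans hj; exact: exp_half_le.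
have := ip_cvgl sh sp sq hp; under eq_fun do rewrite ipC; rewrite ipC => cv.
by apply: (cvgr_to_ge cv); apply: nearW => n; apply: cK; case: (hh n).
Qed.

(** This replaces weak compactness and Mazur's lemma. The least-norm elements [p i] of the shrinking
    sets [upper_slopes f (2^-i)] have increasing norms bounded by that of [lip_a f], and their
    variational inequalities make them Cauchy. Near [p i] there is a majorant of some [lip_a (u i)];
    that slope lies in the same set with almost least norm, so it is itself close to [p i]. *)
Theorem energy_slope_exists f : adm f -> exists G, energy_slope f G.
Proof.
move=> af; have [Lf sf slf] := af.
pose e (i : nat) : R := 2^-1 ^+ i.
have e0 i : 0 < e i := exp_half_gt0 R i.
have eS i j : (i <= j)%N -> e j <= e i by exact: exp_half_le.
have sK i H : upper_slopes f (e i) H -> sqi H by case.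
have Kf i : upper_slopes f (e i) (lip_a f).
  split=> //; exists f; split=> //.
  by rewrite nrm_self_sub ltW.
have /choice[p hp] (i : nat) := @min_norm_element _ (borel X) R m
  (upper_slopes f (e i)) (sK i) (ex_intro _ _ (Kf i))
  (upper_slopes_convex sf (ltW (e0 i))).
have sp i : sqi (p i) by case: (hp i).
have clp i d : 0 < d -> exists2 H, upper_slopes f (e i) H & nrm (fun x => H x - p i x) <= d.
  by case: (hp i) => _ + _; apply.
have mp i H : upper_slopes f (e i) H -> ip (p i) (p i) <= ip (p i) H.
  by case: (hp i) => _ _; apply.
have mpp i j : (i <= j)%N -> ip (p i) (p i) <= ip (p i) (p j).
  move=> ij; apply: (@ip_closure (upper_slopes f (e j))) => //; first exact: sK.
    exact: clp.
  by move=> H KH; apply: mp; apply: upper_slopesS KH; exact: eS.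
have dist i j : (i <= j)%N ->
    ip (fun x => p i x - p j x) (fun x => p i x - p j x) <= ip (p j) (p j) - ip (p i) (p i).
  by move=> ij; rewrite ipBB//; have := mpp _ _ ij; lra.
pose a i := ip (p i) (p i).
have ia : {homo a : i j / (i <= j)%N >-> i <= j}.
  move=> i j ij; rewrite /a -!sqr_nrm lerXn2r ?nnegrE ?nrm_ge0//.
  by apply: nrm_le_of_ip => //; exact: mpp.
pose M := nrm (lip_a f).
have pM i : nrm (p i) <= M by apply: nrm_le_of_ip => //; exact: mp.
have ca : cvgn a.
  apply: nondecreasing_is_cvgn => //; exists (M ^+ 2) => _ [i _ <-].
  by rewrite /a -sqr_nrm lerXn2r ?nnegrE ?nrm_ge0.
have Cp : L2cauchy m p.
  move=> d d0; have /cvgrPdist_le/(_ (d ^+ 2) (exprn_gt0 2 d0))[n0 _ Hn] := ca.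
  have bd i j : (n0 <= i)%N -> (i <= j)%N -> nrm (fun x => p i x - p j x) <= d.
    move=> ni ij; rewrite -(ler_pXn2r (ltn0Sn 1)) ?nnegrE ?nrm_ge0 ?(ltW d0)//.
    rewrite sqr_nrm; apply: (le_trans (dist _ _ ij)).
    have := Hn i ni; rewrite /= ger0_norm; last first.
      by rewrite subr_ge0; exact: nondecreasing_cvgn_le.
    by apply: le_trans; rewrite lerB//; exact: nondecreasing_cvgn_le.
  exists n0 => i j ni nj; case: (leqP i j) => [ij|/ltnW ij]; first exact: bd.
  by rewrite nrmBC; exact: bd.
have [G sG pG] := L2_complete sp Cp.
exists G; split=> //.
- have /choice[H hH] (i : nat) : exists H, upper_slopes f (e i) H /\
      nrm (fun x => H x - p i x) <= e i.
    by have [H KH nH] := clp i _ (e0 i); exists H.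
  have KH i : upper_slopes f (e i) (H i) by case: (hH i).
  have /choice[u hu] (i : nat) : exists v, [/\ adm v, nrm (fun x => v x - f x) <= e i &
      forall x, lip_a v x <= H i x] by case: (KH i).
  have au i : adm (u i) by case: (hu i).
  have sl i : sqi (lip_a (u i)) by case: (au i).
  have Kl i : upper_slopes f (e i) (lip_a (u i)).
    by split=> //; exists (u i); split=> //; case: (hu i).
  have lp i : nrm (fun x => lip_a (u i) x - p i x) ^+ 2 <= e i * (2 * M + 1).
    have hn : nrm (lip_a (u i)) <= nrm (H i).
      apply: le_nrm => //; first exact: sK (KH i).
      apply: aeT => x; have [[Lu _ _] _ hx] := hu i.
      have l0 : 0 <= lip_a (u i) x by apply: lip_a_ge0; exact: Lip_bL.
      rewrite (ger0_norm l0) ger0_norm; first exact: hx.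
      exact: le_trans l0 (hx x).
    have hn2 : nrm (H i) <= nrm (p i) + e i.
      have [_ h1] := hH i; have sHi := sK _ _ (KH i).
      have := nrmD (sqiB sHi (sp i)) (sp i); under eq_fun do rewrite subrK.
      by move=> /le_trans; apply; rewrite addrC lerD2l.
    have ei1 : e i <= 1 by rewrite /e exprn_ile1// invf_le1// ler1n.
    exact: (nrm_near_min (sl i) (sp i) (ltW (e0 i)) ei1 (pM i) (le_trans hn hn2) (mp _ _ (Kl i))).
  have M0 : 0 <= M by exact: nrm_ge0.
  exists u; split=> //.
    apply/L2limP => d d0; have [j hj] := exp_half_small d0; exists j => n jn.
    by have [_ /le_trans + _] := hu n; apply; apply: le_trans hj; exact: eS.
  apply/L2limP => d d0; have [n1 H1] := (L2limP _ _ _).1 pG (d / 2) (divr_gt0 d0 (ltr0Sn R 1)).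
  have d1 : 0 < (d / 2) ^+ 2 / (2 * M + 1).
    by rewrite divr_gt0 ?exprn_gt0 ?divr_gt0// ltr_wpDl// mulr_ge0.
  have [j hj] := exp_half_small d1; exists (maxn n1 j) => n; rewrite geq_max => /andP[nn jn].
  apply: (le_trans (nrm_triangle (sl n) (sp n) sG)).
  rewrite (splitr d); apply: lerD; last exact: H1.
  apply: ler_of_sqr; first by rewrite divr_ge0// ltW.
  apply: (le_trans (lp n)); rewrite -ler_pdivlMr; last by rewrite ltr_wpDl// mulr_ge0.
  by apply: le_trans hj; exact: eS.
move=> v H w av vf sH lH sw Hw.
(* For large [n] the function [H n] belongs to [upper_slopes f (e i)]; the inequality for [p i]
   passes to the weak limit in [n], and the limit in [i] is taken last. *)
have key i : ip (p i) (p i) <= ip (p i) w.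
  have cv := Hw _ (sp i).
  rewrite (ipC _ (p i) w); apply: (cvgr_to_ge cv).
  have [n0 Hn] := (L2limP _ _ _).1 vf _ (e0 i).
  exists n0 => // n /= nn; rewrite ipC; apply: mp; split=> //; exists (v n); split=> //.
  exact: Hn.
have c1 := ip_cvg2 sp sG pG; have c2 := ip_cvgl sp sG sw pG.
by apply: (ler_cvg_to c1 c2); apply: nearW => i; exact: key.
Qed.

Lemma L2lim_le_bound (h : nat -> X -> R) G (c : nat -> R) :
  (forall n, nrm (fun x => h n x - G x) <= c n) -> c n @[n --> \oo] --> 0 ->
  L2lim h G.
Proof.
move=> hc c0; apply: (@squeeze_cvgr _ _ _ _ (fun=> 0) c) => //; last exact: cvg_cst.
by apply: nearW => n; rewrite nrm_ge0 hc.
Qed.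

Lemma L2lim_ge0 (h : nat -> X -> R) G : (forall n, sqi (h n)) -> sqi G ->
  L2lim h G -> (forall n x, 0 <= h n x) -> \forall x \ae m, 0 <= G x.
Proof.
move=> sh sG hG h0; pose N x := Num.max 0 (- G x).
have mG := sqi_meas sG.
have sN : sqi N.
  apply: (@sqi_le _ (borel X) R m _ G) => //.
    by apply: measurable_maxr => //; exact: measurable_funN.
  move=> x; rewrite /N; case: (leP 0 (- G x)) => g0; first by rewrite normrN.
  by rewrite normr0.
have N0 : nrm N = 0.
  apply/eqP; rewrite eq_le nrm_ge0 andbT; apply: (cvgr_to_ge hG); apply: nearW => n.
  apply: le_nrm => //; first exact: sqiB.
  apply: aeT => x; rewrite /N; case: (leP 0 (- G x)) => g0; last by rewrite normr0.
  rewrite ger0_norm// (le_trans _ (ler_norm _))//.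
  by rewrite -[leLHS]add0r lerB// h0.
apply: filterS (nrm_eq0_ae sN N0) => x; rewrite /N => N0x.
have : - G x <= 0 by rewrite -N0x le_max lexx orbT.
by rewrite oppr_le0.
Qed.

Lemma energy_slope_ge0 f G : energy_slope f G -> \forall x \ae m, 0 <= G x.
Proof.
move=> [sG [u [au _ uG]] _]; apply: (L2lim_ge0 _ sG uG).
  by move=> n; case: (au n).
by move=> n x; apply: lip_a_ge0; case: (au n) => /Lip_bL.
Qed.

Lemma sqi_mulB w v c : L0 w -> (forall x, `|w x| <= c) -> sqi v ->
  sqi (fun x => w x * v x).
Proof.
move=> mw wc sv; apply: (@sqi_le _ (borel X) R m _ (fun x => c * v x)).
- by apply: measurable_funM => //; exact: sqi_meas sv.
- move=> x; rewrite !normrM ler_wpM2r//.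
  by rewrite (le_trans (wc x))// ler_norm.
- exact: sqiZ.
Qed.

Lemma nrm_mulB w v c : 0 <= c -> L0 w -> (forall x, `|w x| <= c) -> sqi v ->
  nrm (fun x => w x * v x) <= c * nrm v.
Proof.
move=> c0 mw wc sv; rewrite -(nrm_norm m v).
apply: (@le_trans _ _ (nrm (fun x => c * `|v x|))).
  apply: le_nrm; [exact: sqi_mulB wc sv|exact/sqiZ/sqi_norm|].
  apply: aeT => x; rewrite !normrM !normr_id ler_wpM2r//.
  exact: le_trans (wc x) (ler_norm _).
by rewrite nrmZ ?(ger0_norm c0)//; exact: sqi_norm.
Qed.

(** By continuity [f1] and [f2] differ on a ball about [x], and there [w] vanishes identically. *)
Lemma lip_a_eq0_of_disagree w f1 f2 x : Lip_b w -> Lip_b f1 -> Lip_b f2 ->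
  (forall y, w y != 0 -> f1 y = f2 y) -> f1 x != f2 x -> lip_a w x = 0.
Proof.
move=> Lw Lf1 Lf2 w12 fx.
have Lc : Lip (fun _ : X => 0 : R) by exact: (Lip_bL (Lip_b_cst 0)).
have d0 : 0 < `|f1 x - f2 x| by rewrite normr_gt0 subr_eq0.
have /cvgrPdist_lt/(_ _ d0)/nbhs_ballP[r /= r0 Hr] : f1 y - f2 y @[y --> x] --> f1 x - f2 x.
  exact: (Lip_continuous (Lip_bL (Lip_bB Lf1 Lf2))).
rewrite (@lip_a_eq_local _ _ w (fun=> 0) x r) ?lip_a_cst//; first exact: Lip_bL.
move=> y /Hr; have [//|/w12 ->] := eqVneq (w y) 0.
by rewrite subrr subr0 ltxx.
Qed.

(** The competitor [phi * v n + (1 - phi) * u n] still tends to [f1], because [f1 = f2] wherever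
    [phi] is nonzero. Its slope has a majorant tending to [phi * G2 + (1 - phi) * G1], and the claim
    is the variational inequality of [G1] for this limit. *)
Lemma energy_slope_local f1 f2 G1 G2 (v H : nat -> X -> R) (phi : X -> R) :
  adm f1 -> adm f2 -> energy_slope f1 G1 ->
  (forall n, adm (v n)) -> L2lim v f2 -> (forall n, sqi (H n)) ->
  (forall n x, lip_a (v n) x <= H n x) -> sqi G2 -> L2lim H G2 ->
  Lip_b phi -> (forall x, 0 <= phi x <= 1) ->
  (forall x, phi x != 0 -> f1 x = f2 x) ->
  0 <= ip G1 (fun x => phi x * (G2 x - G1 x)).
Proof.
move=> af1 af2 [sG1 [u [au uf uG]] minG] av vf sH lH sG2 HG Lp p01 p12.
have [[Lf1 sf1 _] [Lf2 sf2 _]] := (af1, af2).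
have [L [_ [L0' _ HL _]]] := (Lip_bP phi).1 Lp.
have pL x : `|lip_a phi x| <= L.
  rewrite ger0_norm; last by apply: lip_a_ge0; exact: Lip_bL.
  exact: lip_a_le_Lip.
have p1 x : `|phi x| <= 1 by have /andP[? ?] := p01 x; rewrite ger0_norm.
have q1 x : `|1 - phi x| <= 1.
  by have /andP[? ?] := p01 x; rewrite ger0_norm ?subr_ge0// lerBlDr lerDl.
have mp := Lip_b_L0 Lp.
have mq : L0 (fun x => 1 - phi x) by apply: Lip_b_L0; apply: Lip_bB => //; exact: Lip_b_cst.
have ml := lip_a_L0 (Lip_bL Lp).
have su n : sqi (u n) by case: (au n).
have sv n : sqi (v n) by case: (av n).
have slu n : sqi (lip_a (u n)) by case: (au n).
pose w n x := phi x * v n x + (1 - phi x) * u n x.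
pose K n x := phi x * H n x + (1 - phi x) * lip_a (u n) x +
  lip_a phi x * `|v n x - u n x|.
pose W x := phi x * G2 x + (1 - phi x) * G1 x.
have sK n : sqi (K n).
  apply: sqiD; last by apply: sqi_mulB pL _ => //; exact/sqi_norm/sqiB.
  by apply: sqiD; [exact: sqi_mulB p1 _|exact: sqi_mulB q1 _].
have sW : sqi W.
  by apply: sqiD; [exact: sqi_mulB p1 _|exact: sqi_mulB q1 _].
have wK n x : lip_a (w n) x <= K n x.
  have [[Lv _ _] [Lu _ _]] := (av n, au n).
  apply: (le_trans (lip_a_interp x Lp Lv Lu p01)); rewrite !lerD2r.
  by rewrite ler_wpM2l//; case/andP: (p01 x).
have aw n : adm (w n).
  have [[Lv _ _] [Lu _ _]] := (av n, au n).
  have Lw : Lip_b (w n).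
    apply: Lip_bD; apply: Lip_bM => //.
    by apply: Lip_bB => //; exact: Lip_b_cst.
  split=> //.
    by apply: sqiD; [exact: sqi_mulB p1 _|exact: sqi_mulB q1 _].
  apply: (@sqi_le _ (borel X) R m _ (K n)) => //.
    by apply: lip_a_L0; exact: Lip_bL.
  move=> x; rewrite ger0_norm; last by apply: lip_a_ge0; exact: Lip_bL.
  exact: le_trans (wK n x) (ler_norm _).
pose c n := nrm (fun x => v n x - f2 x) + nrm (fun x => u n x - f1 x).
have c0 : c n @[n --> \oo] --> 0 by rewrite -(addr0 0); exact: cvgD vf uf.
have wf : L2lim w f1.
  apply: L2lim_le_bound c0 => n; rewrite /c.
  rewrite (_ : (fun x => _) = (fun x => phi x * (v n x - f2 x) + (1 - phi x) * (u n x - f1 x))).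
    have [sB1 sB2] := (sqiB (sv n) sf2, sqiB (su n) sf1).
    apply: (le_trans (nrmD (sqi_mulB mp p1 sB1) (sqi_mulB mq q1 sB2))).
    apply: lerD.
      by have := nrm_mulB ler01 mp p1 sB1; rewrite mul1r.
    by have := nrm_mulB ler01 mq q1 sB2; rewrite mul1r.
  apply/funext => x; rewrite /w; have [->|/p12 ->] := eqVneq (phi x) 0; ring.
have KW : L2lim K W.
  pose e n := nrm (fun x => H n x - G2 x) + nrm (fun x => lip_a (u n) x - G1 x) + L * c n.
  have e0 : e n @[n --> \oo] --> 0.
    rewrite -(addr0 0) -[in X in _ --> _ + X](mulr0 L); apply: cvgD; last exact: cvgMr.
    by rewrite -(addr0 0); exact: cvgD HG uG.
  apply: L2lim_le_bound e0 => n; rewrite /e.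
  have [sB1 sB2] := (sqiB (sH n) sG2, sqiB (slu n) sG1).
  have [sB3 sB4] := (sqiB (sv n) sf2, sqiB (su n) sf1).
  pose k x := `|v n x - f2 x| + `|u n x - f1 x|.
  have sk : sqi k by apply: sqiD; exact: sqi_norm.
  have sK' : sqi (fun x => K n x - W x) by exact: sqiB.
  pose Z x := phi x * `|H n x - G2 x| + (1 - phi x) * `|lip_a (u n) x - G1 x| + lip_a phi x * k x.
  have [sN1 sN2] := (sqi_norm sB1, sqi_norm sB2).
  have [s1 s2] := (sqi_mulB mp p1 sN1, sqi_mulB mq q1 sN2).
  have s3 : sqi (fun x => lip_a phi x * k x) by exact: sqi_mulB pL sk.
  have sZ : sqi Z by apply: sqiD => //; exact: sqiD.
  apply: (@le_trans _ _ (nrm Z)).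
    apply: le_nrm => //; apply: aeT => x.
    have /andP[px0 px1] := p01 x.
    have lp0 : 0 <= lip_a phi x by apply: lip_a_ge0; exact: Lip_bL.
    have k0 : 0 <= k x by rewrite addr_ge0.
    rewrite [leRHS]ger0_norm; last first.
      by rewrite !addr_ge0 ?mulr_ge0 ?subr_ge0.
    rewrite (_ : _ - _ = phi x * (H n x - G2 x) + (1 - phi x) * (lip_a (u n) x - G1 x) +
      lip_a phi x * `|v n x - u n x|); last by rewrite /K /W; ring.
    rewrite (le_trans (ler_normD _ _))// lerD//.
      rewrite (le_trans (ler_normD _ _))//.
      by apply: lerD; rewrite normrM ger0_norm// subr_ge0.
    rewrite normrM normr_id (ger0_norm lp0).
    (* The cross term [lip_a phi * |v n - u n|] vanishes where [f1] and [f2] differ; where they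
       agree it is controlled by the distances of [v n] and [u n] to their common limit. *)
    have [f12|f12] := eqVneq (f1 x) (f2 x); last first.
      by rewrite (lip_a_eq0_of_disagree Lp Lf1 Lf2 p12 f12) !mul0r.
    rewrite ler_wpM2l// /k f12.
    rewrite (_ : v n x - u n x = (v n x - f2 x) - (u n x - f2 x)); last by ring.
    exact: ler_normB.
  apply: (le_trans (nrmD (sqiD s1 s2) s3)); apply: lerD.
    apply: (le_trans (nrmD s1 s2)); apply: lerD.
      have := nrm_mulB ler01 mp p1 sN1.
      by rewrite mul1r (nrm_norm m (fun x => H n x - G2 x)).
    have := nrm_mulB ler01 mq q1 sN2.
    by rewrite mul1r (nrm_norm m (fun x => lip_a (u n) x - G1 x)).
  apply: (@le_trans _ _ (L * nrm k)); first exact: nrm_mulB.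
  rewrite ler_wpM2l// /c -(nrm_norm m (fun x => v n x - f2 x)) -(nrm_norm m (fun x => u n x - f1 x)).
  by apply: nrmD; exact: sqi_norm.
have := minG w K W aw wf sK wK sW (fun g sg => ip_cvgl sK sW sg KW).
have sD := sqiB sG2 sG1; have sPD := sqi_mulB mp p1 sD.
rewrite (_ : W = fun x => G1 x + phi x * (G2 x - G1 x)); last by apply/funext => x; rewrite /W; ring.
by rewrite ipDr// lerDl.
Qed.

Variable d : nat -> X.
Hypothesis d_dense : forall x (e : R), 0 < e -> exists i, mdist (d i) x < e.

(** Applying the integral inequality to all weights [phi * w] gives [G1 * phi * (G2 - G1) >= 0]
    almost everywhere. At a point where [phi] is nonzero and [G2 < G1], the factor [G1] would be
    positive and the product negative. *)
Lemma energy_slope_le_on f1 f2 G1 G2 (v H : nat -> X -> R) (phi : X -> R) :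
  adm f1 -> adm f2 -> energy_slope f1 G1 ->
  (forall n, adm (v n)) -> L2lim v f2 -> (forall n, sqi (H n)) ->
  (forall n x, lip_a (v n) x <= H n x) -> sqi G2 -> L2lim H G2 ->
  (\forall x \ae m, 0 <= G2 x) ->
  Lip_b phi -> (forall x, 0 <= phi x <= 1) ->
  (forall x, phi x != 0 -> f1 x = f2 x) ->
  \forall x \ae m, phi x != 0 -> G1 x <= G2 x.
Proof.
move=> af1 af2 eG1 av vf sH lH sG2 HG G20 Lp p01 p12.
have sG1 : sqi G1 by case: eG1.
have p1 x : `|phi x| <= 1 by have /andP[? ?] := p01 x; rewrite ger0_norm.
have sP : sqi (fun x => phi x * (G2 x - G1 x)).
  by apply: sqi_mulB p1 _; [exact: Lip_b_L0|exact: sqiB].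
have F0 : \forall x \ae m, 0 <= G1 x * (phi x * (G2 x - G1 x)).
  apply: (ae_ge0_of_weights d_dense) => [|w Lw w01]; first exact: sqi_mul.
  have pw01 x : 0 <= phi x * w x <= 1.
    have /andP[p0 p1'] := p01 x; have /andP[w0 w1] := w01 x.
    by rewrite mulr_ge0// mulr_ile1.
  have pw12 x : phi x * w x != 0 -> f1 x = f2 x.
    by rewrite mulf_eq0 negb_or => /andP[/p12].
  have := energy_slope_local af1 af2 eG1 av vf sH lH sG2 HG (Lip_bM Lp Lw) pw01 pw12.
  rewrite ip_def; congr (0 <= _); apply: eq_Rintegral => x _; ring.
apply: (ae_mp3 (energy_slope_ge0 eG1) G20 F0) => x G1x G2x {}F0 px.
have px0 : 0 < phi x by rewrite lt_neqAle eq_sym px; case/andP: (p01 x).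
rewrite leNgt; apply/negP => G21; have G1p := le_lt_trans G2x G21.
by move: F0; rewrite pmulr_rge0// pmulr_rge0// subr_ge0 leNgt G21.
Qed.

Lemma L2_cvgP (u : nat -> X -> R) f : (forall n, sqi (u n)) -> sqi f ->
  L2_cvg m u f <-> L2lim u f.
Proof.
move=> su sf; rewrite /L2_cvg.
have -> : (fun n => 'N[m]_2%:E[(fun x => (u n x - f x)%:E)]%E) =
    (fun n => (nrm (fun x => u n x - f x))%:E).
  by apply/funext => n; apply: Lnorm2E; exact: sqiB.
split=> [H|H]; last by apply/cvg_EFin => //; exact: nearW.
exact: fine_cvg H.
Qed.

Lemma L2_weak_cvgP (u : nat -> X -> R) f : L2_weak_cvg m u f <->
  forall g, sqi g -> ip (u n) g @[n --> \oo] --> ip f g.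
Proof.
split=> H g sg; last first.
  have := H g ((L2P m _).1 sg); under eq_fun do rewrite ip_def; by rewrite ip_def.
have := H g ((L2P m _).2 sg); under [in X in _ -> X]eq_fun do rewrite ip_def; by rewrite ip_def.
Qed.

Lemma ip_le_ae g h1 h2 : sqi g -> sqi h1 -> sqi h2 -> (\forall x \ae m, 0 <= g x) ->
  (\forall x \ae m, h1 x <= h2 x) -> ip g h1 <= ip g h2.
Proof.
move=> sg s1 s2 g0 h12; rewrite !ip_def; apply: le_Rint_ae; [exact: sqi_mul..|].
by apply: (ae_mp2 g0 h12) => x gx hx; rewrite ler_wpM2l.
Qed.

Lemma relaxed_slope_ip f G h : sqi f -> energy_slope f G -> relaxed_slope m f h ->
  sqi h /\ ip G G <= ip G h.
Proof.
move=> sf eG [/L2P sh [u [w [[Lu uf] su /L2P sw /L2_weak_cvgP uw wh]]]].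
have [sG _ minG] := eG; split=> //.
have au n : adm (u n).
  by have [Lun /L2P sun] := Lu n; have /L2P sln := su n; split.
have {}uf : L2lim u f by apply/L2_cvgP => // n; case: (au n).
apply: (@le_trans _ _ (ip G w)).
  by apply: (minG u (fun n => lip_a (u n)) w) => // n; have [] := au n.
by apply: ip_le_ae => //; exact: energy_slope_ge0 eG.
Qed.

Lemma energy_slope_min f G : adm f -> energy_slope f G -> is_min_relaxed_slope m f G.
Proof.
move=> [Lf sf slf] eG; have [sG [u [au uf uG]] _] := eG.
split.
- split; first exact/L2P.
  apply: (@le_lt_trans _ _ (2^-1%:E * \int[m]_x (lip_a f x ^+ 2)%:E)%E).
    apply: ereal_inf_lbound; exists (fun=> f) => /=.
      split=> [_|]; first by split=> //; exact/L2P.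
      apply/L2_cvgP => //; rewrite /L2lim.
      by under eq_fun do rewrite nrm_self_sub; exact: cvg_cst.
    by rewrite (cvg_limn_einf_sup (cvg_cst _)).
  by rewrite (intg_fin (proj2 slf)) -EFinM ltry.
- split; first exact/L2P.
  exists u, G; split.
  - split=> [n|]; first by have [? ? _] := au n; split=> //; exact/L2P.
    by apply/L2_cvgP => // n; case: (au n).
  - by move=> n; apply/L2P; case: (au n).
  - exact/L2P.
  - by apply/L2_weak_cvgP => g sg; apply: ip_cvgl => // n; case: (au n).
  - exact: aeT.
- move=> h /(relaxed_slope_ip sf eG)[sh hG].
  by rewrite !Lnorm2E// lee_fin nrm_le_of_ip.
Qed.

(** [min_relaxed_slope] is a choice among relaxed slopes of least norm. Such a [g] satisfies
    [nrm g <= nrm G] and [ip G G <= ip G g], so expanding the square of [g - G] shows that its norm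
    is 0. *)
Lemma min_relaxed_slopeP f : adm f -> exists G, [/\ energy_slope f G,
  is_min_relaxed_slope m f (min_relaxed_slope m f) &
  \forall x \ae m, min_relaxed_slope m f x = G x].
Proof.
move=> af; have [_ sf _] := af; have [G eG] := energy_slope_exists af.
have sG : sqi G by case: eG.
have mG := energy_slope_min af eG.
have mm : is_min_relaxed_slope m f (min_relaxed_slope m f).
  by rewrite /min_relaxed_slope; case: xgetP => [g -> //|/(_ G)].
exists G; split=> //; move: mm; set g := min_relaxed_slope m f => mm.
have [_ rg gmin] := mm; have [sg hG] := relaxed_slope_ip sf eG rg.
have gG : nrm g <= nrm G.
  have [_ rG _] := mG; have := gmin _ rG.
  by rewrite !Lnorm2E// lee_fin.
have sB := sqiB sg sG.
have n0 : nrm (fun x => g x - G x) = 0.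
  apply/eqP; rewrite eq_le nrm_ge0 andbT; apply: ler_of_sqr => //.
  rewrite expr0n/= sqr_nrm ipBB// (ipC m g G).
  have := ler_sqr_nneg (nrm_ge0 m g) gG; rewrite !sqr_nrm; move: hG.
  by move: (ip g g) (ip G g) (ip G G) => a b c; lra.
by apply: (ae_mp (nrm_eq0_ae sB n0)) => x /eqP; rewrite subr_eq0 => /eqP.
Qed.

(** Minimality concerns norms only; the pointwise bound is the locality comparison for the constant
    sequence [f], with majorant [lip_a f] and weight 1. *)
Lemma min_relaxed_slope_le_lip_a f : adm f ->
  \forall x \ae m, min_relaxed_slope m f x <= lip_a f x.
Proof.
move=> af; have [Lf sf slf] := af; have [G [eG _ gG]] := min_relaxed_slopeP af.
have cst_cvg (h : X -> R) : L2lim (fun=> h) h.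
  by rewrite /L2lim; under eq_fun do rewrite nrm_self_sub; exact: cvg_cst.
have l0 : \forall x \ae m, 0 <= lip_a f x.
  by apply: aeT => x; apply: lip_a_ge0; exact: Lip_bL.
have one x : 0 <= (fun _ : X => 1 : R) x <= 1 by rewrite ler01 lexx.
have H := @energy_slope_le_on f f G (lip_a f) (fun=> f) (fun=> lip_a f) _ af af eG
  (fun=> af) (cst_cvg f) (fun=> slf) (fun _ x => lexx _) slf (cst_cvg _) l0
  (Lip_b_cst 1) one (fun _ _ => erefl).
by apply: (ae_mp2 gG H) => x -> /(_ (oner_neq0 _)).
Qed.

Lemma min_relaxed_slope_local f1 f2 phi : adm f1 -> adm f2 -> Lip_b phi ->
  (forall x, 0 <= phi x <= 1) -> (forall x, phi x != 0 -> f1 x = f2 x) ->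
  \forall x \ae m, phi x != 0 -> min_relaxed_slope m f1 x = min_relaxed_slope m f2 x.
Proof.
move=> a1 a2 Lp p01 p12.
have [G1 [eG1 _ g1]] := min_relaxed_slopeP a1; have [G2 [eG2 _ g2]] := min_relaxed_slopeP a2.
have le f f' G G' : adm f -> adm f' -> energy_slope f G -> energy_slope f' G' ->
    (forall x, phi x != 0 -> f x = f' x) -> \forall x \ae m, phi x != 0 -> G x <= G' x.
  move=> a a' e e' ff; have [sG' [u [au uf uG]] _] := e'.
  apply: (energy_slope_le_on a a' e au uf _ _ sG' uG (energy_slope_ge0 e') Lp p01 ff) => //.
  by move=> n; case: (au n).
have H1 := le _ _ _ _ a1 a2 eG1 eG2 p12.
have H2 := le _ _ _ _ a2 a1 eG2 eG1 (fun x px => esym (p12 x px)).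
have H3 : \forall x \ae m, phi x != 0 -> G1 x = G2 x.
  by apply: (ae_mp2 H1 H2) => x h1 h2 px; apply/eqP; rewrite eq_le h1// h2.
by apply: (ae_mp3 g1 g2 H3) => x -> ->.
Qed.

(** * Gluing over balls and slopes of bounded Lipschitz functions *)

Variable x0 : X.

(** The least integer radius whose open ball about [x0] contains [x]. Evaluating [g k] on the [k]-th
    shell glues a family compatible on balls into one Borel function. *)
Definition shell x : nat := (Num.truncn (mdist x0 x)).+1.

Lemma shellP x : mdist x0 x < (shell x)%:R. Proof. exact: truncnS_gt. Qed.

Lemma shell_le x (k : nat) : mdist x0 x < k%:R -> (shell x <= k)%N.
Proof. by move=> xk; rewrite /shell truncn_lt_nat ?mdist_ge0. Qed.

Lemma shell_meas (k : nat) : measurable ([set x | shell x = k] : set (borel X)).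
Proof.
rewrite (_ : [set x | _] = ball x0 k%:R `\` ball x0 k.-1%:R).
  by apply: measurableD; exact: ball_meas.
apply/seteqP; split=> [x /= <-|x /= [/ballP xk nk]].
  split; first exact/ballP/shellP.
  move=> /ballP; rewrite ltNge /= => /negP; apply; rewrite /shell/=.
  by have /andP[] := truncn_itv (mdist_ge0 x0 x).
apply/eqP; rewrite eqn_leq shell_le//=.
rewrite leqNgt; apply/negP => sk; apply: nk; apply/ballP.
apply: (lt_le_trans (shellP x)); rewrite ler_nat.
by case: k sk {xk} => //= k; rewrite ltnS.
Qed.

Lemma glue_L0 (g : nat -> X -> R) : (forall k, L0 (g k)) -> L0 (fun x => g (shell x) x).
Proof.
move=> mg _ Y mY; rewrite setTI.
rewrite (_ : _ @^-1` Y = \bigcup_k ([set x | shell x = k] `&` g k @^-1` Y)).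
  apply: bigcupT_measurable => k; apply: measurableI; first exact: shell_meas.
  by rewrite -[X in measurable X]setTI; exact: mg.
apply/seteqP; split=> [x Yx|x [k _ [<-]]] //=.
by exists (shell x).
Qed.

Lemma glue_ae (g : nat -> X -> R) :
  (forall j k, (j <= k)%N -> \forall x \ae m, mdist x0 x < j%:R -> g j x = g k x) ->
  forall k, \forall x \ae m, mdist x0 x < k%:R -> g (shell x) x = g k x.
Proof.
move=> gg k.
have H : \forall x \ae m, forall j, (j <= k)%N -> mdist x0 x < j%:R -> g j x = g k x.
  apply: ae_foralln => j; case: (leqP j k) => jk; last exact: aeT.
  by apply: (ae_mp (gg j k jk)) => x.
apply: (ae_mp H) => x {}H xk; apply: H; first exact: shell_le.
exact: shellP.
Qed.

Lemma ae_shells (P : X -> Prop) :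
  (forall k : nat, \forall x \ae m, mdist x0 x < k%:R -> P x) -> \forall x \ae m, P x.
Proof.
move=> H; have : \forall x \ae m, forall k : nat, mdist x0 x < k%:R -> P x.
  exact: ae_foralln.
by move=> /ae_mp; apply=> x; apply; exact: shellP.
Qed.

Definition localize f (k : nat) x := f x * cutoff x0 k x.

Lemma localize_Lip_bs f k : Lip_b f -> Lip_bs (localize f k).
Proof. by move=> Lf; apply: Lip_bs_mulr => //; exact: cutoff_Lip_bs. Qed.

Lemma localize_adm f k : Lip_b f -> adm (localize f k).
Proof. by move=> Lf; apply: Lip_bs_adm; exact: localize_Lip_bs. Qed.

Lemma localize_eq f (k : nat) x : mdist x0 x <= k%:R -> localize f k x = f x.
Proof. by move=> xk; rewrite /localize cutoff_eq1// mulr1. Qed.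

Lemma min_relaxed_slope_balls f1 f2 x r y s : adm f1 -> adm f2 ->
  (forall z, mdist x z < r -> mdist y z < s -> f1 z = f2 z) ->
  \forall z \ae m, mdist x z < r -> mdist y z < s ->
    min_relaxed_slope m f1 z = min_relaxed_slope m f2 z.
Proof.
move=> a1 a2 f12.
(* Positive exactly on the intersection of the two balls. *)
pose phi z := Num.min 1 (Num.min (tent x r 0 z) (tent y s 0 z)).
have Lp : Lip_b phi.
  apply: Lip_b_min; first exact: Lip_b_cst.
  by apply: Lip_b_min; exact: tent_Lip_b.
have p0 z : 0 <= phi z by rewrite !le_min ler01 !tent_ge0.
have p01 z : 0 <= phi z <= 1 by rewrite p0 ge_min lexx.
have pz z : phi z != 0 -> f1 z = f2 z.
  move=> pn; have : 0 < phi z by rewrite lt_neqAle eq_sym pn p0.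
  by rewrite !lt_min => /and3P[_ /tent_supp + /tent_supp]; rewrite !divr1; exact: f12.
apply: (ae_mp (min_relaxed_slope_local a1 a2 Lp p01 pz)) => z Hz xz yz.
apply: Hz; rewrite gt_eqF// !lt_min ltr01/= /tent !lt_max !mul1r !subr_gt0.
by rewrite xz yz !orbT.
Qed.

(** [slope] is a choice with default 0, so the point is that some slope exists: it is glued from the
    minimal relaxed slopes of [localize f k], compatible by locality. *)
Lemma slopeP f : Lip_b f -> is_slope m f (slope m f).
Proof.
move=> Lf; rewrite /slope; case: xgetP => [g -> //|ng]; exfalso.
pose g k := min_relaxed_slope m (localize f k).
apply: (ng (fun x => g (shell x) x)); split.
  apply: glue_L0 => k; have [G [_ [_ [/L2P sg _] _] _]] := min_relaxed_slopeP (localize_adm k Lf).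
  exact: sqi_meas sg.
have gg j k : (j <= k)%N -> \forall x \ae m, mdist x0 x < j%:R -> g j x = g k x.
  move=> jk; have := @min_relaxed_slope_balls (localize f j) (localize f k) x0 j%:R x0 j%:R.
  move=> /(_ (localize_adm j Lf) (localize_adm k Lf)) H.
  apply: (ae_mp (H _)) => [z zj _|x Hx xj]; last exact: Hx.
  by rewrite !localize_eq// ?(ltW zj)// (le_trans (ltW zj))// ler_nat.
move=> x r fr r0 Lfr frf; apply: ae_shells => k.
have := @min_relaxed_slope_balls (localize f k) fr x r x0 k%:R.
move=> /(_ (localize_adm k Lf) (Lip_bs_adm Lfr)) H.
apply: (ae_mp2 (glue_ae gg k) (H _)) => [z xz zk|z gz Hz zk /ballP xz].
  by rewrite localize_eq ?(ltW zk)// frf//; exact/ballP.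
by rewrite (gz zk); exact: Hz.
Qed.

Lemma slope_localize f k : Lip_b f ->
  \forall x \ae m, mdist x0 x < k%:R -> slope m f x = min_relaxed_slope m (localize f k) x.
Proof.
move=> Lf; have [_ H] := slopeP Lf.
(* [is_slope] speaks of positive radii only; for [k = 0] the ball is empty. *)
case: k => [|k]; first by apply: aeT => x; rewrite ltNge mdist_ge0.
have := H x0 k.+1%:R (localize f k.+1) (ltr0Sn _ _) (localize_Lip_bs _ Lf).
move=> /(_ _) HH; apply: (ae_mp (HH _)) => [y /ballP yk|x Hx xk]; last by apply: Hx; exact/ballP.
by rewrite localize_eq// ltW.
Qed.

Lemma slope_le_lip_a f : Lip_b f -> \forall x \ae m, slope m f x <= lip_a f x.
Proof.
move=> Lf; apply: ae_shells => k.
apply: (ae_mp2 (slope_localize k Lf) (min_relaxed_slope_le_lip_a (localize_adm k Lf))) => x Sx Hx xk.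
rewrite Sx// (le_trans Hx)// le_eqVlt; apply/orP; left; apply/eqP.
have r0 : 0 < k%:R - mdist x0 x by rewrite subr_gt0.
apply: lip_a_eq_local r0 _ => [||y /ballP xy]; [|exact: Lip_bL|].
  by apply: Lip_bL; case: (localize_Lip_bs k Lf).
by rewrite localize_eq// (le_trans (metric_tri x _ _))// -lerBrDl ltW.
Qed.

End slopes.

(** * Derivations *)

Section local_integrability.
Context {R : realType} {X : completeMetricType R}.
Variable m : {measure set (borel X) -> \bar R}.
Hypothesis m_fin : finite_on_bounded m.
Variable x0 : X.
Implicit Types (f g h u v w F G H : X -> R) (x y : X) (c r e : R).

Local Notation intg := (@intg _ (borel X) R m).
Local Notation sqi := (@sqi _ (borel X) R m).
Local Notation cut := (cutoff x0).

(** Local integrability is expressed by cutoffs rather than restrictions, so that all integrals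
    range over the whole space; [loc2P] and [loc1P] identify it with [Lp_loc]. *)
Definition loc2 h := L0 h /\ forall k, sqi (fun x => h x * cut k x).
Definition loc1 g := L0 g /\ forall k, intg (fun x => g x * cut k x).

Lemma cut_L0 k : L0 (cut k).
Proof. by apply: Lip_b_L0; exact: cutoff_Lip_b. Qed.

Lemma cut_norm k x : `|cut k x| <= 1.
Proof. by rewrite ger0_norm ?cutoff_ge0// cutoff_le1. Qed.

Lemma sqi_cut k : sqi (cut k).
Proof.
by apply: (sqi_bounded_support m_fin (cut_L0 k) (cut_norm k)) => y; exact: cutoff_supp.
Qed.

Lemma mul_cut f (k : nat) x : (f x != 0 -> mdist x0 x < k%:R) -> f x = f x * cut k x.
Proof.
move=> fk; have [->|/fk xk] := eqVneq (f x) 0; first by rewrite mul0r.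
by rewrite cutoff_eq1 ?mulr1// ltW.
Qed.

Lemma loc2_mul h v c (k : nat) : loc2 h -> L0 v -> (forall x, `|v x| <= c) ->
  (forall x, v x != 0 -> mdist x0 x < k%:R) -> sqi (fun x => h x * v x).
Proof.
move=> [mh sh] mv vc vk; have := sqi_mulB mv vc (sh k).
rewrite (_ : (fun x => _) = (fun x => h x * v x))//.
by apply/funext => x; rewrite {2}(@mul_cut v k x)//; [ring|exact: vk].
Qed.

Lemma loc1_mul g v c (k : nat) : loc1 g -> L0 v -> (forall x, `|v x| <= c) ->
  (forall x, v x != 0 -> mdist x0 x < k%:R) -> intg (fun x => g x * v x).
Proof.
move=> [mg ig] mv vc vk; have := intgM_bounded (ig k) mv vc.
rewrite (_ : (fun x => _ * _ * _) = (fun x => g x * v x))//.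
by apply/funext => x; rewrite {2}(@mul_cut v k x)//; [ring|exact: vk].
Qed.

Lemma loc2_loc1 h : loc2 h -> loc1 h.
Proof.
(* [cut k.+1] is 1 on the support of [cut k], so the product of the two cutoffs is [cut k]. *)
move=> [mh sh]; split=> // k; have := sqi_mul (sh k.+1) (sqi_cut k).
rewrite (_ : (fun x => _ * _ * _) = (fun x => h x * cut k x))//.
apply/funext => x; rewrite [in RHS](@mul_cut (cut k) k.+1 x); last exact: cutoff_supp.
by ring.
Qed.

Lemma loc2_le_ae h g : loc2 h -> L0 g -> (\forall x \ae m, `|g x| <= `|h x|) -> loc2 g.
Proof.
move=> [mh sh] mg gh; split=> // k; apply: sqi_le_ae (sh k).
  by apply: measurable_funM => //; exact: cut_L0.
by apply: (ae_mp gh) => x gx; rewrite !normrM ler_wpM2r.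
Qed.

Lemma loc2Z c h : loc2 h -> loc2 (fun x => c * h x).
Proof.
move=> [mh sh]; split; first exact: measurable_funM.
by move=> k; have := sqiZ c (sh k); under eq_fun do rewrite mulrA.
Qed.

Lemma ball_bounded x r : metric_bounded (ball x r).
Proof. by exists x, r. Qed.

Lemma integrable_on_ball f (k : nat) : L0 f -> m.-integrable (ball x0 k.+1%:R) (EFin \o f) ->
  (forall x, 0 <= f x) -> intg (fun x => f x * cut k x).
Proof.
move=> mf fi f0; have mB := @ball_meas R X x0 k.+1%:R.
have /(integrable_mkcond _ mB) := fi.
rewrite restrict_EFin; apply: intg_le.
  by apply: measurable_funM => //; exact: cut_L0.
move=> x; rewrite normrM (ger0_norm (f0 x)) ger0_norm ?cutoff_ge0// patchE.
case: ifPn => [_|/negP xB]; first by rewrite ler_piMr// cutoff_le1.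
rewrite cutoff_eq0 ?mulr0// leNgt; apply/negP => xk; apply: xB.
by apply/mem_set/ballP.
Qed.

Lemma integrable_of_cut f (B : set (borel X)) : measurable B -> metric_bounded B ->
  (forall k, intg (fun x => f x * cut k x)) -> m.-integrable B (EFin \o f).
Proof.
move=> mB /(metric_boundedP x0)[k Bk] fi.
have := integrableS measurableT mB (subsetT B) (fi k).
apply: eq_integrable => // x /set_mem/Bk/ltW xk /=.
by rewrite cutoff_eq1// mulr1.
Qed.

Lemma loc2P h : Lp_loc m 2 h <-> loc2 h.
Proof.
split=> -[mh hB]; split=> //.
  move=> k; split; first by apply: measurable_funM => //; exact: cut_L0.
  have i2 : intg (fun x => h x ^+ 2 * cut k x).
    apply: integrable_on_ball; [exact: measurable_funX| |by move=> x; exact: sqr_ge0].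
    have := hB _ (@ball_meas R X x0 k.+1%:R) (ball_bounded _ _).
    apply: eq_integrable; first exact: ball_meas.
    by move=> x _ /=; rewrite powR_mulrn// real_normK// num_real.
  have := intgM_bounded i2 (cut_L0 k) (cut_norm k).
  by under eq_fun do rewrite -mulrA -expr2 -exprMn.
move=> B mB bB; have : m.-integrable B (EFin \o (fun x => h x ^+ 2)).
  apply: (integrable_of_cut mB bB) => k.
  have [mk ik] := hB k.+1; have := intgM_bounded ik (cut_L0 k) (cut_norm k).
  rewrite (_ : (fun x => _ * _) = (fun x => h x ^+ 2 * cut k x))//.
  apply/funext => x; rewrite (@mul_cut (cut k) k.+1 x); last exact: cutoff_supp.
  have [->|/cutoff_supp/ltW xk] := eqVneq (cut k x) 0; first by rewrite !mul0r !mulr0.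
  by rewrite cutoff_eq1// !mulr1.
apply: eq_integrable => // x _ /=.
by rewrite powR_mulrn// real_normK// num_real.
Qed.

Lemma loc1P g : Lp_loc m 1 g <-> loc1 g.
Proof.
have nE x : `|g x| `^ 1 = `|g x| by rewrite powRr1.
split=> -[mg gB]; split=> //.
  move=> k; have i1 : intg (fun x => `|g x| * cut k x).
    apply: integrable_on_ball; [exact: measurableT_comp| |by []].
    have := gB _ (@ball_meas R X x0 k.+1%:R) (ball_bounded _ _).
    by apply: eq_integrable; [exact: ball_meas|move=> x _ /=; rewrite nE].
  apply: intg_le i1; first by apply: measurable_funM => //; exact: cut_L0.
  by move=> x; rewrite normrM (ger0_norm (cutoff_ge0 _ _ _)).
move=> B mB bB; have : m.-integrable B (EFin \o (fun x => `|g x|)).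
  apply: (integrable_of_cut mB bB) => k.
  have := intg_norm (gB k); under eq_fun do rewrite normrM (ger0_norm (cutoff_ge0 _ _ _)).
  by [].
by apply: eq_integrable => // x _ /=; rewrite nE.
Qed.

End local_integrability.

(** * Leibniz rule and integration by parts *)

Section derivations.
Context {R : realType} {X : completeMetricType R}.
Variable m : {measure set (borel X) -> \bar R}.
Hypothesis m_fin : finite_on_bounded m.
Variable d : nat -> X.
Hypothesis d_dense : forall x (e : R), 0 < e -> exists i, mdist (d i) x < e.
Variable x0 : X.
Implicit Types (f g h u v w F G H : X -> R) (x y : X) (c r e : R).

Variables (b : (X -> R) -> X -> R) (h : X -> R).
Hypothesis b_lin : Lip_b_linear m b.
Hypothesis h_ge0 : \forall x \ae m, 0 <= h x.
(** The bound is by [lip_a f] rather than by the relaxed slope, so that the section applies to the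
    given derivations and also to their limit, for which only this weaker bound is known at
    first. *)
Hypothesis b_lip : forall f, Lip_b f -> \forall x \ae m, `|b f x| <= h x * lip_a f x.

Lemma der_cst c : \forall x \ae m, b (fun=> c) x = 0.
Proof.
apply: (ae_mp (b_lip (Lip_b_cst c))) => x; rewrite lip_a_cst mulr0 normr_le0.
by move=> /eqP.
Qed.

(* Near [p], [f g - f(p) g - g(p) f] differs by a constant from
   [(f - f(p)) (g - g(p))], whose asymptotic Lipschitz constant is small. *)
Lemma leibniz f g : Lip_b f -> Lip_b g ->
  \forall x \ae m, b (fun y => f y * g y) x = f x * b g x + g x * b f x.
Proof.
move=> Lf Lg; have Lfg := Lip_bM Lf Lg.
have [L [_ [L0' _ HL _]]] := (Lip_bP f).1 Lf.
have [K [_ [K0 _ HK _]]] := (Lip_bP g).1 Lg.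
(* Centres from the dense sequence and dyadic radii leave countably many exceptional null sets,
   hence a single one. *)
have small i j : \forall x \ae m, mdist (d i) x < 2^-1 ^+ j ->
    `|b (fun y => f y * g y) x - f (d i) * b g x - g (d i) * b f x| <=
    h x * (2 * 2^-1 ^+ j * L * K).
  set p := d i; set r : R := 2^-1 ^+ j.
  have r0 : 0 < r by exact: exp_half_gt0.
  have Lc : Lip_b (fun _ : X => f p * g p) by exact: Lip_b_cst.
  have L1 := Lip_bD (Lip_bZ (- g p) Lf) Lfg.
  have L2 := Lip_bD (Lip_bZ (- f p) Lg) L1.
  have L3 := Lip_bD (Lip_bZ 1 Lc) L2.
  have [_ lin] := b_lin.
  have e1 := lin (- g p) f _ Lf Lfg.
  have e2 := lin (- f p) g _ Lg L1.
  have e3 := lin 1 _ _ Lc L2.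
  have lF x : mdist p x < r -> lip_a (fun y => 1 * (f p * g p) +
      (- f p * g y + (- g p * f y + f y * g y))) x <= 2 * r * L * K.
    move=> xr; have s0 : 0 < r - mdist p x by rewrite subr_gt0.
    apply: (@lip_a_le _ _ _ _ _ (r - mdist p x)) => //; first exact: Lip_bL.
      by rewrite !mulr_ge0// ltW.
    move=> y z /ballP xy /ballP xz.
    have py : mdist y p <= r.
      by have := metric_tri x p y; rewrite (metric_sym y p); lra.
    have pz : mdist z p <= r.
      by have := metric_tri x p z; rewrite (metric_sym z p); lra.
    rewrite (_ : _ - _ = (f y - f p) * (g y - g z) + (g z - g p) * (f y - f z)); last by ring.
    rewrite (le_trans (ler_normD _ _))// !normrM.
    rewrite [leRHS](_ : _ = (L * r) * (K * mdist y z) + (K * r) * (L * mdist y z)); last by ring.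
    apply: lerD; apply: ler_pM => //; try exact: HL; try exact: HK.
      by apply: le_trans (HL _ _ I I) _; rewrite ler_wpM2l.
    by apply: le_trans (HK _ _ I I) _; rewrite ler_wpM2l.
  have e123 := ae_mp3 e1 e2 e3 (fun x a1 a2 a3 => conj a1 (conj a2 a3)).
  have e4 := ae_mp2 (der_cst (f p * g p)) h_ge0 (fun x a1 a2 => conj a1 a2).
  apply: (ae_mp3 e123 e4 (b_lip L3)) => x [a1 [a2 a3]] [a4 hx] a5 xr.
  rewrite (_ : _ - _ - _ = b (fun y => 1 * (f p * g p) +
      (- f p * g y + (- g p * f y + f y * g y))) x); last first.
    by rewrite a3 a2 a1 a4; ring.
  by apply: (le_trans a5); apply: ler_wpM2l => //; exact: lF.
have H : \forall x \ae m, forall i j, mdist (d i) x < 2^-1 ^+ j ->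
    `|b (fun y => f y * g y) x - f (d i) * b g x - g (d i) * b f x| <=
    h x * (2 * 2^-1 ^+ j * L * K).
  by apply: ae_foralln => i; apply: ae_foralln => j; exact: small.
apply: (ae_mp2 H h_ge0) => x {}H hx; apply/eqP; rewrite -subr_eq0 -normr_le0.
set A := b _ x in H *; set B := b g x in H *; set C := b f x in H *.
apply: (@le_eps_mul _ _ _ (h x * (2 * L * K) + L * `|B| + K * `|C|)) => e e0 e1.
have [j je] := exp_half_small e0; have r0 := exp_half_gt0 R j.
have [i ix] := d_dense x r0; have {}H := H i j ix.
set r := 2^-1 ^+ j in je r0 ix H.
rewrite add0r; apply: (@le_trans _ _ (r * (h x * (2 * L * K) + L * `|B| + K * `|C|))); last first.
  by apply: ler_wpM2r => //; rewrite !addr_ge0// !mulr_ge0.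
rewrite (_ : A - _ = (A - f (d i) * B - g (d i) * C) + (f (d i) - f x) * B +
  (g (d i) - g x) * C); last by ring.
rewrite [leRHS](_ : _ = h x * (2 * r * L * K) + (L * r) * `|B| + (K * r) * `|C|); last by ring.
rewrite (le_trans (ler_normD _ _))//; apply: lerD.
  rewrite (le_trans (ler_normD _ _))//; apply: lerD => //.
  rewrite normrM ler_wpM2r//; apply: le_trans (HL _ _ I I) _.
  by rewrite ler_wpM2l// ltW.
rewrite normrM ler_wpM2r//; apply: le_trans (HK _ _ I I) _.
by rewrite ler_wpM2l// ltW.
Qed.

Hypothesis h_loc2 : loc2 m x0 h.

Lemma der_L0 f : Lip_b f -> L0 (b f).
Proof. by case: b_lin => H _; exact: H. Qed.

Lemma der_loc2 f : Lip_b f -> loc2 m x0 (b f).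
Proof.
move=> Lf; have [L [_ [L0' _ HL _]]] := (Lip_bP f).1 Lf.
apply: (loc2_le_ae (loc2Z L h_loc2) (der_L0 Lf)).
apply: (ae_mp2 (b_lip Lf) h_ge0) => x bx hx; apply: (le_trans bx).
rewrite normrM (ger0_norm L0') (ger0_norm hx) mulrC ler_wpM2r//.
exact: lip_a_le_Lip.
Qed.

(** The radius grows by the 1 of [lip_a_supp], whence [k.+1] here and in later cutoffs. *)
Lemma der_supp v (k : nat) : Lip_b v -> (forall x, v x != 0 -> mdist x0 x < k%:R) ->
  \forall x \ae m, b v x != 0 -> mdist x0 x < k.+1%:R.
Proof.
move=> Lv vk; apply: (ae_mp (b_lip Lv)) => x bx bx0.
rewrite -natr1; apply: (lip_a_supp (Lip_bL Lv) vk); apply: contra bx0 => /eqP l0.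
by move: bx; rewrite l0 mulr0 normr_le0.
Qed.

Lemma der_mul_intg f v : Lip_b f -> Lip_bs v -> intg m (fun x => b f x * v x).
Proof.
move=> Lf [Lv /(bounded_supportP x0)[k vk]].
have [_ [M [_ _ _ HM]]] := (Lip_bP v).1 Lv.
apply: (loc1_mul _ (Lip_b_L0 Lv) HM vk).
by apply: loc2_loc1 => //; exact: der_loc2.
Qed.

Lemma der_mul_cut v (k : nat) : Lip_b v -> (forall x, v x != 0 -> mdist x0 x < k%:R) ->
  \forall x \ae m, b v x = b v x * cutoff x0 k.+1 x.
Proof. by move=> Lv vk; apply: (ae_mp (der_supp Lv vk)) => x; exact: mul_cut. Qed.

Lemma der_mul_intg_bs f v : Lip_b f -> Lip_bs v -> intg m (fun x => b v x * f x).
Proof.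
move=> Lf [Lv /(bounded_supportP x0)[k vk]].
have [_ [M [_ _ _ HM]]] := (Lip_bP f).1 Lf.
apply: (intgM_bounded _ (Lip_b_L0 Lf) HM).
have i1 := intg_norm ((loc2_loc1 m_fin (der_loc2 Lv)).2 k.+1).
apply: intg_le_ae i1; first exact: der_L0.
by apply: (ae_mp (der_mul_cut Lv vk)) => x <-.
Qed.

Lemma der_by_parts g f v : is_divergence m b g -> Lip_b f -> Lip_bs v ->
  \int[m]_x (b f x * v x) =
  - (\int[m]_x (b v x * f x)) - \int[m]_x (g x * (f x * v x)).
Proof.
move=> [/(loc1P m x0) lg div] Lf Lv; have [Lv' sv] := Lv.
have Lfv : Lip_bs (fun x => f x * v x) by exact: Lip_bs_mulr.
have i1 := der_mul_intg Lf Lv; have i2 := der_mul_intg_bs Lf Lv.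
have e1 : \int[m]_x b (fun y => f y * v y) x =
    \int[m]_x (b v x * f x) + \int[m]_x (b f x * v x).
  rewrite -ItgD//; apply: (@eq_Rint_ae _ (borel X)).
  - by apply: der_L0; case: Lfv.
  - exact: (intg_meas (intgD i2 i1)).
  - by apply: (ae_mp (leibniz Lf Lv')) => x ->; ring.
have e2 : \int[m]_x (g x * (f x * v x)) = \int[m]_x (f x * v x * g x).
  by apply: eq_Rintegral => x _; rewrite mulrC.
by have := div _ Lfv; rewrite e2 e1; lra.
Qed.

End derivations.

(** * Signs of locally integrable functions *)

Section local_signs.
Context {R : realType} {X : completeMetricType R}.
Variable m : {measure set (borel X) -> \bar R}.
Hypothesis m_fin : finite_on_bounded m.
Variable d : nat -> X.
Hypothesis d_dense : forall x (e : R), 0 < e -> exists i, mdist (d i) x < e.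
Variable x0 : X.
Implicit Types (f g h u v w F G H : X -> R) (x y p : X) (c r e : R).
Local Notation cut := (cutoff x0).

Lemma tent_gt0_neq0 p r x : tent p r 0 x != 0 -> mdist p x < r.
Proof.
move=> p0; have : 0 < tent p r 0 x by rewrite lt_neqAle eq_sym p0 tent_ge0.
by move=> /tent_supp; rewrite divr1.
Qed.

Lemma tent_gt0 p r x : mdist p x < r -> 0 < tent p r 0 x.
Proof. by move=> px; rewrite /tent mul1r lt_max subr_gt0 px orbT. Qed.

Lemma tent_Lip_bs p r : Lip_bs (tent p r 0).
Proof.
split; first exact: tent_Lip_b.
by exists p, r => x /= /tent_gt0_neq0 ?; exact/ballP.
Qed.

Lemma loc1_Lip_bs F v : loc1 m x0 F -> Lip_bs v -> intg m (fun x => F x * v x).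
Proof.
move=> lF [Lv /(bounded_supportP x0)[k vk]]; have [_ [M [_ _ _ vM]]] := (Lip_bP v).1 Lv.
exact: (loc1_mul lF (Lip_b_L0 Lv) vM vk).
Qed.

(** Multiplying by a tent makes [F] integrable on the whole space without changing its sign in the
    ball; the global criterion for weights then applies. *)
Lemma loc1_ge0_ball F p r : loc1 m x0 F ->
  (forall v, Lip_bs v -> (forall x, 0 <= v x) -> (forall x, v x != 0 -> mdist p x < r) ->
    0 <= \int[m]_x (F x * v x)) ->
  \forall x \ae m, mdist p x < r -> 0 <= F x.
Proof.
move=> lF H; pose phi := tent p r 0; have Lphi : Lip_bs phi by exact: tent_Lip_bs.
have : \forall x \ae m, 0 <= F x * phi x.
  apply: (ae_ge0_of_weights d_dense); first exact: loc1_Lip_bs.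
  move=> w Lw w01; have := H (fun x => w x * phi x).
  rewrite (@eq_Rintegral _ _ _ m _ (fun x => F x * phi x * w x)); last by move=> x _; ring.
  apply; first exact: Lip_bs_mulr.
    by move=> x; rewrite mulr_ge0 ?tent_ge0//; case/andP: (w01 x).
  by move=> x; rewrite mulf_eq0 negb_or => /andP[_ /tent_gt0_neq0].
move=> HF; apply: (ae_mp HF) => x Fx px.
by rewrite -(pmulr_lge0 _ (tent_gt0 px)).
Qed.

Lemma loc1_ge0 F : loc1 m x0 F ->
  (forall v, Lip_bs v -> (forall x, 0 <= v x) -> 0 <= \int[m]_x (F x * v x)) ->
  \forall x \ae m, 0 <= F x.
Proof.
move=> lF H; apply: (ae_shells (x0 := x0)) => k.
by apply: loc1_ge0_ball => // v Lv v0 _; exact: H.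
Qed.

Lemma loc1_lin F G c e : loc1 m x0 F -> loc1 m x0 G -> loc1 m x0 (fun x => c * F x + e * G x).
Proof.
move=> [mF iF] [mG iG]; split; first by apply: measurable_funD; exact: measurable_funM.
move=> k; have := intgD (intgZ c (iF k)) (intgZ e (iG k)).
by rewrite (_ : (fun x => _ + _) = (fun x => (c * F x + e * G x) * cut k x))//; apply/funext => x; ring.
Qed.

Lemma loc1_eq0_ball F p r : loc1 m x0 F ->
  (forall v, Lip_bs v -> (forall x, v x != 0 -> mdist p x < r) -> \int[m]_x (F x * v x) = 0) ->
  \forall x \ae m, mdist p x < r -> F x = 0.
Proof.
move=> lF H.
have h1 : \forall x \ae m, mdist p x < r -> 0 <= F x.
  by apply: loc1_ge0_ball => // v Lv _ vp; rewrite H.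
have h2 : \forall x \ae m, mdist p x < r -> 0 <= -1 * F x + 0 * F x.
  apply: loc1_ge0_ball => [|v Lv _ vp]; first exact: loc1_lin.
  rewrite (@eq_Rintegral _ _ _ m _ (fun x => -1 * (F x * v x))); last by move=> x _; ring.
  by rewrite ItgZ ?H ?mulr0//; exact: loc1_Lip_bs.
by apply: (ae_mp2 h1 h2) => x f0 f1 xp; have := f0 xp; have := f1 xp; lra.
Qed.

Lemma loc1_eq0 F : loc1 m x0 F ->
  (forall v, Lip_bs v -> \int[m]_x (F x * v x) = 0) -> \forall x \ae m, F x = 0.
Proof.
move=> lF H; apply: (ae_shells (x0 := x0)) => k.
by apply: loc1_eq0_ball => // v Lv _; exact: H.
Qed.

End local_signs.

(** * Existence of the least bound of a derivation *)

Section least_bound.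
Context {R : realType} {X : completeMetricType R}.
Variable m : {measure set (borel X) -> \bar R}.
Variable x0 : X.
Variable b : (X -> R) -> X -> R.
Implicit Types (f g h q : X -> R) (x y : X).
Local Notation cut := (cutoff x0).

Lemma der_bound_min g h : der_bound m b g -> der_bound m b h ->
  der_bound m b (fun x => Num.min (g x) (h x)).
Proof.
move=> [mg g0 bg] [mh h0 bh]; split; first exact: measurable_minr.
  by apply: (ae_mp2 g0 h0) => x gx hx; rewrite le_min gx.
move=> f Lf; apply: (ae_mp2 (bg f Lf) (bh f Lf)) => x gx hx.
by case: (leP (g x) (h x)).
Qed.

Lemma der_bound_cvg (q : nat -> X -> R) h : (forall n, der_bound m b (q n)) -> L0 h ->
  (\forall x \ae m, q n x @[n --> \oo] --> h x) -> der_bound m b h.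
Proof.
move=> bq mh qh; split=> //.
  have H : \forall x \ae m, forall n, 0 <= q n x.
    by apply: ae_foralln => n; case: (bq n).
  by apply: (ae_mp2 qh H) => x qx q0; apply: (cvgr_to_ge qx); exact: nearW.
move=> f Lf; have H : \forall x \ae m, forall n, `|b f x| <= q n x * slope m f x.
  by apply: ae_foralln => n; case: (bq n) => _ _; exact.
apply: (ae_mp2 qh H) => x qx q0.
have cv : q n x * slope m f x @[n --> \oo] --> h x * slope m f x by exact: cvgMl.
by apply: (cvgr_to_ge cv); exact: nearW.
Qed.

(* The least bound is the infimum of countably many bounds whose [L^2] norms on
   balls are almost minimal. *)
Lemma der_norm_exists h : der_bound m b h -> loc2 m x0 h ->
  exists2 g, is_der_norm m b g & loc2 m x0 g.
Proof.
move=> bh lh; pose A : set (X -> R) := [set g | der_bound m b g /\ loc2 m x0 g].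
pose J (k : nat) g := nrm m (fun x => g x * cut k x).
pose I k := inf [set J k g | g in A].
have hasI k : has_inf [set J k g | g in A].
  by split; [exists (J k h), h|exists 0 => _ [g _ <-]; exact: nrm_ge0].
have /choice[q hq] (kj : nat * nat) : exists g, A g /\ J kj.1 g < I kj.1 + 2^-1 ^+ kj.2.
  have e0 := exp_half_gt0 R kj.2.
  by have [_ [g Ag <-] Hg] := inf_adherent e0 (hasI kj.1); exists g.
pose q' n := if unpickle n is Some kj then q kj else h.
have Aq n : A (q' n) by rewrite /q'; case: (unpickle n) => [kj|//]; case: (hq kj).
pose p := fix p n x := if n is n'.+1 then Num.min (p n' x) (q' n x) else q' 0%N x.
have bp n : der_bound m b (p n).
  elim: n => [|n IH] /=; first by case: (Aq 0%N).
  by apply: der_bound_min => //; case: (Aq n.+1).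
have pS n x : p n.+1 x <= p n x by rewrite /= ge_min lexx.
have pq n x : p n x <= q' n x by case: n => //= n; rewrite ge_min lexx orbT.
have pmono i j x : (i <= j)%N -> p j x <= p i x.
  move=> ij; rewrite -(subnKC ij); elim: (j - i)%N => [|n IH]; first by rewrite addn0.
  by rewrite addnS (le_trans (pS _ _)).
have p0 : \forall x \ae m, forall n, 0 <= p n x.
  by apply: ae_foralln => n; case: (bp n).
have cp : \forall x \ae m, cvgn (fun n => p n x).
  apply: (ae_mp p0) => x px; apply: nonincreasing_is_cvgn; last by exists 0 => _ [n _ <-].
  by move=> i j ij; exact: pmono.
have mp n : L0 (p n) by case: (bp n).
have [g mg pg] := ae_cvg_limit mp cp.
have bg : der_bound m b g := der_bound_cvg bp mg pg.
have gq : \forall x \ae m, 0 <= g x /\ forall n, g x <= q' n x.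
  apply: (ae_mp2 pg p0) => x px px0; split.
    by apply: (cvgr_to_ge px); exact: nearW.
  move=> n; apply: le_trans (pq n x); apply: (cvgr_to_le px).
  by exists n => // i /= ni; exact: pmono.
have lg : loc2 m x0 g.
  apply: (loc2_le_ae (Aq 0%N).2 mg); apply: (ae_mp gq) => x [g0 /(_ 0%N) gq0].
  by rewrite !ger0_norm// (le_trans g0).
exists g => //; split=> // h' bh'.
have bmin := der_bound_min bh' bg.
have min_g : \forall x \ae m, `|Num.min (h' x) (g x)| <= `|g x|.
  have [_ g0 _] := bg; have [_ h0 _] := bh'.
  apply: (ae_mp2 g0 h0) => x gx hx; rewrite !ger0_norm ?le_min ?hx//.
  by rewrite ge_min lexx orbT.
have mmin : L0 (fun x => Num.min (h' x) (g x)) by case: bmin.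
have lmin : loc2 m x0 (fun x => Num.min (h' x) (g x)) := loc2_le_ae lg mmin min_g.
(* [g] lies below every [q (k, j)], so its norm is at most the infimum [I k]; the minimum with [h']
   is a competitor, so its norm is no smaller. *)
have Jle k : J k g <= J k (fun x => Num.min (h' x) (g x)).
  apply: (@le_trans _ _ (I k)); last first.
    by apply: ge_inf; [case: (hasI k)|exists (fun x => Num.min (h' x) (g x))].
  apply/ler_addgt0Pr => e e0; have [j je] := exp_half_small e0.
  have [[_ lq] /ltW Hq] := hq (k, j).
  apply: (@le_trans _ _ (J k (q (k, j)))); last by rewrite (le_trans Hq)// lerD2l.
  apply: le_nrm; [exact: lg.2|exact: lq.2|].
  apply: (ae_mp gq) => x [g0 /(_ (pickle (k, j)))]; rewrite /q' pickleK => gqx.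
  rewrite !normrM ler_wpM2r// !ger0_norm//; exact: le_trans gqx.
apply: (ae_shells (x0 := x0)) => k.
have [sg smin] := (lg.2 k, lmin.2 k).
pose D x := (g x * cut k x) ^+ 2 - (Num.min (h' x) (g x) * cut k x) ^+ 2.
have iD : intg m D by apply: intgB; [case: sg|case: smin].
have D0 : \forall x \ae m, 0 <= D x.
  apply: (ae_mp min_g) => x gx; rewrite subr_ge0; apply: ler_sqr_norm.
  by rewrite !normrM ler_wpM2r.
have ID : \int[m]_x D x <= 0.
  rewrite ItgB; [|by case: sg|by case: smin].
  by rewrite subr_le0 -!ipE -!sqr_nrm ler_sqr_nneg ?nrm_ge0//; exact: Jle.
have [_ g0 _] := bg; have [_ h0 _] := bh'.
apply: (ae_mp3 (Rint_eq0_ae iD D0 ID) g0 h0) => x Dx gx hx xk.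
rewrite leNgt; apply/negP => hg; move: Dx.
rewrite /D cutoff_eq1 ?(ltW xk)// !mulr1 (min_l (ltW hg)).
move=> /eqP; rewrite subr_sqr mulf_eq0 subr_eq0 => /orP[/eqP gh|/eqP gh].
  by move: hg; rewrite gh ltxx.
by move: gx hx hg; lra.
Qed.

End least_bound.

(** * Weak limits along varying measures *)

(* By Tychonoff the sequence of rows has a cluster point in a product of segments. *)
Lemma diagonal_extraction (R : realType) (a : nat -> nat -> R) :
  (forall i, exists M, forall n, `|a i n| <= M) ->
  exists2 k : nat -> nat, {homo k : i j / (i < j)%N} & forall i, cvgn (fun n => a i (k n)).
Proof.
move=> /choice[M HM].
pose T := fun _ : nat => (R : topologicalType).
pose A := fun i : nat => `[- M i, M i]%classic : set (T i).
have cA : compact [set f : prod_topology T | forall i, A i (f i)].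
  by apply: tychonoff => i; exact: segment_compact.
pose s (n : nat) : prod_topology T := fun i => a i n.
have [p [_ cl]] : [set f : prod_topology T | forall i, A i (f i)] `&`
    cluster (s @ \oo) !=set0.
  apply: (cA (s @ \oo)); exists 0%N => // n _ i /=; rewrite /A/= in_itv/=.
  by rewrite -ler_norml; exact: HM.
have near_p (k : nat) (e : R) : 0 < e ->
    nbhs p [set f : prod_topology T | forall i, (i < k)%N -> `|p i - f i| < e].
  move=> e0; elim: k => [|k IH]; first by apply: filterS filterT => f _ i.
  have pk : nbhs p [set f : prod_topology T | `|p k - f k| < e].
    have /cvgrPdist_lt/(_ e e0) : f k @[f --> p] --> (p k : R).
      exact: (@proj_continuous _ T k p).
    by apply: filterS.
  apply: filterS (filterI IH pk) => f [H1 H2] i; rewrite ltnS leq_eqVlt => /predU1P[->//|].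
  exact: H1.
(* Beyond any index [kN.2] some [s n] is within [2^-kN.1] of the cluster point in its first [kN.1]
   coordinates. *)
have /choice[sel hsel] (kN : nat * nat) : exists n, (kN.2 <= n)%N /\
    forall i, (i < kN.1)%N -> `|p i - a i n| < 2^-1 ^+ kN.1.
  have e0 := exp_half_gt0 R kN.1.
  have tail : (s @ \oo) [set f | exists2 n, (kN.2 <= n)%N & f = s n].
    by exists kN.2 => // n nN; exists n.
  have [f [[n nN ->] H]] := cl _ _ tail (near_p kN.1 _ e0).
  by exists n.
pose k := fix k n := if n is n'.+1 then sel (n, (k n').+1) else sel (0, 0)%N.
exists k.
  apply: homo_ltn; first exact: ltn_trans.
  by move=> n /=; have [] := hsel (n.+1, (k n).+1).
move=> i; apply/cvg_ex; exists (p i); apply/cvgrPdist_le => e e0.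
have [j je] := exp_half_small e0; exists (maxn i.+1 j) => // n; rewrite /= geq_max => /andP[ni nj].
apply: (@le_trans _ _ (2^-1 ^+ n)); last first.
  by apply: le_trans je; exact: exp_half_le.
case: n ni {nj} => // n ni; apply/ltW.
by have [_ /(_ i ni)] := hsel (n.+1, (k n).+1).
Qed.

Lemma cvgn_of_approx (R : realType) (a : nat -> R) :
  (forall e, 0 < e -> exists c : nat -> R, cvgn c /\ \forall n \near \oo, `|a n - c n| <= e) ->
  cvgn a.
Proof.
move=> H; apply: cauchy_cvg; apply: cauchy_exP => e e0.
have e4 : 0 < e / 4 by rewrite divr_gt0.
have [c [/cvg_ex[l /= /cvgrPdist_le/(_ _ e4) cl] ac]] := H _ e4.
exists l; apply: filterS (filterI cl ac) => n [h1 h2]; rewrite /ball/=.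
rewrite (_ : l - a n = (l - c n) - (a n - c n)); last by ring.
by apply: le_lt_trans (ler_normB _ _) _; lra.
Qed.

(** * Continuous test functions with bounded support *)

Section C_bs.
Context {R : realType} {X : completeMetricType R}.
Implicit Types (f g h u v w : X -> R) (x y : X) (c r e : R).
Variable x0 : X.

Lemma C_bP v : C_b v <-> continuous v /\ exists2 M, 0 <= M & forall x, `|v x| <= M.
Proof. by split=> -[cv /bounded_real_funP]. Qed.

Lemma C_bsP v : C_bs v <-> exists M (k : nat), [/\ 0 <= M, continuous v, forall x, `|v x| <= M &
  forall x, v x != 0 -> mdist x0 x < k%:R].
Proof.
split=> [[/C_bP[cv [M M0 vM]] /(bounded_supportP x0)[k vk]]|[M [k [M0 cv vM vk]]]].
  by exists M, k.
by split; [apply/C_bP; split=> //; exists M|apply/(bounded_supportP x0); exists k].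
Qed.

Lemma C_bs_L0 v : C_bs v -> L0 v.
Proof. by move=> [[cv _] _]; exact: continuous_L0. Qed.

Lemma Lip_bs_C_bs v : Lip_bs v -> C_bs v.
Proof. by move=> [Lv sv]; split=> //; exact: Lip_b_C_b. Qed.

Lemma C_bs_mul f v : C_b f -> C_bs v -> C_bs (fun x => f x * v x).
Proof.
move=> /C_bP[cf [M M0 fM]] /C_bsP[N [k [N0 cv vN vk]]].
apply/C_bsP; exists (M * N), k; split.
- exact: mulr_ge0.
- by move=> x; apply: cvgM; [exact: cf|exact: cv].
- by move=> x; rewrite normrM ler_pM.
- by move=> x; rewrite mulf_eq0 negb_or => /andP[_ /vk].
Qed.

Lemma C_b_cst c : C_b (fun _ : X => c).
Proof. exact: Lip_b_C_b (Lip_b_cst c). Qed.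

Lemma C_bs_C_b v : C_bs v -> C_b v. Proof. by case. Qed.

Lemma C_bs_lin c e v w : C_bs v -> C_bs w -> C_bs (fun x => c * v x + e * w x).
Proof.
move=> Cv Cw; have /C_bsP[M [k [M0 cv vM vk]]] := C_bs_mul (C_b_cst c) Cv.
have /C_bsP[N [j [N0 cw wN wj]]] := C_bs_mul (C_b_cst e) Cw.
apply/C_bsP; exists (M + N), (maxn k j); split.
- exact: addr_ge0.
- by move=> x; apply: cvgD; [exact: cv|exact: cw].
- by move=> x; rewrite (le_trans (ler_normD _ _))// lerD.
move=> x; have [->|/vk xk _] := eqVneq (c * v x) 0; last first.
  by rewrite (lt_le_trans xk)// ler_nat leq_maxl.
by rewrite add0r => /wj /lt_le_trans; apply; rewrite ler_nat leq_maxr.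
Qed.

Lemma C_bsB v w : C_bs v -> C_bs w -> C_bs (fun x => v x - w x).
Proof.
by move=> Cv Cw; have := C_bs_lin 1 (-1) Cv Cw; under eq_fun do rewrite mul1r mulN1r.
Qed.

Lemma C_bs_norm v : C_bs v -> C_bs (fun x => `|v x|).
Proof.
move=> /C_bsP[M [k [M0 cv vM vk]]]; apply/C_bsP; exists M, k; split=> //.
- by move=> x; apply: cvg_norm; exact: cv.
- by move=> x; rewrite normr_id.
- by move=> x; rewrite normr_eq0; exact: vk.
Qed.

Lemma C_bs_pos v : C_bs v -> C_bs (fun x => Num.max (v x) 0).
Proof.
move=> Cv; have := C_bs_lin 2^-1 2^-1 Cv (C_bs_norm Cv).
rewrite (_ : (fun x => 2^-1 * v x + _) = (fun x => Num.max (v x) 0))//.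
by apply/funext => x; rewrite max_normE addr0 subr0 mulrDr.
Qed.

Lemma C_bs_neg v : C_bs v -> C_bs (fun x => Num.max (- v x) 0).
Proof.
move=> Cv; apply: (@C_bs_pos (fun x => - v x)).
by have := C_bs_lin (-1) 0 Cv Cv; under eq_fun do rewrite mulN1r mul0r addr0.
Qed.

Lemma pos_sub_neg (a : R) : Num.max a 0 - Num.max (- a) 0 = a.
Proof.
have [a0|a0] := leP a 0; first by rewrite max_l ?oppr_ge0// sub0r opprK.
by rewrite max_r ?subr0// oppr_le0 ltW.
Qed.

Lemma max_ge0 (a : R) : 0 <= Num.max a 0.
Proof. by rewrite le_max lexx orbT. Qed.

End C_bs.

(** * Compactness in local L^2 and local L^1 along converging measures *)

Section weak_limits.
Context {R : realType} {X : completeMetricType R}.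
Variables (m_ : nat -> {measure set (borel X) -> \bar R})
  (m : {measure set (borel X) -> \bar R}).
Hypothesis m_fin : forall n, finite_on_bounded (m_ n).
Hypothesis m_fin_lim : finite_on_bounded m.
Hypothesis m_cvg : weak_measure_cvg m_ m.
Variable d : nat -> X.
Hypothesis d_dense : forall x (e : R), 0 < e -> exists i, mdist (d i) x < e.
Variable x0 : X.
Implicit Types (f g h u v w : X -> R) (x y : X) (c r e : R).
Local Notation cut := (cutoff x0).
Local Notation code := (nat * rat * nat)%type.

Definition bounded_in_loc2 (b : nat -> X -> R) := (forall n, L0 (b n)) /\
  forall k, exists2 S : R, 0 <= S & forall n, sqi (m_ n) (fun x => b n x * cut k x) /\
    nrm (m_ n) (fun x => b n x * cut k x) <= S.

Lemma bounded_in_loc2_loc2 b n : bounded_in_loc2 b -> loc2 (m_ n) x0 (b n).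
Proof. by move=> [mb H]; split=> // k; have [S _ /(_ n)[]] := H k. Qed.

Lemma C_bs_sqi (mu : {measure set (borel X) -> \bar R}) v :
  finite_on_bounded mu -> C_bs v -> sqi mu v.
Proof.
move=> fin Cv; have /(C_bsP x0)[M [k [M0 _ vM vk]]] := Cv.
exact: (sqi_bounded_support fin (C_bs_L0 Cv) vM vk).
Qed.

Lemma nrm_C_bs_cvg v : C_bs v -> nrm (m_ n) v @[n --> \oo] --> nrm m v.
Proof.
move=> Cv; under eq_fun do rewrite nrm_def; rewrite nrm_def.
have : ip (m_ n) v v @[n --> \oo] --> ip m v v.
  under eq_fun do rewrite ip_def; rewrite ip_def.
  by apply: m_cvg; apply: C_bs_mul => //; exact: C_bs_C_b.
exact: (continuous_cvg _ (@sqrt_continuous R _)).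
Qed.

Lemma nrm_C_bs_bounded v : C_bs v -> exists B : R, forall n, nrm (m_ n) v <= B.
Proof.
move=> Cv; have cv : cvgn (fun n => nrm (m_ n) v).
  by apply/cvg_ex; exists (nrm m v); exact: nrm_C_bs_cvg.
have [B [Br HB]] := cvg_seq_bounded cv; exists (B + 1) => n.
have := HB (B + 1) _ n Logic.I; rewrite ltrDl ltr01 => /(_ isT).
by apply: le_trans; exact: ler_norm.
Qed.

Lemma pairing_le (mu : {measure set (borel X) -> \bar R}) b v (k : nat) :
  sqi mu (fun x => b x * cut k x) -> sqi mu v ->
  (forall x, v x != 0 -> mdist x0 x < k%:R) ->
  `|\int[mu]_x (b x * v x)| <= nrm mu (fun x => b x * cut k x) * nrm mu v.
Proof.
move=> sb sv vk; apply: le_trans (cauchy_schwarz sb sv).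
rewrite ip_def (@eq_Rintegral _ _ _ mu _ (fun x => b x * cut k x * v x))// => x _.
by rewrite {1}(@mul_cut _ _ x0 v k x); [ring|exact: vk].
Qed.

(** The approximation of [v] by tents is chosen for [m] alone. Weak convergence of the measures,
    tested on the square of the difference, transfers its smallness to [m_ n] for all large [n], and
    Cauchy-Schwarz with the uniform bound on [b] concludes. *)
Lemma weak_approx_cvg b v : bounded_in_loc2 b -> C_bs v -> (forall x, 0 <= v x) ->
  (forall s : seq code, cvgn (fun n => \int[m_ n]_x (b n x * tentmax d s x))) ->
  cvgn (fun n => \int[m_ n]_x (b n x * v x)).
Proof.
move=> bb Cv v0 Hs; have /(C_bsP x0)[M [k [M0 cv vM vk]]] := Cv.
have ov a : 0 <= a -> open [set y | a < v y].
  by move=> _; exact: open_superlevel.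
have [s [sv scv]] := lsc_tentmax_approx d_dense v0 ov.
have Cs N : C_bs (tentmax d (s N)) by apply: Lip_bs_C_bs; exact: tentmax_Lip_bs.
have CB N : C_bs (fun x => v x - tentmax d (s N) x) by exact: C_bsB.
have sk N x : v x - tentmax d (s N) x != 0 -> mdist x0 x < k%:R.
  have [v0x|/vk//] := eqVneq (v x) 0.
  have := sv N x; rewrite v0x => t0; have -> : tentmax d (s N) x = 0.
    by apply/eqP; rewrite eq_le t0 tentmax_ge0.
  by rewrite subrr eqxx.
have [S S0 HS] := bb.2 k.
have small : nrm m (fun x => v x - tentmax d (s N) x) @[N --> \oo] --> 0.
  under eq_fun do rewrite nrm_def; rewrite -(@sqrtr0 R).
  apply: (continuous_cvg _ (@sqrt_continuous R _)).
  under eq_fun do rewrite ip_def; rewrite -(@Itg0 _ (borel X) R m).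
  apply: (@Rint_dominated _ (borel X) R m _ _ (fun x => v x * v x)).
  - move=> N; apply: (C_bs_L0 (v := fun x => (v x - tentmax d (s N) x) * (v x - tentmax d (s N) x))).
    by apply: C_bs_mul => //; exact: C_bs_C_b.
  - exact: measurable_cst.
  - apply: aeT => x; rewrite -(mulr0 0) -(subrr (v x)).
    by apply: cvgM; apply: cvgB => //; exact: cvg_cst.
  - by have sv' := C_bs_sqi m_fin_lim Cv; exact: sqi_mul.
  - apply: aeT => x N; have t0 := tentmax_ge0 d (s N) x; have tv := sv N x.
    by rewrite normrM ger0_norm ?subr_ge0// ler_pM ?subr_ge0// gerBl.
apply: cvgn_of_approx => e e0.
have e1 : 0 < e / (S + 1) by rewrite divr_gt0// ltr_wpDl.
have [N /= HN] : exists N, nrm m (fun x => v x - tentmax d (s N) x) < e / (S + 1).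
  have /cvgrPdist_lt/(_ _ e1)[N _ /(_ N (leqnn N))] := small.
  by rewrite sub0r normrN ger0_norm ?nrm_ge0//; exists N.
exists (fun n => \int[m_ n]_x (b n x * tentmax d (s N) x)); split; first exact: Hs.
have : \forall n \near \oo, nrm (m_ n) (fun x => v x - tentmax d (s N) x) < e / (S + 1).
  by apply: (cvgr_lt _ (nrm_C_bs_cvg (CB N))).
apply: filterS => n Hn; have [sb nb] := HS n; have lb := bounded_in_loc2_loc2 n bb.
have int w : C_bs w -> intg (m_ n) (fun x => b n x * w x).
  move=> Cw; have /(C_bsP x0)[M' [k' [_ _ wM wk]]] := Cw.
  exact: (loc1_mul (loc2_loc1 (m_fin n) lb) (C_bs_L0 Cw) wM wk).
rewrite -ItgB; [|exact: int..].
rewrite (@eq_Rintegral _ _ _ (m_ n) _ (fun x => b n x * (v x - tentmax d (s N) x))); last first.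
  by move=> x _; rewrite mulrBr.
apply: (le_trans (pairing_le sb (C_bs_sqi (m_fin n) (CB N)) (sk N))).
apply: (@le_trans _ _ ((S + 1) * (e / (S + 1)))).
  apply: ler_pM; rewrite ?nrm_ge0 ?(ltW Hn)//.
  by apply: (le_trans nb); rewrite lerDl.
by rewrite mulrC divfK// gt_eqF// ltr_wpDl.
Qed.

Lemma bounded_in_loc2_intg b n v : bounded_in_loc2 b -> C_bs v ->
  intg (m_ n) (fun x => b n x * v x).
Proof.
move=> bb Cv; have /(C_bsP x0)[M [k [_ _ vM vk]]] := Cv.
exact: (loc1_mul (loc2_loc1 (m_fin n) (bounded_in_loc2_loc2 n bb)) (C_bs_L0 Cv) vM vk).
Qed.

(** The limit functional is bounded only on test functions supported in a fixed ball, so Riesz is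
    applied on each [V k] and the densities [g k] are glued by shells. The bound on [V k] is in the
    norm of [m], because norms of test functions converge. *)
Theorem weak_limit_loc2 b : bounded_in_loc2 b ->
  (forall s : seq code, cvgn (fun n => \int[m_ n]_x (b n x * tentmax d s x))) ->
  exists2 B, loc2 m x0 B & forall v, C_bs v ->
    \int[m_ n]_x (b n x * v x) @[n --> \oo] --> \int[m]_x (B x * v x).
Proof.
move=> bb Hs.
have pint n v : C_bs v -> intg (m_ n) (fun x => b n x * v x) by exact: bounded_in_loc2_intg.
have cvg_b v : C_bs v -> cvgn (fun n => \int[m_ n]_x (b n x * v x)).
  move=> Cv.
  have c1 := weak_approx_cvg bb (C_bs_pos x0 Cv) (fun x => max_ge0 _) Hs.
  have c2 := weak_approx_cvg bb (C_bs_neg x0 Cv) (fun x => max_ge0 _) Hs.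
  have E n : \int[m_ n]_x (b n x * Num.max (v x) 0) -
      \int[m_ n]_x (b n x * Num.max (- v x) 0) = \int[m_ n]_x (b n x * v x).
    rewrite -ItgB; [|exact/pint/(C_bs_pos x0)|exact/pint/(C_bs_neg x0)].
    by apply: eq_Rintegral => x _; rewrite -mulrBr pos_sub_neg.
  by rewrite -(funext E); exact: is_cvgB c1 c2.
pose l v := limn (fun n => \int[m_ n]_x (b n x * v x)).
have lP v : C_bs v -> \int[m_ n]_x (b n x * v x) @[n --> \oo] --> l v by exact: cvg_b.
have llin s t v w : C_bs v -> C_bs w -> l (fun x => s * v x + t * w x) = s * l v + t * l w.
  move=> Cv Cw; apply: cvg_lim => //.
  rewrite (_ : (fun n => _) = (fun n => s * (\int[m_ n]_x (b n x * v x)) + t * (\int[m_ n]_x (b n x * w x)))).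
    by apply: cvgD; apply: cvgMr; exact: lP.
  apply/funext => n; rewrite -!ItgZ; [|exact: pint..].
  rewrite -ItgD; [|exact/intgZ/pint..].
  by apply: eq_Rintegral => x _; ring.
pose V (k : nat) := [set v : X -> R | C_bs v /\ forall x, v x != 0 -> mdist x0 x < k%:R].
have VC k v : V k v -> C_bs v by case.
have V0 k : V k (fun=> 0).
  split=> [|x]; last by rewrite eqxx.
  apply/(C_bsP x0); exists 0, 0%N; split=> // [|x|x]; rewrite ?normr0 ?eqxx//.
  by move=> x; exact: cvg_cst.
have Vlin k s t v w : V k v -> V k w -> V k (fun x => s * v x + t * w x).
  move=> [Cv vk] [Cw wk]; split=> [|x]; first exact: C_bs_lin.
  have [->|/vk//] := eqVneq (v x) 0; have [->|/wk//] := eqVneq (w x) 0.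
  by rewrite !mulr0 addr0 eqxx.
have /choice[g hg] (k : nat) : exists g, sqi m g /\ forall v, V k v -> l v = ip m g v.
  have [S S0 HS] := bb.2 k.
  have [||||v Vv|g sg Hg] := @riesz _ (borel X) R m (V k) l S.
  - by move=> v /VC; exact: C_bs_sqi.
  - exact: V0.
  - exact: Vlin.
  - by move=> s t v w /VC Cv /VC Cw; exact: llin.
  - have [Cv vk] := Vv.
    have h1 : `|\int[m_ n]_x (b n x * v x)| @[n --> \oo] --> `|l v|.
      by apply: cvg_norm; exact: lP.
    have h2 : S * nrm (m_ n) v @[n --> \oo] --> S * nrm m v by apply: cvgMr; exact: nrm_C_bs_cvg.
    apply: (ler_cvg_to h1 h2); apply: nearW => n; have [sb nb] := HS n.
    apply: (le_trans (pairing_le sb (C_bs_sqi (m_fin n) Cv) vk)).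
    by rewrite ler_wpM2r ?nrm_ge0.
  - by exists g.
have sg k : sqi m (g k) by case: (hg k).
have lg k v : V k v -> l v = \int[m]_x (g k x * v x) by case: (hg k) => _ H /H; rewrite ip_def.
have gg j k : (j <= k)%N -> \forall x \ae m, mdist x0 x < j%:R -> g j x = g k x.
  move=> jk; have l1 i : loc1 m x0 (g i).
    by split=> [|k']; [exact: sqi_meas (sg i)|apply: sqi_mul => //; exact: sqi_cut].
  have H : \forall x \ae m, mdist x0 x < j%:R -> 1 * g k x + -1 * g j x = 0.
    apply: (loc1_eq0_ball d_dense (loc1_lin 1 (-1) (l1 k) (l1 j))) => v Lv vj.
    have Cv := Lip_bs_C_bs Lv; have sv := C_bs_sqi m_fin_lim Cv.
    have Vj : V j v by [].
    have Vk : V k v by split=> // x /vj /lt_le_trans; apply; rewrite ler_nat.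
    rewrite (@eq_Rintegral _ _ _ m _ (fun x => g k x * v x - g j x * v x)); last by move=> x _; ring.
    by rewrite ItgB; [rewrite -(lg k v Vk) -(lg j v Vj) subrr|exact: sqi_mul..].
  by apply: (ae_mp H) => x + xj => /(_ xj); lra.
pose B x := g (shell x0 x) x.
have mB : L0 B by apply: glue_L0 => k; exact: (sqi_meas (sg k)).
have Bg := glue_ae gg.
exists B.
  split=> // k; apply: (@sqi_le_ae _ (borel X) R m _ (g k.+1)) => //.
    by apply: measurable_funM => //; exact: cut_L0.
  apply: (ae_mp (Bg k.+1)) => x Bx.
  have [->|/cutoff_supp xk] := eqVneq (cut k x) 0; first by rewrite mulr0 normr0.
  by rewrite /B (Bx xk) normrM ler_piMr// cut_norm.
move=> v Cv; have /(C_bsP x0)[M [k [_ _ _ vk]]] := Cv.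
rewrite (_ : \int[m]_x (B x * v x) = l v); first exact: lP.
have Vv : V k v by [].
rewrite (lg k v Vv); apply: (@eq_Rint_ae _ (borel X)).
- by apply: measurable_funM => //; exact: C_bs_L0.
- by apply: intg_meas; apply: sqi_mul => //; exact: C_bs_sqi.
- apply: (ae_mp (Bg k)) => x Bx; have [->|/vk/Bx] := eqVneq (v x) 0; first by rewrite !mulr0.
  by rewrite /B => ->.
Qed.

(** Weak convergence bounds the norms of the cutoffs under [m_ n] uniformly in [n]. *)
Lemma bounded_in_loc2_of_bound (b : nat -> X -> R) c : (forall n, L0 (b n)) ->
  (forall n x, `|b n x| <= c) -> bounded_in_loc2 b.
Proof.
move=> mb bc; have c0 : 0 <= c by exact: le_trans (bc 0%N x0).
split=> // k.
have Ck : C_bs (cut k) by apply: Lip_bs_C_bs; exact: cutoff_Lip_bs.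
have [S SP] := nrm_C_bs_bounded Ck.
exists (c * Num.max S 0); first by rewrite mulr_ge0// max_ge0.
move=> n; have sk := sqi_cut (m_fin n) x0 k.
split; first exact: sqi_mulB (mb n) (bc n) sk.
apply: (le_trans (nrm_mulB c0 (mb n) (bc n) sk)); rewrite ler_wpM2l// le_max.
by rewrite SP.
Qed.

Definition clip (M a : R) := Num.max (- M) (Num.min M a).
Definition excess (M a : R) := Num.max 0 (`|a| - M).

Lemma clip_norm (M a : R) : 0 <= M -> `|clip M a| <= M.
Proof.
move=> M0; rewrite /clip ler_norml le_max lexx/= ge_max ge_min lexx/= andbT.
by rewrite (le_trans _ M0)// oppr_le0.
Qed.

Lemma clip_id (M a : R) : `|a| <= M -> clip M a = a.
Proof.
by rewrite ler_norml => /andP[Ma aM]; rewrite /clip (min_r aM) (max_r Ma).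
Qed.

Lemma clip_contract (M a c : R) : `|clip M a - clip M c| <= `|a - c|.
Proof.
rewrite /clip ler_norml; have := ler_norm (a - c); have := ler_norm (- (a - c)).
rewrite normrN; move: (`|a - c|) => t t1 t2.
by apply/andP; rewrite /Num.max /Num.min; do ![case: ifPn]; rewrite -?leNgt => *; split; lra.
Qed.

Lemma clip_le (M a : R) : 0 <= M -> `|clip M a| <= `|a|.
Proof.
move=> M0; have := clip_contract M a 0.
by rewrite [clip M 0]clip_id ?normr0// !subr0.
Qed.

Lemma excess_ge0 (M a : R) : 0 <= excess M a. Proof. by rewrite /excess le_max lexx. Qed.

Lemma excess_le (M a : R) : 0 <= M -> excess M a <= `|a|.
Proof. by move=> M0; rewrite /excess ge_max normr_ge0/= lerBlDr lerDl. Qed.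

Lemma excess_anti (M N a : R) : M <= N -> excess N a <= excess M a.
Proof. by move=> MN; rewrite /excess ge_max le_max lexx/= le_max lerB// orbT. Qed.

Lemma clip_dist (M a : R) : 0 <= M -> `|a - clip M a| <= excess M a.
Proof.
move=> M0; rewrite /clip /excess.
case: (leP M a) => Ma.
  rewrite max_r; last by rewrite (le_trans _ M0)// oppr_le0.
  rewrite ger0_norm ?subr_ge0// [`|a|]ger0_norm ?(le_trans M0)//.
  by rewrite le_max lexx orbT.
case: (leP (- M) a) => aM.
  by rewrite subrr normr0 le_max lexx.
have a0 : a <= 0 by rewrite ltW// (lt_le_trans aM)// oppr_le0.
rewrite opprK ler0_norm ?(ler0_norm a0); last by rewrite -lerBrDr sub0r ltW.
by rewrite le_max opprD lexx orbT.
Qed.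

Lemma clip_clip (M N a : R) : 0 <= M -> M <= N -> clip M (clip N a) = clip M a.
Proof.
move=> M0 MN; rewrite /clip /Num.max /Num.min; do ![case: ifPn]; rewrite -?leNgt => *; lra.
Qed.

Lemma clip_dist2 (M N a : R) : 0 <= M -> M <= N -> `|clip N a - clip M a| <= excess M a.
Proof.
move=> M0 MN; rewrite -(clip_clip a M0 MN); apply: (le_trans (clip_dist (clip N a) M0)).
rewrite /excess ge_max le_max lexx/= le_max; apply/orP; right.
by rewrite lerD2r clip_le// (le_trans M0).
Qed.

Lemma clip_L0 (M : R) g : L0 g -> L0 (fun x => clip M (g x)).
Proof.
by move=> mg; apply: measurable_maxr; [exact: measurable_cst|apply: measurable_minr].
Qed.

Lemma excess_L0 (M : R) g : L0 g -> L0 (fun x => excess M (g x)).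
Proof.
move=> mg; apply: measurable_maxr; first exact: measurable_cst.
by apply: measurable_funB => //; exact: measurableT_comp.
Qed.

Lemma cut_mono (j k : nat) x : (j <= k)%N -> cut j x <= cut k x.
Proof.
move=> jk; have [->|/cutoff_supp xj] := eqVneq (cut j x) 0; first exact: cutoff_ge0.
move: jk; rewrite leq_eqVlt => /predU1P[->//|jk].
rewrite [leRHS]cutoff_eq1 ?cutoff_le1// (le_trans (ltW xj))// ler_nat//.
Qed.

(* The truncations are bounded, hence have weak limits, and the uniformly small
   tails make these limits an [L^1_loc] Cauchy sequence in the truncation level. *)
Lemma weak_limit_loc1 (g : nat -> X -> R) : (forall n, loc1 (m_ n) x0 (g n)) ->
  (forall k e, 0 < e -> exists M : nat, forall n,
     \int[m_ n]_x (excess M%:R (g n x) * cut k x) <= e) ->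
  (forall (M : nat) (s : seq code),
     cvgn (fun n => \int[m_ n]_x (clip M%:R (g n x) * tentmax d s x))) ->
  exists2 G, loc1 m x0 G & forall v, C_bs v ->
    \int[m_ n]_x (g n x * v x) @[n --> \oo] --> \int[m]_x (G x * v x).
Proof.
move=> lg tail Hs; have mg n : L0 (g n) by case: (lg n).
have bclip (M : nat) : bounded_in_loc2 (fun n x => clip M%:R (g n x)).
  apply: (@bounded_in_loc2_of_bound _ M%:R) => [n|n x]; first exact: clip_L0.
  exact: clip_norm.
have /choice[G hG] (M : nat) : exists G, loc2 m x0 G /\ forall v, C_bs v ->
    \int[m_ n]_x (clip M%:R (g n x) * v x) @[n --> \oo] --> \int[m]_x (G x * v x).
  have [G lG HG] := weak_limit_loc2 (bclip M) (Hs M).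
  by exists G.
have lG M : loc2 m x0 (G M) by case: (hG M).
have GC M v : C_bs v -> \int[m_ n]_x (clip M%:R (g n x) * v x) @[n --> \oo] -->
    \int[m]_x (G M x * v x) by case: (hG M) => _; exact.
have lex M n : loc1 (m_ n) x0 (fun x => excess M%:R (g n x)).
  split=> [|k]; first exact: excess_L0.
  apply: intg_le (intg_norm ((lg n).2 k)).
    by apply: measurable_funM; [exact: excess_L0|exact: cut_L0].
  move=> x; rewrite !normrM ler_wpM2r// ger0_norm ?excess_ge0//.
  exact: excess_le.
have GC1 M v : C_bs v -> intg m (fun x => G M x * v x).
  move=> Cv; have /(C_bsP x0)[c [k [_ _ vc vk]]] := Cv.
  exact: (loc1_mul (loc2_loc1 m_fin_lim (lG M)) (C_bs_L0 Cv) vc vk).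
have cC n M v : C_bs v -> intg (m_ n) (fun x => clip M%:R (g n x) * v x).
  by move=> Cv; exact: (bounded_in_loc2_intg n (bclip M) Cv).
have Ccut k : C_bs (cut k) by apply: Lip_bs_C_bs; exact: cutoff_Lip_bs.
(* An L^1 norm is not weakly continuous, but it is controlled by Lipschitz weights of modulus at
   most 1; for each such weight the estimate holds before the limit, through the tails of [g n], and
   survives it. *)
have key k (e : R) (M M' : nat) : (forall n, \int[m_ n]_x (excess M%:R (g n x) * cut k x) <= e) ->
    (M <= M')%N -> \int[m]_x (`|G M' x - G M x| * cut k x) <= e.
  move=> He MM'.
  rewrite (@eq_Rintegral _ _ _ m _ (fun x => `|G M' x * cut k x - G M x * cut k x|)); last first.
    by move=> x _; rewrite -mulrBl normrM (ger0_norm (cutoff_ge0 _ _ _)).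
  apply: (L1_norm_le_of_weights d_dense); first by apply: intgB; exact: GC1.
  move=> w Lw w1; have Cw : C_bs (fun x => w x * cut k x).
    by apply: C_bs_mul => //; exact: Lip_b_C_b.
  rewrite (@eq_Rintegral _ _ _ m _ (fun x => G M' x * (w x * cut k x) - G M x * (w x * cut k x))); last first.
    by move=> x _; ring.
  rewrite ItgB; [|exact: GC1..].
  have cv : \int[m_ n]_x (clip M'%:R (g n x) * (w x * cut k x)) -
      \int[m_ n]_x (clip M%:R (g n x) * (w x * cut k x)) @[n --> \oo] -->
      \int[m]_x (G M' x * (w x * cut k x)) - \int[m]_x (G M x * (w x * cut k x)).
    by apply: cvgB; exact: GC.
  apply: (cvgr_to_le cv); apply: nearW => n; rewrite -ItgB; [|exact: cC..].
  apply: le_trans (He n); apply: le_Rint; [by apply: intgB; exact: cC|exact: (lex M n).2|].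
  move=> x; rewrite -mulrBl mulrA (le_trans (ler_norm _))// !normrM.
  rewrite (ger0_norm (cutoff_ge0 _ _ _)) ler_wpM2r ?cutoff_ge0//.
  apply: (@le_trans _ _ (excess M%:R (g n x) * 1)); last by rewrite mulr1.
  by apply: ler_pM => //; apply: clip_dist2 => //; rewrite ler_nat.
have /choice[N0 HN0] (j : nat) : exists M : nat, forall n,
    \int[m_ n]_x (excess M%:R (g n x) * cut j x) <= 2^-1 ^+ j.
  by apply: tail; exact: exp_half_gt0.
pose N := fix N j := if j is i.+1 then maxn (N i) (N0 j) else N0 0%N.
have NN0 j : (N0 j <= N j)%N by case: j => //= j; rewrite leq_maxr.
have Nmono i j : (i <= j)%N -> (N i <= N j)%N.
  elim: j => [|j IH]; first by rewrite leqn0 => /eqP ->.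
  rewrite leq_eqVlt => /predU1P[->//|]; rewrite ltnS => /IH /leq_trans; apply.
  by rewrite /= leq_maxl.
(* One level [N j] serves all radii [k <= j], because [cut k <= cut j] and the excess decreases with
   the level. *)
have HN j k n : (k <= j)%N -> \int[m_ n]_x (excess (N j)%:R (g n x) * cut k x) <= 2^-1 ^+ j.
  move=> kj; apply: le_trans (HN0 j n); apply: le_Rint; [exact: (lex _ n).2..|].
  move=> x; apply: ler_pM; rewrite ?excess_ge0 ?cutoff_ge0//; last exact: cut_mono.
  by apply: excess_anti; rewrite ler_nat.
pose u j := G (N j).
have mu j : L0 (u j) by case: (lG (N j)).
have ud i j k : (k <= j)%N -> (j <= i)%N -> \int[m]_x (`|u i x - u j x| * cut k x) <= 2^-1 ^+ j.
  by move=> kj ji; apply: key (Nmono _ _ ji) => n; exact: HN.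
have iud i j k : intg m (fun x => `|u i x - u j x| * cut k x).
  have := intg_norm (intgB (GC1 (N i) _ (Ccut k)) (GC1 (N j) _ (Ccut k))).
  by under eq_fun do rewrite -mulrBl normrM (ger0_norm (cutoff_ge0 _ _ _)).
have aec : \forall x \ae m, cvgn (fun j => u j x).
  have := @ae_sum_bounded _ (borel X) R m (fun j x => `|u j.+1 x - u j x| * cut j x).
  move=> /(_ _ _ _)/ae_mp; apply.
  - by move=> j; exact: (intg_meas (iud _ _ _)).
  - by move=> j x; rewrite mulr_ge0 ?cutoff_ge0.
  - by move=> j; rewrite (intg_fin (iud _ _ _)) lee_fin ud.
  move=> x [C HC]; pose J := shell x0 x.
  (* From index [J] on the cutoff is 1 at [x], so beyond [J] the weighted sum controls the
     increments themselves. *)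
  have cJ j : cut (j + J) x = 1.
    rewrite cutoff_eq1// (le_trans (ltW (shellP x0 x)))// ler_nat.
    exact: leq_addl.
  have : cvgn (fun j => u (j + J)%N x).
    apply: (@cvgn_of_abs_sum_bounded _ _ C) => n.
    apply: le_trans (HC (n + J)%N).
    apply: (@le_trans _ _ (\sum_(J <= j < n + J) `|u j.+1 x - u j x| * cut j x)); last first.
      rewrite [leRHS](@big_cat_nat _ _ _ J)//= ?leq_addl// lerDr.
      by apply: sumr_ge0 => j _; rewrite mulr_ge0 ?cutoff_ge0.
    have -> : \sum_(J <= j < n + J) `|u j.+1 x - u j x| * cut j x =
        \sum_(0 <= j < n) `|u (j + J).+1 x - u (j + J)%N x| * cut (j + J) x.
      by rewrite -{1}[J]add0n big_addn addnK.
    apply: ler_sum => j _.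
    by rewrite cJ mulr1 addSn.
  by move=> /cvg_ex[l hl]; apply/cvg_ex; exists l; rewrite -(cvg_shiftn J (fun j => u j x) (nbhs l)).
have [L mL uL] := ae_cvg_limit mu aec.
have Lu j k : (k <= j)%N -> intg m (fun x => `|L x - u j x| * cut k x) /\
    \int[m]_x (`|L x - u j x| * cut k x) <= 2^-1 ^+ j.
  move=> kj; apply: (@Rint_fatou _ (borel X) R m (fun i x => `|u i x - u j x| * cut k x)).
  - by move=> i; exact: iud.
  - by move=> i x; rewrite mulr_ge0 ?cutoff_ge0.
  - by exists j => // i /= ji; exact: ud.
  - apply: measurable_funM; last exact: cut_L0.
    have mB : L0 (fun x => L x - u j x) by apply: measurable_funB; [exact: mL|exact: mu].
    exact: measurableT_comp.
  - apply: (ae_mp uL) => x ux; apply: cvgMl; apply: cvg_norm; apply: cvgB => //.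
    exact: cvg_cst.
  - by move=> x; rewrite mulr_ge0 ?cutoff_ge0.
have lL : loc1 m x0 L.
  split=> // k; have [i1 _] := Lu k k (leqnn k).
  apply: intg_le (intgD i1 (intg_norm (GC1 (N k) _ (Ccut k)))).
    by apply: measurable_funM => //; exact: cut_L0.
  move=> x; rewrite !normrM (ger0_norm (cutoff_ge0 _ _ _)) -mulrDl.
  rewrite ler_wpM2r ?cutoff_ge0// -[X in `|X| <= _](subrK (u k x)).
  exact: ler_normD.
exists L => // v Cv; have /(C_bsP x0)[c [k [c0 _ vc vk]]] := Cv.
have vcut x : `|v x| <= c * cut k x.
  have [->|/vk xk] := eqVneq (v x) 0; first by rewrite normr0 mulr_ge0 ?cutoff_ge0.
  by rewrite cutoff_eq1 ?mulr1// ltW.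
have est (mu' : {measure set (borel X) -> \bar R}) (f h D : X -> R) (e : R) :
    intg mu' (fun x => f x * v x) -> intg mu' (fun x => h x * v x) ->
    intg mu' (fun x => D x * cut k x) -> (forall x, `|f x - h x| <= D x) ->
    \int[mu']_x (D x * cut k x) <= e ->
    `|\int[mu']_x (f x * v x) - \int[mu']_x (h x * v x)| <= c * e.
  move=> i1 i2 i3 fh De; rewrite -ItgB//.
  apply: (le_trans (le_norm_Rint (intgB i1 i2))).
  apply: (@le_trans _ _ (c * \int[mu']_x (D x * cut k x))); last by rewrite ler_wpM2l.
  rewrite -ItgZ//; apply: le_Rint; [exact/intg_norm/intgB|exact: intgZ|].
  by move=> x; rewrite -mulrBl normrM mulrCA; apply: ler_pM.
have lLv : intg m (fun x => L x * v x) by exact: (loc1_mul lL (C_bs_L0 Cv) vc vk).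
have lgv n : intg (m_ n) (fun x => g n x * v x) by exact: (loc1_mul (lg n) (C_bs_L0 Cv) vc vk).
apply/cvgrPdist_le => e e0.
have e1 : 0 < e / 3 / (c + 1) by rewrite !divr_gt0// ltr_wpDl.
have [j0 hj0] := exp_half_small e1; pose j := maxn j0 k.
have hj : c * 2^-1 ^+ j <= e / 3.
  apply: (@le_trans _ _ ((c + 1) * (e / 3 / (c + 1)))); last first.
    by rewrite mulrC divfK// gt_eqF// ltr_wpDl.
  apply: ler_pM => //; rewrite ?exprn_ge0 ?lerDl//; apply: le_trans hj0.
  by apply: exp_half_le; exact: leq_maxl.
have kj : (k <= j)%N by exact: leq_maxr.
have [iLu dLu] := Lu j k kj.
have h1 := est m L (u j) (fun x => `|L x - u j x|) _ lLv (GC1 (N j) _ Cv) iLu (fun x => lexx _) dLu.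
have /cvgrPdist_le/(_ _ (divr_gt0 e0 (ltr0Sn R 2))) h2 := GC (N j) _ Cv.
apply: filterS h2 => n h2.
have h3 := est (m_ n) (g n) (fun x => clip (N j)%:R (g n x)) (fun x => excess (N j)%:R (g n x)) _
  (lgv n) (cC n (N j) _ Cv) ((lex (N j) n).2 k) (fun x => clip_dist (g n x) (ler0n _ _)) (HN j k n kj).
set A := \int[m]_x (L x * v x) in h1 *; set B := \int[m]_x (u j x * v x) in h1 h2 *.
set C := \int[m_ n]_x (g n x * v x) in h3 *; set D := \int[m_ n]_x (_ * v x) in h2 h3.
(* Truncation at level [N j] costs at most [e / 3] under [m] and, uniformly in [n], under [m_ n];
   the middle term is the convergence at this fixed level. *)
rewrite (_ : A - C = (A - B) + (B - D) - (C - D)); last by ring.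
rewrite (le_trans (ler_normB _ _))//.
have := ler_normD (A - B) (B - D); lra.
Qed.
End weak_limits.

(** * Limits of derivations *)

Section least_slope_bound.
Context {R : realType} {X : completeMetricType R}.
Variable m : {measure set (borel X) -> \bar R}.
Hypothesis m_fin : finite_on_bounded m.
Variable d : nat -> X.
Hypothesis d_dense : forall x (e : R), 0 < e -> exists i, mdist (d i) x < e.
Variable x0 : X.
Implicit Types (f g u v w F P : X -> R) (t : nat -> X -> R) (x y : X) (c r e : R).
Local Notation cut := (cutoff x0).
Local Notation intg := (@intg _ (borel X) R m).
Local Notation sqi := (@sqi _ (borel X) R m).
Local Notation L2lim := (@L2lim _ (borel X) R m).

Lemma sqi_clip (N : nat) P : intg P -> sqi (fun x => clip N%:R (P x)).
Proof.
move=> iP; have mC : L0 (fun x => clip N%:R (P x)) by apply: clip_L0; exact: intg_meas iP.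
split=> //; apply: (@intg_le _ (borel X) R m _ (fun x => N%:R * `|P x|)).
- exact: measurable_funX.
- move=> x; rewrite normrX expr2; apply: ler_pM => //; first exact: clip_norm.
  exact: clip_le.
- exact/intgZ/intg_norm.
Qed.

(* The integrable weight is split into a truncation, which is square integrable,
   and a remainder which is small in [L^1]. *)
Lemma Rint_mul_cvg_bounded P t f M : intg P -> (forall n, sqi (t n)) -> sqi f ->
  (forall n x, `|t n x| <= M) -> (forall x, `|f x| <= M) -> L2lim t f ->
  \int[m]_x (P x * t n x) @[n --> \oo] --> \int[m]_x (P x * f x).
Proof.
move=> iP st sf tM fM tf; have M0 : 0 <= M by exact: le_trans (fM x0).
have mP := intg_meas iP.
have iex (N : nat) : intg (fun x => excess N%:R (P x)).
  apply: intg_le (intg_norm iP); first exact: excess_L0.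
  by move=> x; rewrite ger0_norm ?excess_ge0// excess_le.
have ex0 : \int[m]_x excess N%:R (P x) @[N --> \oo] --> 0.
  rewrite -(@Itg0 _ (borel X) R m).
  apply: (@Rint_dominated _ (borel X) R m _ _ (fun x => `|P x|)).
  - by move=> N; exact: intg_meas (iex N).
  - exact: measurable_cst.
  - apply: aeT => x; apply/cvgrPdist_le => e e0; near=> N.
    rewrite sub0r normrN /excess max_l; first by rewrite normr0 ltW.
    rewrite subr_le0.
    by near: N; exact: nbhs_infty_ger.
  - exact: intg_norm.
  - by apply: aeT => x N; rewrite ger0_norm ?excess_ge0// excess_le.
have iPt n : intg (fun x => P x * t n x) by apply: intgM_bounded iP (sqi_meas (st n)) (tM n).
have iPf : intg (fun x => P x * f x) by exact: intgM_bounded iP (sqi_meas sf) fM.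
apply/cvgrPdist_le => e e0.
have e1 : 0 < e / 2 / (2 * M + 1) by rewrite !divr_gt0// ltr_wpDl// mulr_ge0.
have [N HN] : exists N : nat, \int[m]_x excess N%:R (P x) <= e / 2 / (2 * M + 1).
  have /cvgrPdist_le/(_ _ e1)[N _ /(_ N (leqnn N))] := ex0.
  by rewrite sub0r normrN => HN; exists N; exact: le_trans (ler_norm _) HN.
have sC := sqi_clip N iP.
have /cvgrPdist_le/(_ _ (divr_gt0 e0 (ltr0Sn R 1))) := ip_cvgl st sf sC tf.
apply: filterS => n Hn.
have iCt : intg (fun x => clip N%:R (P x) * t n x) by exact: sqi_mul sC (st n).
have iCf : intg (fun x => clip N%:R (P x) * f x) by exact: sqi_mul sC sf.
have E : \int[m]_x (P x * f x) - \int[m]_x (P x * t n x) =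
    (ip m f (fun x => clip N%:R (P x)) - ip m (t n) (fun x => clip N%:R (P x))) +
    \int[m]_x ((P x - clip N%:R (P x)) * (f x - t n x)).
  rewrite (ipC m f) (ipC m (t n)) !ip_def.
  rewrite (@eq_Rintegral _ _ _ m _ (fun x => (P x * f x - P x * t n x) -
    (clip N%:R (P x) * f x - clip N%:R (P x) * t n x)) (fun x => (P x - _) * _)); last first.
    by move=> x _; ring.
  by rewrite (ItgB (intgB iPf (iPt n)) (intgB iCf iCt)) (ItgB iPf (iPt n)) (ItgB iCf iCt); ring.
rewrite E (le_trans (ler_normD _ _))// (splitr e); apply: lerD => //.
have iR : intg (fun x => (P x - clip N%:R (P x)) * (f x - t n x)).
  have := intgB (intgB iPf (iPt n)) (intgB iCf iCt).
  rewrite (_ : (fun x => _ - _ - _) = (fun x => (P x - clip N%:R (P x)) * (f x - t n x)))//.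
  by apply/funext => x; ring.
apply: (le_trans (le_norm_Rint iR)).
apply: (@le_trans _ _ (\int[m]_x (2 * M * excess N%:R (P x)))).
  apply: le_Rint; [exact: intg_norm|exact: intgZ|].
  move=> x; rewrite normrM mulrC; apply: ler_pM => //; last exact: clip_dist.
  by have := ler_normB (f x) (t n x); have := fM x; have := tM n x; lra.
rewrite ItgZ//; apply: (@le_trans _ _ ((2 * M + 1) * (e / 2 / (2 * M + 1)))); last first.
  by rewrite mulrC divfK// gt_eqF// ltr_wpDl// mulr_ge0.
apply: ler_pM => //; rewrite ?mulr_ge0 ?lerDl//.
by apply: Rintegral_ge0 => x _; exact: excess_ge0.
Unshelve. all: by end_near. Qed.

Variables (b : (X -> R) -> X -> R) (h G : X -> R).
Hypothesis b_lin : Lip_b_linear m b.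
Hypothesis h_ge0 : \forall x \ae m, 0 <= h x.
Hypothesis b_lip : forall f, Lip_b f -> \forall x \ae m, `|b f x| <= h x * lip_a f x.
Hypothesis h_loc2 : loc2 m x0 h.
Hypothesis b_div : is_divergence m b G.

(* Through the divergence, [b] passes to the limit along a sequence realizing the
   minimal relaxed slope. *)
Lemma der_le_min_relaxed_slope f : Lip_bs f ->
  \forall x \ae m, `|b f x| <= h x * min_relaxed_slope m f x.
Proof.
move=> Lf; have [Lf' _] := Lf; have af := Lip_bs_adm m_fin Lf; have [_ sf _] := af.
have [S [[sS [u [au uf uS]] _] _ mrsS]] := min_relaxed_slopeP af.
have [_ [M [_ M0 _ fM]]] := (Lip_bP f).1 Lf'.
(* In the integration by parts [G] is only locally integrable, so L^2 convergence of the factor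
   paired with it must be supplemented by a uniform bound. Clipping at a bound of [f] provides it,
   increases no slope and brings the sequence no farther from [f]. *)
pose t n x := clip M (u n x).
have Lu n : Lip_b (u n) by case: (au n).
have Lt n : Lip_b (t n).
  by apply: Lip_b_max; [exact: Lip_b_cst|apply: Lip_b_min => //; exact: Lip_b_cst].
have tM n x : `|t n x| <= M by exact: clip_norm.
have tu n x : lip_a (t n) x <= lip_a (u n) x.
  by apply: lip_a_comp; [exact: Lip_bL|exact: Lip_bL|move=> y z; exact: clip_contract].
have td n x : `|t n x - f x| <= `|u n x - f x|.
  by rewrite -{1}(clip_id (fM x)); exact: clip_contract.
have st n : sqi (t n).
  have [_ su _] := au n; apply: sqi_le su; first exact: Lip_b_L0.
  by move=> x; exact: clip_le.
have tf : L2lim t f.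
  apply: (L2lim_le_bound (c := fun n => nrm m (fun x => u n x - f x))) uf => n.
  apply: le_nrm; [exact: sqiB|by apply: sqiB => //; case: (au n)|].
  by apply: aeT => x; exact: td.
have cvgb v : Lip_bs v -> \int[m]_x (b (t n) x * v x) @[n --> \oo] --> \int[m]_x (b f x * v x).
  move=> Lv; have [Lv' /(bounded_supportP x0)[k vk]] := Lv.
  have [_ [c [_ _ _ vc]]] := (Lip_bP v).1 Lv'.
  have parts := der_by_parts m_fin d_dense b_lin h_ge0 b_lip h_loc2 b_div _ Lv.
  rewrite (parts _ Lf').
  rewrite (_ : (fun n => _) = (fun n => - (\int[m]_x (b v x * t n x)) -
    \int[m]_x (G x * (t n x * v x)))); last by apply/funext => n; rewrite (parts _ (Lt n)).
  have iP : intg (fun x => G x * v x).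
    by apply: loc1_Lip_bs Lv; apply/(loc1P m x0); case: b_div.
  apply: cvgB; last first.
    rewrite (@eq_Rintegral _ _ _ m _ (fun x => G x * v x * f x)); last by move=> x _; ring.
    rewrite (_ : (fun n => _) = (fun n => \int[m]_x (G x * v x * t n x))); last first.
      by apply/funext => n; apply: eq_Rintegral => x _; ring.
    exact: (Rint_mul_cvg_bounded iP st sf tM fM tf).
  apply: cvgN; have sbv := (der_loc2 b_lin h_ge0 b_lip h_loc2 Lv').2 k.+1.
  have E w : Lip_b w -> \int[m]_x (b v x * w x) = ip m w (fun x => b v x * cut k.+1 x).
    move=> Lw; rewrite ip_def; apply: (@eq_Rint_ae _ (borel X)).
    - by apply: measurable_funM; [exact: (der_L0 b_lin)|exact: Lip_b_L0].
    - by apply: measurable_funM; [exact: Lip_b_L0|exact: sqi_meas sbv].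
    - by apply: (ae_mp (der_mul_cut b_lip Lv' vk)) => x bx; rewrite {1}bx; ring.
  rewrite (E _ Lf') (_ : (fun n => _) = (fun n => ip m (t n) (fun x => b v x * cut k.+1 x))).
    exact: ip_cvgl.
  by apply/funext => n; exact: E.
have lb w : Lip_b w -> loc1 m x0 (b w).
  by move=> Lw; apply: loc2_loc1 => //; exact: (der_loc2 b_lin h_ge0 b_lip h_loc2).
have lhS : loc1 m x0 (fun x => h x * S x).
  split=> [|k]; first by apply: measurable_funM; [case: h_loc2|exact: sqi_meas sS].
  have := sqi_mul (h_loc2.2 k) sS.
  by rewrite (_ : (fun x => _) = (fun x => h x * S x * cut k x))//; apply/funext => x; ring.
(* The values [b (t n)] converge only weakly, so the absolute value is split into two signs and each
   inequality is passed to the limit against [v >= 0]. On the other side [lip_a (u n)] converges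
   strongly to [S] and is paired with the square integrable [h * v]. *)
have key (s : R) : s = 1 \/ s = -1 -> \forall x \ae m, 0 <= 1 * (h x * S x) + - s * b f x.
  move=> s1; apply: (loc1_ge0 d_dense (loc1_lin 1 (- s) lhS (lb _ Lf'))) => v Lv v0.
  have [Lv' /(bounded_supportP x0)[k vk]] := Lv.
  have [_ [c [_ _ _ vc]]] := (Lip_bP v).1 Lv'.
  have shv : sqi (fun x => h x * v x) by exact: loc2_mul (Lip_b_L0 Lv') vc vk.
  rewrite (@eq_Rintegral _ _ _ m _ (fun x => h x * S x * v x + - s * (b f x * v x))); last first.
    by move=> x _; ring.
  have i1 := loc1_Lip_bs lhS Lv; have i2 w (Lw : Lip_b w) := loc1_Lip_bs (lb _ Lw) Lv.
  rewrite (ItgD i1 (intgZ (- s) (i2 _ Lf'))) (ItgZ (- s) (i2 _ Lf')).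
  have cv : ip m (lip_a (u n)) (fun x => h x * v x) + - s * \int[m]_x (b (t n) x * v x)
      @[n --> \oo] --> \int[m]_x (h x * S x * v x) + - s * \int[m]_x (b f x * v x).
    apply: cvgD; last by apply: cvgMr; exact: cvgb.
    rewrite (_ : \int[m]_x (h x * S x * v x) = ip m S (fun x => h x * v x)).
      by apply: ip_cvgl => // n; case: (au n).
    by rewrite ip_def; apply: eq_Rintegral => x _; ring.
  apply: (cvgr_to_ge cv); apply: nearW => n.
  have sl : sqi (lip_a (u n)) by case: (au n).
  have i3 := sqi_mul sl shv.
  rewrite ip_def -(ItgZ (- s) (i2 _ (Lt n))) -(ItgD i3 (intgZ (- s) (i2 _ (Lt n)))).
  rewrite -(@Itg0 _ (borel X) R m); apply: le_Rint_ae; first exact: intg0.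
    by apply: (intgD i3 (intgZ (- s) (i2 _ (Lt n)))).
  apply: (ae_mp2 (b_lip (Lt n)) h_ge0) => x bx hx.
  rewrite (_ : _ + _ = (h x * lip_a (u n) x - s * b (t n) x) * v x); last by ring.
  rewrite mulr_ge0// subr_ge0; apply: (@le_trans _ _ `|b (t n) x|).
    by case: s1 => ->; rewrite ?mul1r ?mulN1r ?ler_norm// -normrN ler_norm.
  by rewrite (le_trans bx)// ler_wpM2l.
apply: (ae_mp3 (key _ (or_introl erefl)) (key _ (or_intror erefl)) mrsS) => x H1 H2 ->.
by rewrite ler_norml; apply/andP; split; lra.
Qed.

(** On the ball of radius [k] the difference of [f] and [localize f k] vanishes, and with it [lip_a]
    of the difference; so [b] takes the same value on both functions there, and the bound for
    bounded support carries over. *)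
Lemma der_bound_slope : der_bound m b h.
Proof.
split=> //; first by case: h_loc2.
move=> f Lf; apply: (ae_shells (x0 := x0)) => k.
have Lk := localize_Lip_bs x0 k Lf; have [Lk' _] := Lk.
have Ld : Lip_b (fun y => -1 * localize x0 f k y + f y) by apply: Lip_bD => //; exact: Lip_bZ.
have bd := ae_mp2 (b_lip Ld) (b_lin.2 (-1) _ f Lk' Lf) (fun x p q => conj p q).
apply: (ae_mp3 bd (der_le_min_relaxed_slope Lk) (slope_localize m_fin d_dense x0 k Lf)).
move=> x [+ lin] bx sx xk; have l0 : lip_a (fun y => -1 * localize x0 f k y + f y) x <= 0.
  have r0 : 0 < k%:R - mdist x0 x by rewrite subr_gt0.
  apply: (lip_a_le (Lip_bL Ld) r0) => // y z /ballP xy /ballP xz.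
  have yk : mdist x0 y <= k%:R by have := metric_tri x x0 y; lra.
  have zk : mdist x0 z <= k%:R by have := metric_tri x x0 z; lra.
  by rewrite !localize_eq// !mulN1r !addNr subrr normr0 mul0r.
rewrite (_ : lip_a _ x = 0); last by apply/eqP; rewrite eq_le l0 lip_a_ge0//; exact: Lip_bL.
rewrite mulr0 normr_le0 lin => /eqP b0; rewrite sx// (_ : b f x = b (localize x0 f k) x)//.
by move: b0; lra.
Qed.

End least_slope_bound.

(** * Chosen representatives of the norm and the divergence *)

Section canonical_representatives.
Context {R : realType} {X : completeMetricType R}.
Variable m : {measure set (borel X) -> \bar R}.
Hypothesis m_fin : finite_on_bounded m.
Variable x0 : X.
Variable b : (X -> R) -> X -> R.

(** The chosen norm is minimal, so it lies below the square integrable witness [h] and inherits its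
    integrability. *)
Lemma der_normP : Der_loc m 2 b -> is_der_norm m b (der_norm m b) /\ loc2 m x0 (der_norm m b).
Proof.
move=> [_ [h [hb /(loc2P m x0) lh]]].
have nb : is_der_norm m b (der_norm m b).
  by rewrite /der_norm; case: xgetP => [g -> //|ng]; case: (ng h).
split=> //; have [[mn n0 _] min] := nb; apply: (loc2_le_ae lh mn).
by apply: (ae_mp2 n0 (min _ hb.1)) => x n0x nx; rewrite !ger0_norm// (le_trans n0x).
Qed.

Lemma divergenceP : Div1_loc m b -> is_divergence m b (divergence m b).
Proof.
move=> [_ [g gb]]; rewrite /divergence; case: xgetP => [g' -> //|ng].
by case: (ng g).
Qed.

Lemma Der_loc_Div1_loc h G : Lip_b_linear m b -> der_bound m b h -> loc2 m x0 h ->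
  is_divergence m b G -> Der_loc m 2 b /\ Div1_loc m b.
Proof.
move=> bl bh lh bG; have [g gn lg] := der_norm_exists bh lh.
have db : derivation m b by split=> //; exists h.
split; first by split=> //; exists g; split=> //; exact/(loc2P m x0).
split; last by exists G.
by split=> //; exists g; split=> //; apply/(loc1P m x0); exact: loc2_loc1.
Qed.

End canonical_representatives.

(** A small ball about a point [p] near [x] lies in a ball about [x]; this allows centres from the
    dense sequence. *)
Lemma lip_const_near (R : realType) (X : completeMetricType R) (f : X -> R) (x : X) (e : R) :
  Lip f -> 0 < e -> exists2 r : R, 0 < r & forall p s, s <= r -> mdist p x < s ->
    lip_const f (ball p s) <= lip_a f x + e.
Proof.
move=> Lf e0; have [r r0 fr] := lip_aP x Lf e0.
exists (r / 2); first by rewrite divr_gt0.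
move=> p s sr px; apply: lip_const_le; first by rewrite addr_ge0 ?lip_a_ge0// ltW.
apply: lip_onS fr => y /ballP py; apply/ballP.
rewrite (le_lt_trans (metric_tri p x y))// (splitr r) ltrD//; last exact: lt_le_trans py sr.
by rewrite metric_sym; exact: lt_le_trans px sr.
Qed.

(** * The limit derivation and its divergence *)

Section limit_derivation.
Context {R : realType} {X : completeMetricType R}.
Variables (m_ : nat -> {measure set (borel X) -> \bar R})
  (m : {measure set (borel X) -> \bar R}).
Hypothesis m_fin : forall n, finite_on_bounded (m_ n).
Hypothesis m_fin_lim : finite_on_bounded m.
Hypothesis m_cvg : weak_measure_cvg m_ m.
Variable d : nat -> X.
Hypothesis d_dense : forall x (e : R), 0 < e -> exists i, mdist (d i) x < e.
Variable x0 : X.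
Variables (b_ : nat -> (X -> R) -> X -> R) (h_ g_ : nat -> X -> R) (h G : X -> R).
Hypothesis b_lin : forall n, Lip_b_linear (m_ n) (b_ n).
Hypothesis h_ge0 : forall n, \forall x \ae m_ n, 0 <= h_ n x.
Hypothesis b_lip : forall n f, Lip_b f ->
  \forall x \ae m_ n, `|b_ n f x| <= h_ n x * lip_a f x.
Hypothesis h_bound : bounded_in_loc2 m_ x0 h_.
Hypothesis g_div : forall n, is_divergence (m_ n) (b_ n) (g_ n).
Hypothesis h_loc2 : loc2 m x0 h.
Hypothesis h_cvg : forall v, C_bs v ->
  \int[m_ n]_x (h_ n x * v x) @[n --> \oo] --> \int[m]_x (h x * v x).
Hypothesis G_loc1 : loc1 m x0 G.
Hypothesis G_cvg : forall v, C_bs v ->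
  \int[m_ n]_x (g_ n x * v x) @[n --> \oo] --> \int[m]_x (G x * v x).
Hypothesis tent_cvg : forall s t : seq (nat * rat * nat),
  cvgn (fun n => \int[m_ n]_x (b_ n (tentmax d s) x * tentmax d t x)).
Implicit Types (f u v w : X -> R) (x y : X) (c r e : R).
Local Notation cut := (cutoff x0).

Let h_n_loc2 n : loc2 (m_ n) x0 (h_ n) := bounded_in_loc2_loc2 n h_bound.

Lemma values_bounded f : Lip_b f -> bounded_in_loc2 m_ x0 (fun n => b_ n f).
Proof.
move=> Lf; split=> [n|k]; first exact: (der_L0 (b_lin n)).
have [L [_ [L0' _ HL _]]] := (Lip_bP f).1 Lf; have [S S0 HS] := h_bound.2 k.
exists (L * S); first by rewrite mulr_ge0.
move=> n; have [sh nh] := HS n.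
have sb := (der_loc2 (b_lin n) (h_ge0 n) (b_lip n) (h_n_loc2 n) Lf).2 k.
split=> //; apply: (@le_trans _ _ (nrm (m_ n) (fun x => L * (h_ n x * cut k x)))).
  apply: le_nrm => //; first exact: sqiZ.
  apply: (ae_mp2 (b_lip n Lf) (h_ge0 n)) => x bx hx.
  rewrite mulrA !normrM ler_wpM2r// (le_trans bx)//.
  rewrite (ger0_norm L0') (ger0_norm hx) mulrC ler_wpM2r//.
  exact: lip_a_le_Lip.
by rewrite nrmZ// (ger0_norm L0') ler_wpM2l.
Qed.

Lemma values_cvgn f s : Lip_b f -> cvgn (fun n => \int[m_ n]_x (b_ n f x * tentmax d s x)).
Proof.
move=> Lf; set v := tentmax d s; have Lv : Lip_bs v by exact: tentmax_Lip_bs.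
have [Lv' /(bounded_supportP x0)[k vk]] := Lv.
have [B _ HB] := weak_limit_loc2 m_fin m_fin_lim m_cvg d_dense
  (values_bounded Lv') (@tent_cvg s).
(* [b_ n v] vanishes beyond radius [k.+1], so cutting [f] off there changes no integral and makes it
   an admissible test function. *)
have Cf : C_bs (fun x => f x * cut k.+1 x).
  by apply: Lip_bs_C_bs; apply: Lip_bs_mulr => //; exact: cutoff_Lip_bs.
have Cfv : C_bs (fun x => f x * v x) by apply: Lip_bs_C_bs; exact: Lip_bs_mulr.
apply/cvg_ex; exists (- (\int[m]_x (B x * (f x * cut k.+1 x))) - \int[m]_x (G x * (f x * v x))).
rewrite (_ : (fun n => _) = (fun n => - (\int[m_ n]_x (b_ n v x * (f x * cut k.+1 x))) -
    \int[m_ n]_x (g_ n x * (f x * v x)))); last first.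
  apply/funext => n.
  rewrite (der_by_parts (m_fin n) d_dense (b_lin n) (h_ge0 n) (b_lip n) (h_n_loc2 n) (g_div n) Lf Lv).
  congr (- _ - _); apply: (@eq_Rint_ae _ (borel X)).
  - exact: (intg_meas (der_mul_intg_bs (m_fin n) (b_lin n) (h_ge0 n) (b_lip n) (h_n_loc2 n) Lf Lv)).
  - apply: measurable_funM; first exact: (der_L0 (b_lin n)).
    exact: C_bs_L0 Cf.
  - by apply: (ae_mp (der_mul_cut (b_lip n) Lv' vk)) => x bx; rewrite {1}bx; ring.
by apply: cvgB; [apply: cvgN; exact: HB|exact: G_cvg].
Qed.

(** The value is chosen for each [f] separately; linearity then holds almost everywhere because weak
    limits are unique. *)
Definition limit_der f : X -> R := xget (cst 0) [set B | loc2 m x0 B /\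
  forall v, C_bs v -> \int[m_ n]_x (b_ n f x * v x) @[n --> \oo] --> \int[m]_x (B x * v x)].

Lemma limit_derP f : Lip_b f -> loc2 m x0 (limit_der f) /\
  forall v, C_bs v ->
    \int[m_ n]_x (b_ n f x * v x) @[n --> \oo] --> \int[m]_x (limit_der f x * v x).
Proof.
move=> Lf; rewrite /limit_der; case: xgetP => [B -> //|nB]; exfalso.
have [B lB HB] := weak_limit_loc2 m_fin m_fin_lim m_cvg d_dense
  (values_bounded Lf) (fun s => @values_cvgn f s Lf).
exact: (nB B).
Qed.

Let lim_loc1 f : Lip_b f -> loc1 m x0 (limit_der f).
Proof. by move=> /limit_derP[lB _]; exact: loc2_loc1. Qed.

Let n_intg n f v : Lip_b f -> C_bs v -> intg (m_ n) (fun x => b_ n f x * v x).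
Proof. by move=> /values_bounded bb; exact: (bounded_in_loc2_intg m_fin n bb). Qed.

Lemma limit_der_linear : Lip_b_linear m limit_der.
Proof.
split=> [f Lf|c f g Lf Lg]; first by case: (limit_derP Lf) => -[].
have Lfg : Lip_b (fun y => c * f y + g y) by apply: Lip_bD => //; exact: Lip_bZ.
have [_ Hf] := limit_derP Lf; have [_ Hg] := limit_derP Lg; have [_ Hfg] := limit_derP Lfg.
move: (lim_loc1 Lf) (lim_loc1 Lg) (lim_loc1 Lfg) Hf Hg Hfg.
move: (limit_der f) (limit_der g) (limit_der (fun y => c * f y + g y)) => A B C lA lB lC.
move=> HA HB HC; have l1 := loc1_lin c 1 lA lB; have l2 := loc1_lin 1 (-1) lC l1.
have : \forall x \ae m, 1 * C x + -1 * (c * A x + 1 * B x) = 0.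
  apply: (loc1_eq0 d_dense l2) => v Lv; have Cv := Lip_bs_C_bs Lv.
  have i1 := loc1_Lip_bs lA Lv; have i2 := loc1_Lip_bs lB Lv; have i3 := loc1_Lip_bs lC Lv.
  rewrite (@eq_Rintegral _ _ _ m _ (fun x => C x * v x - (c * (A x * v x) + B x * v x))); last first.
    by move=> x _; ring.
  rewrite (ItgB i3 (intgD (intgZ c i1) i2)) (ItgD (intgZ c i1) i2) (ItgZ c i1).
  apply/eqP; rewrite subr_eq0; apply/eqP; apply: (cvg_unique _ (HC v Cv)) => //.
  rewrite (_ : (fun n => _) = (fun n => c * \int[m_ n]_x (b_ n f x * v x) +
    \int[m_ n]_x (b_ n g x * v x))); first by apply: cvgD; [apply: cvgMr; exact: HA|exact: HB].
  have iA n := n_intg n Lf Cv; have iB n := n_intg n Lg Cv.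
  apply/funext => n; rewrite -(ItgZ c (iA n)) -(ItgD (intgZ c (iA n)) (iB n)).
  apply: (@eq_Rint_ae _ (borel X)).
  - exact: (intg_meas (n_intg n Lfg Cv)).
  - exact: (intg_meas (intgD (intgZ c (iA n)) (iB n))).
  - by apply: (ae_mp ((b_lin n).2 c f g Lf Lg)) => x ->; ring.
by move=> H; apply: (ae_mp H) => x; lra.
Qed.

Lemma limit_bound_ge0 : \forall x \ae m, 0 <= h x.
Proof.
apply: (loc1_ge0 d_dense (loc2_loc1 m_fin_lim h_loc2)) => v Lv v0.
have Cv := Lip_bs_C_bs Lv; apply: (cvgr_to_ge (h_cvg Cv)); apply: nearW => n.
rewrite -(@Itg0 _ (borel X) R (m_ n)); apply: le_Rint_ae; first exact: intg0.
  exact: (bounded_in_loc2_intg m_fin n h_bound Cv).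
by apply: (ae_mp (h_ge0 n)) => x hx; rewrite mulr_ge0.
Qed.

(** [lip_a f] need not be continuous, so weak convergence of [h_ n] says nothing about its product
    with [lip_a f]. On a ball the constant [lip_const f (ball p r)] takes its place and does pass to
    the limit. *)
Lemma limit_der_le_ball f p r (s : R) : Lip_b f -> s = 1 \/ s = -1 ->
  \forall x \ae m, mdist p x < r ->
    s * limit_der f x <= lip_const f (ball p r) * h x.
Proof.
move=> Lf s1; set c := lip_const f (ball p r); have LLf := Lip_bL Lf.
have lF := loc1_lin c (- s) (loc2_loc1 m_fin_lim h_loc2) (lim_loc1 Lf).
have [_ Hf] := limit_derP Lf.
suff H : \forall x \ae m, mdist p x < r -> 0 <= c * h x + - s * limit_der f x.
  by apply: (ae_mp H) => x + xp => /(_ xp); lra.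
apply: (loc1_ge0_ball d_dense lF) => v Lv v0 vp; have Cv := Lip_bs_C_bs Lv.
have ih n : intg (m_ n) (fun x => h_ n x * v x).
  exact: (bounded_in_loc2_intg m_fin n h_bound Cv).
have i1 := loc1_Lip_bs (loc2_loc1 m_fin_lim h_loc2) Lv.
have i2 := loc1_Lip_bs (lim_loc1 Lf) Lv.
rewrite (@eq_Rintegral _ _ _ m _ (fun x => c * (h x * v x) + - s * (limit_der f x * v x))); last first.
  by move=> x _; ring.
rewrite ItgD ?ItgZ//; [|exact: intgZ..].
have cv : c * \int[m_ n]_x (h_ n x * v x) + - s * \int[m_ n]_x (b_ n f x * v x)
    @[n --> \oo] --> c * \int[m]_x (h x * v x) + - s * \int[m]_x (limit_der f x * v x).
  by apply: cvgD; apply: cvgMr; [exact: h_cvg|exact: Hf].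
apply: (cvgr_to_ge cv); apply: nearW => n.
rewrite -ItgZ// -ItgZ ?n_intg// -ItgD; [|exact: intgZ|by apply: intgZ; exact: n_intg].
rewrite -(@Itg0 _ (borel X) R (m_ n)); apply: le_Rint_ae; first exact: intg0.
  by apply: intgD; apply: intgZ => //; exact: n_intg.
apply: (ae_mp2 (b_lip n Lf) (h_ge0 n)) => x bx hx.
have [->|vx] := eqVneq (v x) 0; first by rewrite !mulr0 addr0.
have px := vp x vx.
have lc : lip_a f x <= c.
  have r0 : 0 < r - mdist p x by rewrite subr_gt0.
  apply: (lip_a_le LLf r0); first exact: lip_const_ge0.
  apply: lip_onS (lip_constP LLf) => y /ballP xy; apply/ballP.
  by have := metric_tri x p y; lra.
rewrite (_ : _ + _ = (c * h_ n x - s * b_ n f x) * v x); last by ring.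
rewrite mulr_ge0// subr_ge0; apply: (@le_trans _ _ `|b_ n f x|).
  by case: s1 => ->; rewrite ?mul1r ?mulN1r ?ler_norm// -normrN ler_norm.
by rewrite (le_trans bx)// mulrC ler_wpM2r.
Qed.

Lemma limit_der_lip f : Lip_b f -> \forall x \ae m, `|limit_der f x| <= h x * lip_a f x.
Proof.
move=> Lf; have LLf := Lip_bL Lf.
(* Countably many balls leave one null set; shrinking balls around [x] then recover [lip_a f x] by
   upper semicontinuity. *)
have H : \forall x \ae m, forall i j, mdist (d i) x < 2^-1 ^+ j ->
    `|limit_der f x| <= lip_const f (ball (d i) (2^-1 ^+ j)) * h x.
  apply: ae_foralln => i; apply: ae_foralln => j.
  have H1 := limit_der_le_ball (d i) (2^-1 ^+ j) Lf (or_introl erefl).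
  have H2 := limit_der_le_ball (d i) (2^-1 ^+ j) Lf (or_intror erefl).
  apply: (ae_mp2 H1 H2) => x + + xi => /(_ xi); rewrite mul1r => Hx /(_ xi).
  by rewrite mulN1r ler_norml Hx andbT lerNl.
apply: (ae_mp2 H limit_bound_ge0) => x {}H hx.
apply: (@le_eps_mul _ _ _ (h x)) => e e0 e1.
have [r r0 fr] := lip_const_near x LLf e0.
have [j jr] := exp_half_small r0.
have [i ix] := d_dense x (exp_half_gt0 R j); apply: (le_trans (H i j ix)).
rewrite [leRHS](_ : _ = (lip_a f x + e) * h x); last by ring.
by rewrite ler_wpM2r// fr.
Qed.

Lemma limit_der_cvg f v : Lip_bs f -> C_b v ->
  \int[m_ n]_x (b_ n f x * v x) @[n --> \oo] --> \int[m]_x (limit_der f x * v x).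
Proof.
move=> [Lf /(bounded_supportP x0)[k fk]] Cv.
(* Since [f] has bounded support, its images under the derivations live within radius [k.+1], and a
   merely bounded continuous [v] can be cut off there. *)
have Cvc : C_bs (fun x => v x * cut k.+1 x).
  by apply: (C_bs_mul x0) => //; apply: Lip_bs_C_bs; exact: cutoff_Lip_bs.
have mv : L0 v by case: Cv => cv _; exact: continuous_L0.
have ins (mu : {measure set (borel X) -> \bar R}) b q : (forall f, Lip_b f -> L0 (b f)) ->
    (forall f, Lip_b f -> \forall x \ae mu, `|b f x| <= q x * lip_a f x) ->
    \int[mu]_x (b f x * v x) = \int[mu]_x (b f x * (v x * cut k.+1 x)).
  move=> mb bq; apply: (@eq_Rint_ae _ (borel X)).
  - by apply: measurable_funM => //; exact: mb.
  - by apply: measurable_funM; [exact: mb|exact: C_bs_L0 Cvc].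
  - by apply: (ae_mp (der_mul_cut bq Lf fk)) => x bx; rewrite {1}bx; ring.
rewrite (ins m limit_der h); [|exact: limit_der_linear.1|exact: limit_der_lip].
rewrite (_ : (fun n => _) = (fun n => \int[m_ n]_x (b_ n f x * (v x * cut k.+1 x)))).
  exact: (limit_derP Lf).2.
by apply/funext => n; apply: (ins (m_ n) (b_ n) (h_ n)); [exact: (b_lin n).1|exact: b_lip].
Qed.

(** The duality with [C_b] is tested on the constant 1. *)
Lemma limit_der_div : is_divergence m limit_der G.
Proof.
split; first exact/(loc1P m x0).
move=> f Lf; have H := limit_der_cvg Lf (C_b_cst 1).
have Cf := Lip_bs_C_bs Lf.
rewrite (@eq_Rintegral _ _ _ m _ (fun x => limit_der f x * 1)); last by move=> x _; rewrite mulr1.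
rewrite [RHS](@eq_Rintegral _ _ _ m _ (fun x => G x * f x)); last by move=> x _; rewrite mulrC.
have H' : - (\int[m_ n]_x (b_ n f x * 1)) @[n --> \oo] --> - \int[m]_x (limit_der f x * 1).
  exact: cvgN.
apply: (cvg_unique _ H') => //.
rewrite (_ : (fun n => _) = (fun n => \int[m_ n]_x (g_ n x * f x))); first exact: G_cvg.
apply/funext => n; rewrite (@eq_Rintegral _ _ _ (m_ n) _ (b_ n f)); last by move=> x _; rewrite mulr1.
by rewrite (g_div n).2//; apply: eq_Rintegral => x _; rewrite mulrC.
Qed.

Theorem limit_der_Der_loc : Der_loc m 2 limit_der /\ Div1_loc m limit_der.
Proof.
have bh := der_bound_slope m_fin_lim d_dense limit_der_linear limit_bound_ge0
  limit_der_lip h_loc2 limit_der_div.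
exact: Der_loc_Div1_loc limit_der_linear bh h_loc2 limit_der_div.
Qed.

End limit_derivation.

(* The integral of a nonnegative function is a supremum over the simple functions
   below it, so [g] need not be measurable. *)
Lemma ge0_le_integral_supported d (T : measurableType d) (R : realType)
  (mu : {measure set T -> \bar R}) (D : set T) (f g : T -> \bar R) :
  (forall x, 0 <= f x)%E -> (forall x, ~ D x -> f x = 0%E) ->
  (forall x, D x -> (f x <= g x)%E) ->
  (\int[mu]_x f x <= \int[mu]_(x in D) g x)%E.
Proof.
move=> f0 fD fg; rewrite !ge0_integralE//; last by move=> x /fg; exact: le_trans.
apply: le_ereal_sup => _ [s sf <-]; exists s => //= x; apply: (le_trans (sf x)).
rewrite patch_setT /patch; case: ifPn => [/set_mem/fg//|/negP xD].
by rewrite fD// => Dx; apply: xD; exact/mem_set.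
Qed.

Lemma ereal_sup_ltyP (R : realType) (F : nat -> \bar R) : (ereal_sup (range F) < +oo)%E ->
  exists2 S : R, 0 <= S & forall n, (F n <= S%:E)%E.
Proof.
move=> FS; have Fle n : (F n <= ereal_sup (range F))%E by apply: ereal_sup_ubound; exists n.
move: FS Fle; case: (ereal_sup _) => [r| |] // _ Fle.
  exists (Num.max r 0); first by rewrite le_max lexx orbT.
  by move=> n; rewrite (le_trans (Fle n))// lee_fin le_max lexx.
by exists 0 => // n; rewrite (le_trans (Fle n))// leNye.
Qed.

(** * Uniform bounds and extraction of a subsequence *)

Section extraction.
Context {R : realType} {X : completeMetricType R}.
Variables (m_ : nat -> {measure set (borel X) -> \bar R})
  (m : {measure set (borel X) -> \bar R}).
Hypothesis m_fin : forall n, finite_on_bounded (m_ n).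
Hypothesis m_cvg : weak_measure_cvg m_ m.
Variable d : nat -> X.
Variable x0 : X.
Implicit Types (b g h : nat -> X -> R) (v : X -> R).
Local Notation cut := (cutoff x0).
Local Notation code := (nat * rat * nat)%type.

Lemma pairing_bounded b v : bounded_in_loc2 m_ x0 b -> C_bs v ->
  exists M : R, forall n, `|\int[m_ n]_x (b n x * v x)| <= M.
Proof.
move=> bb Cv; have /(C_bsP x0)[c [k [_ _ _ vk]]] := Cv.
have [S S0 HS] := bb.2 k.
have [B HB] := nrm_C_bs_bounded m_cvg x0 Cv.
exists (S * B) => n; have [sb nb] := HS n.
apply: (le_trans (pairing_le sb (C_bs_sqi x0 (m_fin n) Cv) vk)).
by apply: ler_pM; rewrite ?nrm_ge0.
Qed.

Lemma weak_extraction (I : countType) (F : I -> nat -> X -> R) :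
  (forall i, bounded_in_loc2 m_ x0 (F i)) ->
  exists2 k : nat -> nat, {homo k : i j / (i < j)%N} & forall i (s : seq code),
    cvgn (fun n => \int[m_ (k n)]_x (F i (k n) x * tentmax d s x)).
Proof.
move=> bF; pose a j n := if unpickle j is Some (i, s) then
  \int[m_ n]_x (F i n x * tentmax d (s : seq code) x) else 0.
have [|k km kc] := @diagonal_extraction _ a.
  move=> j; rewrite /a; case: (unpickle j) => [[i s]|]; last by exists 0 => n; rewrite normr0.
  by apply: pairing_bounded => //; apply: Lip_bs_C_bs; exact: tentmax_Lip_bs.
by exists k => // i s; have := kc (pickle (i, s)); rewrite /a pickleK.
Qed.

Lemma bounded_in_loc2_comp b (k : nat -> nat) : bounded_in_loc2 m_ x0 b ->
  bounded_in_loc2 (fun n => m_ (k n)) x0 (fun n => b (k n)).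
Proof.
move=> [mb bb]; split=> [n|j]; first exact: mb.
by have [S S0 HS] := bb j; exists S => // n; exact: HS.
Qed.

Lemma bounded_in_loc2_of_ball h : (forall n, loc2 (m_ n) x0 (h n)) ->
  (forall r : R, 0 < r -> (ereal_sup (range (fun n =>
     \int[m_ n]_(x in ball x0 r) (h n x ^+ 2)%:E)) < +oo)%E) ->
  bounded_in_loc2 m_ x0 h.
Proof.
move=> lh hb; split=> [n|k]; first by case: (lh n).
have [S S0 HS] := ereal_sup_ltyP (hb k.+1%:R (ltr0Sn _ _)).
exists (Num.sqrt S); first exact: sqrtr_ge0.
move=> n; have sh := (lh n).2 k; split=> //.
rewrite nrm_def ler_wsqrtr// ipE -lee_fin -intg_fin; last by case: sh.
apply: le_trans (HS n); apply: (@ge0_le_integral_supported _ (borel X)) => [x|x xk|x _].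
- by rewrite lee_fin sqr_ge0.
- by rewrite cutoff_eq0 ?mulr0 ?expr0n// leNgt; apply/negP => /ballP.
rewrite lee_fin; apply: ler_sqr_norm; rewrite normrM ler_piMr//; exact: cut_norm.
Qed.

(** The de la Vallee-Poussin criterion: above a level [M] independent of [n] the function [Theta]
    dominates [K * z], so [K] times the tail is at most the uniform bound [S]. The radius is [k.+1]
    because [cut k] vanishes beyond it. *)
Lemma superlinear_tails g (Theta : R -> R -> \bar R) :
  (forall n, loc1 (m_ n) x0 (g n)) ->
  (forall r z, 0 < r -> 0 <= z -> (0 <= Theta r z)%E) ->
  (forall r, 0 < r -> (Theta r z * z^-1%:E)%E @[z --> +oo%R] --> +oo%E) ->
  (forall r, 0 < r -> (ereal_sup (range (fun n =>
     \int[m_ n]_(x in ball x0 r) Theta r `|g n x|%R)) < +oo)%E) ->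
  forall (k : nat) e, 0 < e -> exists M : nat, forall n,
    \int[m_ n]_x (excess M%:R (g n x) * cut k x) <= e.
Proof.
move=> lg T0 Tsup Tb k e e0; have r0 : 0 < k.+1%:R :> R by [].
have [S S0 HS] := ereal_sup_ltyP (Tb _ r0).
(* [S + 1] instead of [S] keeps [K] positive when [S = 0]. *)
pose K := (S + 1) / e; have K0 : 0 < K by rewrite divr_gt0// ltr_wpDl.
have [M [M1 HM]] : exists M : nat, (0 < M)%N /\
    forall z, M%:R < z -> ((K * z)%:E <= Theta k.+1%:R z)%E.
  have /cvgeyPge/(_ K)[A [_ HA]] := Tsup _ r0.
  exists (Num.truncn A).+1; split=> // z Mz.
  have Az : A < z by apply: lt_trans Mz; exact: truncnS_gt.
  have z0 : 0 < z by apply: le_lt_trans Mz.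
  have := HA z Az; rewrite lee_pdivlMr//.
exists M => n.
have iex : intg (m_ n) (fun x => excess M%:R (g n x) * cut k x).
  apply: intg_le (intg_norm ((lg n).2 k)).
    by apply: measurable_funM; [apply: excess_L0; case: (lg n)|exact: cut_L0].
  move=> x; rewrite !normrM ler_wpM2r// ger0_norm ?excess_ge0//.
  exact: excess_le.
suff : K * \int[m_ n]_x (excess M%:R (g n x) * cut k x) <= S.
  move=> H; rewrite -(ler_pM2l K0) (le_trans H)// /K divfK ?gt_eqF//.
  by rewrite lerDl.
rewrite -ItgZ// -lee_fin -intg_fin; last exact: intgZ.
apply: le_trans (HS n); apply: (@ge0_le_integral_supported _ (borel X)) => [x|x xk|x _].
- by rewrite lee_fin (mulr_ge0 (ltW K0))// mulr_ge0 ?excess_ge0 ?cutoff_ge0.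
- by rewrite cutoff_eq0 ?mulr0// leNgt; apply/negP => /ballP.
have [gM|gM] := leP `|g n x| M%:R.
  by rewrite /excess max_l ?subr_le0// mul0r mulr0 T0.
apply: le_trans (HM _ gM); rewrite lee_fin ler_pM2l//.
rewrite -[leRHS]mulr1; apply: ler_pM; rewrite ?excess_ge0 ?cutoff_ge0 ?cutoff_le1//.
exact: excess_le.
Qed.

End extraction.

(** * Lipschitz regularity of the algebra *)

Section algebra.
Context {R : realType} {X : completeMetricType R}.
Implicit Types (f : X -> R) (D : set X).

(** Bounded Lipschitz functions form a lattice algebra over the rationals containing the truncated
    distances, so minimality of the algebra applies. *)
Lemma algA_Lip_b D f : algA D f -> Lip_b f.
Proof.
apply: smallest_sub => [|g [x [k [_ k0 ->]]]].
  split=> [|g h|q g|g h|g h].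
  - exact: (Lip_b_cst 0).
  - exact: Lip_bD.
  - exact: Lip_bZ.
  - exact: Lip_bM.
  - by move=> Lg Lh; split; [exact: Lip_b_max|exact: Lip_b_min].
have k0' : 0 <= ratr k :> R by rewrite ler0q.
apply/Lip_bP; exists 1, (ratr k); split=> //.
  move=> y z _ _; rewrite mul1r.
  have := metric_tri z y x; have := metric_tri y z x; have := metric_sym z y.
  have := mdist_ge0 y z; rewrite ler_norml /Num.min; do ![case: ifPn]; rewrite -?leNgt => *; lra.
by move=> y; rewrite ger0_norm ?le_min ?mdist_ge0// ge_min lexx orbT.
Qed.

Lemma algA_bs_Lip_bs D f : algA_bs D f -> Lip_bs f.
Proof. by move=> [/algA_Lip_b]. Qed.

End algebra.

Theorem theorem4p1 (R : realType) (X : completeMetricType R)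
    (D : set X) (D_countable : countable D) (D_dense : dense D)
    (m_ : nat -> {measure set (borel X) -> \bar R})
    (m : {measure set (borel X) -> \bar R})
    (m_fin : forall n, finite_on_bounded (m_ n)) (m_fin_lim : finite_on_bounded m)
    (m_cvg : weak_measure_cvg m_ m)
    (b_ : nat -> (X -> R) -> X -> R)
    (b_der : forall n, Der_loc (m_ n) 2 (b_ n) /\ Div1_loc (m_ n) (b_ n))
    (xbar : X) (Theta : R -> R -> \bar R)
    (Theta_ge0 : forall r z, 0 < r -> 0 <= z -> (0 <= Theta r z)%E)
    (Theta_superlinear : forall r, 0 < r ->
      (Theta r z * z^-1%:E)%E @[z --> +oo%R] --> +oo%E)
    (norm_bound : forall r, 0 < r ->
      (ereal_sup (range (fun n =>
        \int[m_ n]_(x in ball xbar r) (der_norm (m_ n) (b_ n) x ^+ 2)%:E))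
       < +oo)%E)
    (div_bound : forall r, 0 < r ->
      (ereal_sup (range (fun n =>
        \int[m_ n]_(x in ball xbar r)
          Theta r `|divergence (m_ n) (b_ n) x|%R))
       < +oo)%E) :
  exists (k : nat -> nat) (b : (X -> R) -> X -> R),
    [/\ {homo k : i j / (i < j)%N},
        Der_loc m 2 b /\ Div1_loc m b &
        forall f v, algA_bs D f -> C_b v ->
          (\int[m_ (k i)]_x (b_ (k i) f x * v x)) @[i --> \oo] -->
            \int[m]_x (b f x * v x)].
Proof.
have [d d_dense] := dense_sequence xbar D_countable D_dense.
pose h_ n := der_norm (m_ n) (b_ n); pose g_ n := divergence (m_ n) (b_ n).
have hP n := der_normP xbar (b_der n).1.
have g_div n : is_divergence (m_ n) (b_ n) (g_ n) := divergenceP (b_der n).2.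
have b_lin n : Lip_b_linear (m_ n) (b_ n) by case: (b_der n) => -[[]].
have h_ge0 n : \forall x \ae m_ n, 0 <= h_ n x by have [[[_ h0 _] _] _] := hP n.
have b_lip n f : Lip_b f -> \forall x \ae m_ n, `|b_ n f x| <= h_ n x * lip_a f x.
  move=> Lf; have [[[_ _ bh] _] _] := hP n.
  apply: (ae_mp3 (bh f Lf) (h_ge0 n) (slope_le_lip_a (m_fin n) d_dense xbar Lf)) => x bx hx sx.
  by rewrite (le_trans bx)// ler_wpM2l.
have lh n : loc2 (m_ n) xbar (h_ n) by case: (hP n).
have h_bound : bounded_in_loc2 m_ xbar h_ := bounded_in_loc2_of_ball lh norm_bound.
have lg n : loc1 (m_ n) xbar (g_ n) by apply/loc1P; case: (g_div n).
have tails := superlinear_tails lg Theta_ge0 Theta_superlinear div_bound.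
clear hP; clearbody h_ g_.
(* One subsequence must serve the values on maxima of tents, the norms, and the divergences
   truncated at every integer level; a countable sum type indexes the three families together. *)
pose F (i : seq (nat * rat * nat) + option nat) n := match i with
  | inl s => b_ n (tentmax d s) | inr None => h_ n
  | inr (Some M) => fun x => clip M%:R (g_ n x) end.
have bF i : bounded_in_loc2 m_ xbar (F i).
  case: i => [s|[M|]] //=.
  - by apply: (values_bounded b_lin h_ge0 b_lip h_bound); exact: tentmax_Lip_b.
  - apply: (bounded_in_loc2_of_bound m_fin m_cvg) => [n|n x]; last exact: clip_norm.
    by apply: clip_L0; case: (lg n).
have [k k_incr kF] := weak_extraction m_fin m_cvg d bF.
have k_infty : k @ \oo --> \oo.
  have nk n : (n <= k n)%N.
    elim: n => // n IH; exact: leq_ltn_trans IH (k_incr _ _ (ltnSn n)).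
  by move=> A [N _ NA]; exists N => // n /= Nn; apply: NA; exact: leq_trans Nn (nk n).
have mk_cvg : weak_measure_cvg (fun n => m_ (k n)) m.
  by move=> v Cv; exact: (cvg_comp _ _ k_infty (m_cvg v Cv)).
have mk_fin n : finite_on_bounded (m_ (k n)) by [].
have hk_bound := bounded_in_loc2_comp k h_bound.
have [h lh_lim h_cvg] := weak_limit_loc2 mk_fin m_fin_lim mk_cvg d_dense hk_bound
  (fun s => kF (inr None) s).
have [G lG G_cvg] := weak_limit_loc1 mk_fin m_fin_lim mk_cvg d_dense (fun n => lg (k n))
  (fun j e e0 => let: ex_intro M HM := tails j e e0 in ex_intro _ M (fun n => HM (k n)))
  (fun M s => kF (inr (Some M)) s).
have bk_lin n := b_lin (k n); have hk_ge0 n := h_ge0 (k n); have bk_lip n := b_lip (k n).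
have gk_div n := g_div (k n); have tk s := kF (inl s).
exists k, (limit_der (fun n => m_ (k n)) m xbar (fun n => b_ (k n))); split=> //.
  exact: (limit_der_Der_loc mk_fin m_fin_lim mk_cvg d_dense bk_lin hk_ge0 bk_lip hk_bound
    gk_div lh_lim h_cvg lG G_cvg tk).
move=> f v /algA_bs_Lip_bs Lf Cv.
exact: (limit_der_cvg mk_fin m_fin_lim mk_cvg d_dense bk_lin hk_ge0 bk_lip hk_bound gk_div
  lh_lim h_cvg G_cvg tk Lf Cv).
Qed.
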